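(* Let $a>0$, $1=\sigma_0>\sigma_1>\dots>\sigma_h>0$ real numbers, $\ell\ge2$, $s_1+\dots+s_\ell=n$ with $s_i\in\mathbb N_{>0}$, and let the parameter be $\omega:=(\boldsymbol\lambda_1,\dots,\boldsymbol\lambda_\ell)\in\Omega\subset\mathbb C^m$, $m=\ell(h+1)$, with $\boldsymbol\lambda_i=(\lambda_i^{(0)},\dots,\lambda_i^{(h)})$. Consider the differential equation $$\frac{dY}{dz}=\left(\Lambda(z,\omega)+R(z,\omega)\right)Y,\qquad \Lambda(z,\omega)=\bigoplus_{i=1}^\ell\sum_{k=0}^h\sigma_k\lambda_i^{(k)}z^{\sigma_k-1}I_{s_i},$$ where: (a) $\Omega$ is a bounded open connected domain; (b) $\boldsymbol\lambda_i\ne\boldsymbol\lambda_j$ for any $i\ne j$, and moreover $\lambda_{ij}\ne0$ on the closure $\overline\Omega$ (equivalently the degree of $q_i(z,\omega)-q_j(z,\omega)$ is constant); (c) $\sigma_0,\dots,\sigma_h$ are independent of the parameters; (e) the enumeration of the determinations of $\arg\lambda_{ij}$ described in the context is preserved on $\overline\Omega$ for a fixed $\eta$; and $R\in\mathscr O(\widetilde{\mathbb C}_a\times\Omega;\mathfrak{gl}(n,\mathbb C))$ satisfies the uniform good decay condition on any open interval. Let $\boldsymbol k\in\mathbb Z^\mu$ be adequate with respect to $(\sigma^{(\rho)};\tau_\rho)_{\rho=0}^{\mu-1}$ on $\Omega$, i.e. the open interval $$\Sigma_{\boldsymbol k}:=\bigcap_{\omega\in\overline\Omega}\left(\bigcap_{\rho=0}^{\mu-1}\left]\tau_\rho(\omega)+\frac{k_\rho\pi}{\sigma^{(\rho)}}-\pi;\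 \tau_\rho(\omega)+\frac{k_\rho\pi}{\sigma^{(\rho)}}\right[\right)=:\left]a_{\boldsymbol k};b_{\boldsymbol k}\right[$$ is non-empty. Then there exists a unique holomorphic fundamental matrix solution $Y_{\boldsymbol k}\colon(\mathbb H_{I,a}\cap\widetilde{\mathbb C}_a)\times\Omega\to GL(n,\mathbb C)$, where $I=\Sigma_{\boldsymbol k}+\frac\pi2$, with asymptotic behaviour $$Y_{\boldsymbol k}(z,\omega)=\left(I_n+o(1)\right)\exp\{Q(z,\omega)\},\quad\text{uniformly in }\Omega,$$ for $z\to\infty$ in any closed subsector of $S_{\boldsymbol k}:=\{z\in\widetilde{\mathbb C^*}\mid a_{\boldsymbol k}<\arg z<b_{\boldsymbol k}+\pi\}$.
   Context: Notation. $\widetilde{\mathbb C^*}$ is the universal cover of $\mathbb C^*$; its points have modulus $|z|>0$ and argument $\arg z\in\mathbb R$, and $z^s=|z|^se^{\sqrt{-1}s\arg z}$. $\widetilde{\mathbb C}_a:=\{z\in\widetilde{\mathbb C^*}:|z|>a\}$. $\mathbb H_{\phi,b}:=\{z\in\widetilde{\mathbb C^*}:\arg z\in\left]\phi-\frac\pi2;\phi+\frac\pi2\right[,\ |z|\ge\frac{b}{\cos(\phi-\arg z)}\}$, $\ell_{\phi,b}:=\partial\mathbb H_{\phi,b}$, $\mathbb H_{I,b}:=\bigcup_{\phi\in I}\mathbb H_{\phi,b}$. $\mathfrak{gl}(n,\mathbb C)$ carries an arbitrary norm; $\mathscr O(D;V)$ is the space of $V$-valued holomorphic functions on $D$. $Q(z,\omega):=q_1(z,\omega)I_{s_1}\oplus\dots\oplus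 q_\ell(z,\omega)I_{s_\ell}$, $q_i(z,\omega):=\sum_{k=0}^h\lambda_i^{(k)}z^{\sigma_k}$. For $i\ne j$, $k_{ij}:=\min\{k\mid\lambda_i^{(k)}-\lambda_j^{(k)}\ne0\}$ (independent of $\omega$ by (b)), $\lambda_{ij}:=\lambda_i^{(k_{ij})}-\lambda_j^{(k_{ij})}$, a function of $\omega$. Uniform good decay condition on an open interval $I$: there is a positive function $g$ which, for any closed interval $J\subseteq I$, is $L^1$-integrable (arc length) along every $\ell_{\phi,b}$, $\phi\in J$, $b>a$, with $|R(z,\omega)|\le g(z)$ almost everywhere on $\ell_{\phi,b}$ for all $\omega\in\Omega$, and $\lim_{b\to+\infty}\big(\sup_{\omega\in\Omega}\sup_{\phi\in J}\|R(\cdot,\omega)|_{\ell_{\phi,b}}\|_1\big)=0$. Enumeration and condition (e). There is a fixed $\eta\in\mathbb R$ with $\eta\ne\arg\lambda_{ij}(\omega)\bmod\pi$ for all $i\ne j$ and all $\omega\in\overline\Omega$. For each $\omega$ the distinct values of the determinations $\arg\lambda_{ij}(\omega)\in\left]\eta-\pi;\eta\right[$ are enumerated as $\eta_{\widetilde\mu-1}<\dots<\eta_1<\eta_0$; condition (e) says that this enumeration (which pairs $(i,j)$ occur, and the equalities and strict inequalities between their arguments) is the same for all $\omega\in\overline\Omega$. For pairs $(i,j)$ with $\arg\lambda_{ij}\in\left]\eta-\pi;\eta\right[$, put $\tau_{ij}(\omega):=\frac1{\sigma_{k_{ij}}}\left(\frac{3\pi}2-\arg\lambda_{ij}(\omega)\right)$.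 The distinct couples $(\sigma_{k_{ij}};\tau_{ij})$ are enumerated as $(\sigma^{(\rho)};\tau_\rho)$, $\rho=0,\dots,\mu-1$, with $\tau_0\le\dots\le\tau_{\mu-1}$ (pairs with equal $\tau_{ij}$ and equal $\sigma_{k_{ij}}$ get the same label; pairs with equal $\tau_{ij}$ but different $\sigma_{k_{ij}}$ get different consecutive labels); $\tau_\rho(\omega)$ depends continuously on $\omega$. *)

(* Defs.v *)
From HB Require Import structures.
From mathcomp Require Import all_boot all_order all_algebra.
From mathcomp Require Import all_classical all_reals all_analysis.
From mathcomp Require Export complex.

Set Implicit Arguments.
Unset Strict Implicit.
Unset Printing Implicit Defensive.

Import Order.TTheory GRing.Theory Num.Theory.
Import numFieldTopology.Exports numFieldNormedType.Exports.

Local Open Scope classical_set_scope.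
Local Open Scope complex_scope.
Local Open Scope ring_scope.

(* The standard topology and norm of R[i], as a normed space over itself. *)
HB.instance Definition _ (R : rcfType) :=
  PseudoPointedMetric.copy R[i] (R[i])^o.
HB.instance Definition _ (R : rcfType) := NormedModule.copy R[i] (R[i])^o.

Section Exponentials.
Context {R : realType}.

Definition cexp (z : R[i]) : R[i] :=
  (expR (complex.Re z) * cos (complex.Im z))
    +i* (expR (complex.Re z) * sin (complex.Im z)).

Definition mexp n (A : 'M[R[i]]_n) : 'M[R[i]]_n :=
  limn (fun N : nat => \sum_(0 <= k < N) (k`!%:R : R[i])^-1 *: A ^+ k).

Definition is_arg (z : R[i]) (t : R) : Prop := z = `|z| * cexp (0 +i* t).

Definition is_norm n (N : 'M[R[i]]_n -> R) : Prop :=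
  [/\ forall A B, N (A + B) <= N A + N B,
      forall c A, (N (c *: A))%:C = `|c| * (N A)%:C &
      forall A, N A = 0 -> A = 0].

End Exponentials.

(* The universal cover of C^* is modelled by R[i] with covering map cexp: the
   point w has modulus e^(Re w) and argument Im w, and w = log z is a global
   holomorphic chart. *)
Section UniversalCover.
Context {R : realType}.
Implicit Types (w : R[i]) (phi b s t : R).

Definition umod w : R := expR (complex.Re w).
Definition uarg w : R := complex.Im w.

Definition upow w s : R[i] := (umod w `^ s)%:C * cexp (0 +i* (s * uarg w)).

Definition ucover_gt (a : R) : set R[i] := [set w | a < umod w].

Definition halfplane phi b : set R[i] :=
  [set w | phi - pi / 2 < uarg w < phi + pi / 2 /\
           b / cos (phi - uarg w) <= umod w].

Definition halfplanes (I : set R) b : set R[i] :=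
  \bigcup_(phi in I) halfplane phi b.

(* For b > 0 the boundary of halfplane phi b is the lift of the line
   z = e^(i phi) (b + i t), on which t is the arc length. *)
Definition ell phi b t : R[i] :=
  ln (Num.sqrt (b ^+ 2 + t ^+ 2)) +i* (phi + atan (t / b)).

(* Derivative with respect to z, not to the logarithmic coordinate w. *)
Definition is_dz n (f : R[i] -> 'M[R[i]]_n) w (df : 'M[R[i]]_n) : Prop :=
  (cexp u - cexp w)^-1 *: (f u - f w) @[u --> w^'] --> df.

(* Differentiability is over the field R[i], i.e. complex. *)
Definition holomorphic_on p q n (D : set R[i]) (Omega : set 'M[R[i]]_(p, q))
    (F : R[i] -> 'M[R[i]]_(p, q) -> 'M[R[i]]_n) : Prop :=
  forall w omega, D w -> Omega omega ->
    differentiable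
      (fun x : (R[i] * 'M[R[i]]_(p, q))%type => F x.1 x.2) (w, omega).

Definition good_decay p q n (N : 'M[R[i]]_n -> R) (a : R)
    (Omega : set 'M[R[i]]_(p, q))
    (F : R[i] -> 'M[R[i]]_(p, q) -> 'M[R[i]]_n) (I : set R) : Prop :=
  exists g : R[i] -> R, (forall w, 0 < g w) /\
  forall c d : R, c <= d -> `[c, d] `<=` I ->
    (forall phi b, c <= phi <= d -> a < b ->
       lebesgue_measure.-integrable setT (fun t : R => (g (ell phi b t))%:E) /\
       forall omega, Omega omega ->
         {ae lebesgue_measure, forall t : R,
            N (F (ell phi b t) omega) <= g (ell phi b t)}) /\
    ereal_sup [set
      ereal_sup [set
        (\int[lebesgue_measure]_t (N (F (ell phi b t) omega))%:E)%E
        | phi in `[c, d]]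
      | omega in Omega] @[b --> +oo] --> 0%E.

End UniversalCover.

(* The parameter omega is an l x h.+1 matrix whose i-th row is
   (lambda_i^(0), ..., lambda_i^(h)); F is the perturbation R(z, omega). *)
Section System.
Context {R : realType} {l h : nat}.
Variables (s : 'I_l -> nat) (sigma : 'I_h.+1 -> R).
Implicit Types (w : R[i]) (omega : 'M[R[i]]_(l, h.+1))
  (Omega : set 'M[R[i]]_(l, h.+1)) (i j : 'I_l).

Definition q_fun w omega i : R[i] :=
  \sum_(k < h.+1) omega i k * upow w (sigma k).

Definition Q_mx w omega : 'M[R[i]]_(\sum_(i < l) s i) :=
  \mxdiag_(i < l) (q_fun w omega i)%:M.

Definition Lambda_mx w omega : 'M[R[i]]_(\sum_(i < l) s i) :=
  \mxdiag_(i < l)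
    (\sum_(k < h.+1) (sigma k)%:C * omega i k * upow w (sigma k - 1))%:M.

(* The default value ord0 is only reached when the rows i and j agree. *)
Definition k_first omega i j : 'I_h.+1 :=
  [arg min_(k < ord0 | omega i k != omega j k) k].

Definition lam omega i j : R[i] :=
  omega i (k_first omega i j) - omega j (k_first omega i j).

Definition constant_degrees Omega : Prop :=
  forall i j, i != j ->
    [/\ forall omega, Omega omega -> row i omega <> row j omega,
        forall omega, closure Omega omega -> lam omega i j != 0 &
        forall omega omega', closure Omega omega -> closure Omega omega' ->
          k_first omega i j = k_first omega' i j].

Definition arg_window (eta : R) (z : R[i]) : set R :=
  [set t | eta - pi < t < eta /\ is_arg z t].

(* For z != 0, arg_window eta z has at most one element. *)
Definition arg_det (eta : R) (z : R[i]) : R := xget 0 (arg_window eta z).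

Definition windowed (eta : R) omega i j : Prop :=
  i != j /\ arg_window eta (lam omega i j) !=set0.

(* Comparing by <= records both the equalities and the strict inequalities. *)
Definition preserved_enumeration (eta : R) Omega : Prop :=
  [/\ forall omega i j t (m : int), closure Omega omega -> i != j ->
        is_arg (lam omega i j) t -> eta <> t + m%:~R * pi,
      forall omega omega' i j, closure Omega omega -> closure Omega omega' ->
        windowed eta omega i j -> windowed eta omega' i j &
      forall omega omega' i j i' j',
        closure Omega omega -> closure Omega omega' ->
        windowed eta omega i j -> windowed eta omega i' j' ->
        arg_det eta (lam omega i j) <= arg_det eta (lam omega i' j') ->
        arg_det eta (lam omega' i j) <= arg_det eta (lam omega' i' j')].

Definition tau_pair (eta : R) omega i j : R :=
  (3 * pi / 2 - arg_det eta (lam omega i j)) / sigma (k_first omega i j).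

Definition tau_enumeration (eta : R) Omega (mu : nat) (sg : 'I_mu -> R)
    (tau : 'I_mu -> 'M[R[i]]_(l, h.+1) -> R) : Prop :=
  (forall omega, closure Omega omega ->
     [/\ injective (fun rho => (sg rho, tau rho omega)),
         range (fun rho => (sg rho, tau rho omega)) =
           [set (sigma (k_first omega p.1 p.2), tau_pair eta omega p.1 p.2)
            | p in [set p : 'I_l * 'I_l | windowed eta omega p.1 p.2]] &
         forall rho rho' : 'I_mu, (rho <= rho')%N ->
           tau rho omega <= tau rho' omega]) /\
  (forall rho, {within closure Omega, continuous (tau rho)}).

Definition Sigma_set Omega (mu : nat) (sg : 'I_mu -> R)
    (tau : 'I_mu -> 'M[R[i]]_(l, h.+1) -> R) (k : 'I_mu -> int) : set R :=
  \bigcap_(omega in closure Omega) \bigcap_(rho in [set: 'I_mu])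
    [set` `]tau rho omega + (k rho)%:~R * pi / sg rho - pi,
            tau rho omega + (k rho)%:~R * pi / sg rho[].

(* E is the o(1) term: it tends to 0, uniformly in omega, along every closed
   subsector c <= arg z <= d of the open sector alpha < arg z < beta, whose
   points of large modulus are in the domain D. *)
Definition fundamental_solution (N : 'M[R[i]]_(\sum_(i < l) s i) -> R)
    (F : R[i] -> 'M[R[i]]_(l, h.+1) -> 'M[R[i]]_(\sum_(i < l) s i))
    (D : set R[i]) Omega (alpha beta : R)
    (Y : R[i] -> 'M[R[i]]_(l, h.+1) -> 'M[R[i]]_(\sum_(i < l) s i)) : Prop :=
  [/\ holomorphic_on D Omega Y,
      forall w omega, D w -> Omega omega -> Y w omega \in unitmx,
      forall w omega, D w -> Omega omega ->
        is_dz (Y ^~ omega) w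
          ((Lambda_mx w omega + F w omega) *m Y w omega) &
      exists E : R[i] -> 'M[R[i]]_(l, h.+1) -> 'M[R[i]]_(\sum_(i < l) s i),
        (forall w omega, D w -> Omega omega ->
           Y w omega = (1%:M + E w omega) *m mexp (Q_mx w omega)) /\
        forall c d eps : R, alpha < c -> c <= d -> d < beta -> 0 < eps ->
          exists M : R, forall w omega, c <= uarg w <= d -> M < umod w ->
            Omega omega -> D w /\ N (E w omega) < eps].

End System.

(* Main.v *)
(* On the universal cover take w = log z as coordinate, and for a direction phi in
   Sigma + pi/2 put x = z e^(-i phi), so that the half-plane H_(phi,b) becomes Re x > b.
   Writing Y = X e^Q, the entries of X solve
     X_ij(x) = delta_ij - int e^(p(x) - p(x')) (e^(i phi) R X)_ij(x') dx',   p = q_i - q_j,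
   where x' runs along the vertical line through x towards infinity.  For large Re x the
   real part of p is monotone on vertical lines (adequacy of k keeps the leading term of
   its derivative away from 0, and the sense is the same for every parameter because
   Omega is connected); choosing the end at which it increases, the kernel has modulus at most 1,
   and the decay of the L^1-norm of R on l_(phi,b) makes the Picard iteration
   contract and gives X = 1 + o(1), uniformly in the parameters.  The integral equation
   returns a solution of the differential equation because a primitive W of the
   integrand is holomorphic and its limit at the end of a vertical line does not depend
   on the line.

   Two solutions asymptotic to e^Q on the sector common to two of these half-planes differ
   by a constant matrix C with e^Q C e^(-Q) -> 1 there.  For i <> j this sector contains
   a direction where the leading term of Re (q_i - q_j) changes sign, hence a ray on which
   Re (q_i - q_j) >= 0 eventually; so C_ij = 0, and C = 1.  This glues the solutions
   belonging to different directions, and proves uniqueness. *)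

From HB Require Import structures.
Require Import Defs.
From mathcomp Require Import all_boot all_order all_algebra.
From mathcomp Require Import all_classical all_reals all_analysis.
From mathcomp Require Import measurable_realfun.
From mathcomp Require Import ring lra.

Set Implicit Arguments.
Unset Strict Implicit.
Unset Printing Implicit Defensive.

Import Order.TTheory GRing.Theory Num.Theory.
Import numFieldTopology.Exports numFieldNormedType.Exports.

Local Open Scope classical_set_scope.
Local Open Scope complex_scope.
Local Open Scope ring_scope.

(** * Derivatives and integrals along real segments *)

(** The integral equation is solvable only where [Re x] is large, and every direction yields its own
    solution there. All of them are therefore written as [Phi *m C], with one fundamental matrix
    [Phi] of the whole domain [|z| > a] and a matrix [C] depending on the parameters alone.
    Continuation to small [|z|] is then automatic, gluing becomes an equality of matrices [C],
    checked along rays and parameter by parameter, and holomorphy in the parameters is inherited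
    from a single [C]. In the coordinate [log z] the domain is a half-plane, so [Phi] comes from
    Picard iteration on a star-shaped set and its inverse [Psi] from the adjoint system. Holomorphy
    is joint in [z] and in a matrix of parameters, so limits and integrals have to be shown
    differentiable on normed spaces over [R[i]]. This rests on Cauchy estimates on complex lines,
    turned into inequalities between finite differences. The recurring factors [2] come from
    estimating real and imaginary parts separately; they only affect how small the decay integral
    must be. *)

Section RealNorm.
Context {R : realType}.
Implicit Types (V W : normedModType R[i]).

(** The norm of a normed module over [R[i]] is an element of [R[i]]. It is real and nonnegative, and
    [rn] is the same number in [R], where the order is total and real arithmetic applies. *)
Definition rn {V} (x : V) : R := complex.Re `|x|.

Lemma rnE V (x : V) : `|x| = (rn x)%:C.
Proof. by rewrite /rn RRe_real// ger0_real. Qed.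

Lemma rn_ge0 V (x : V) : 0 <= rn x.
Proof. by rewrite -ler0c -rnE. Qed.

Lemma rnD V (x y : V) : rn (x + y) <= rn x + rn y.
Proof. by rewrite -lecR rmorphD/= -!rnE ler_normD. Qed.

Lemma rnN V (x : V) : rn (- x) = rn x.
Proof. by rewrite /rn normrN. Qed.

Lemma rnB V (x y : V) : rn (x - y) <= rn x + rn y.
Proof. by rewrite -(rnN y) rnD. Qed.

Lemma rnC V (x y : V) : rn (x - y) = rn (y - x).
Proof. by rewrite -rnN opprB. Qed.

Lemma rn_dist V (x y : V) : `|rn x - rn y| <= rn (x - y).
Proof.
have := rnD (x - y) y; have := rnD (y - x) x; rewrite !subrK (rnC y).
by rewrite ler_norml => ? ?; apply/andP; split; lra.
Qed.

Lemma rnZ V (c : R[i]) (x : V) : rn (c *: x) = rn c * rn x.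
Proof. by apply: complexI; rewrite rmorphM/= -!rnE normrZ. Qed.

Lemma rnM (c x : R[i]) : rn (c * x) = rn c * rn x.
Proof. by apply: complexI; rewrite rmorphM/= -!rnE normrM. Qed.

Lemma rn0 V : rn (0 : V) = 0.
Proof. by rewrite /rn normr0. Qed.

Lemma rn1 : rn (1 : R[i]) = 1.
Proof. by rewrite /rn normr1. Qed.

Lemma rn_eq0 V (x : V) : (rn x == 0) = (x == 0).
Proof. by rewrite -[RHS]normr_eq0 rnE -(inj_eq (@complexI R)). Qed.

Lemma rnV (x : R[i]) : rn x^-1 = (rn x)^-1.
Proof. by apply: complexI; rewrite fmorphV/= -!rnE normfV. Qed.

Lemma rnX (x : R[i]) n : rn (x ^+ n) = rn x ^+ n.
Proof. by apply: complexI; rewrite rmorphXn/= -!rnE normrX. Qed.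

Lemma rnR (x : R) : rn (x%:C) = `|x|.
Proof. by apply: complexI; rewrite -rnE normc_def/= expr0n addr0 sqrtr_sqr. Qed.

Lemma rn_sum V (I : Type) (r : seq I) (P : pred I) (f : I -> V) :
  rn (\sum_(i <- r | P i) f i) <= \sum_(i <- r | P i) rn (f i).
Proof.
elim/big_ind2 : _ => //; first by rewrite rn0.
by move=> x a y b xa yb; rewrite (le_trans (rnD _ _))// lerD.
Qed.

Lemma rnRe (x : R[i]) : `|complex.Re x| <= rn x.
Proof. by rewrite -lecR -rnE normc_ge_Re. Qed.

Lemma rnIm (x : R[i]) : `|complex.Im x| <= rn x.
Proof.
have := rnRe (x * 'i%C); rewrite ReiNIm normrN rnM.
by rewrite (_ : rn 'i%C = 1) ?mulr1// /rn normc_def/= expr0n add0r expr1n sqrtr1.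
Qed.

Lemma rn_ReIm (x : R[i]) : rn x <= `|complex.Re x| + `|complex.Im x|.
Proof.
case: x => a b /=.
have -> : a +i* b = a%:C + 'i%C * b%:C by rewrite [LHS]complexE.
rewrite (le_trans (rnD _ _))// rnM !rnR.
by rewrite (_ : rn 'i%C = 1) ?mul1r// /rn normc_def/= expr0n add0r expr1n sqrtr1.
Qed.

Lemma cReD (x y : R[i]) : complex.Re (x + y) = complex.Re x + complex.Re y.
Proof. by case: x; case: y. Qed.

Lemma cImD (x y : R[i]) : complex.Im (x + y) = complex.Im x + complex.Im y.
Proof. by case: x; case: y. Qed.

Lemma cReN (x : R[i]) : complex.Re (- x) = - complex.Re x.
Proof. by case: x. Qed.

Lemma cImN (x : R[i]) : complex.Im (- x) = - complex.Im x.
Proof. by case: x. Qed.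

Lemma cReM (x y : R[i]) : complex.Re (x * y) =
  complex.Re x * complex.Re y - complex.Im x * complex.Im y.
Proof. by case: x; case: y. Qed.

Lemma cImM (x y : R[i]) : complex.Im (x * y) =
  complex.Re x * complex.Im y + complex.Im x * complex.Re y.
Proof. by case: x; case: y. Qed.

Lemma rcD (x y : R) : (x + y)%:C = x%:C + y%:C.
Proof. by apply/eqP; rewrite eq_complex/= addr0 !eqxx. Qed.

Lemma rcN (x : R) : (- x)%:C = - x%:C.
Proof. by apply/eqP; rewrite eq_complex/= oppr0 !eqxx. Qed.

Lemma rcM (x y : R) : (x * y)%:C = x%:C * y%:C.
Proof. by apply/eqP; rewrite eq_complex/= !mulr0 mul0r subr0 addr0 !eqxx. Qed.

Lemma rcV (x : R) : x^-1%:C = x%:C^-1.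
Proof. exact: (fmorphV (real_complex R)). Qed.

Definition ReImE := (cReD, cImD, cReN, cImN, cReM, cImM).

Lemma gt0_complex (e : R[i]) : 0 < e -> 0 < complex.Re e /\ e = (complex.Re e)%:C.
Proof.
case: e => a b; rewrite ltcE/= => /andP[/eqP -> a0]; split => //.
Qed.

Lemma nbhs_rn V (x : V) (P : set V) :
  nbhs x P <-> exists2 d : R, 0 < d & forall y, rn (y - x) < d -> P y.
Proof.
split.
  move=> /nbhs_normP[e/= /gt0_complex[e0 ee] H]; exists (complex.Re e) => // y yd.
  by apply: H => /=; rewrite distrC rnE ee ltcR.
case=> d d0 H; apply/nbhs_normP; exists d%:C; first by rewrite /= ltcR.
by move=> y /=; rewrite rnE ltcR rnC; exact: H.
Qed.

Lemma cvg_rn {T} {F : set_system T} {FF : Filter F} V (f : T -> V) (y : V) :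
  f @ F --> y <-> forall e : R, 0 < e -> \forall x \near F, rn (f x - y) < e.
Proof.
split.
  move=> /cvgr_distC_lt H e e0.
  have e0' : 0 < e%:C :> R[i] by rewrite ltcR.
  by apply: filterS (H _ e0') => x; rewrite rnE ltcR.
move=> H; apply/cvgrPdist_lt => e /gt0_complex[e0 ->].
by apply: filterS (H _ e0) => x; rewrite distrC rnE ltcR.
Qed.

Lemma continuous_rn V W (f : V -> W) (x : V) :
  {for x, continuous f} <->
  forall e : R, 0 < e -> exists2 d : R, 0 < d &
    forall y, rn (y - x) < d -> rn (f y - f x) < e.
Proof.
rewrite /prop_for /continuous_at cvg_rn; split => H e /H.
  by move=> /nbhs_rn.
by move=> H'; apply/nbhs_rn.
Qed.

End RealNorm.

Section RealLine.
Context {R : realType}.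
Implicit Types (f g : R -> R[i]).

(** Derivative in a real variable for values in [R[i]], which is a normed module over itself and not
    over [R]. The form without quotient admits [h = 0] and is equivalent to derivability of the real
    and imaginary parts. *)
Definition rder f (t : R) (l : R[i]) : Prop :=
  forall e : R, 0 < e -> exists2 d : R, 0 < d &
    forall h : R, `|h| < d -> rn (f (t + h) - f t - h%:C * l) <= e * `|h|.

Lemma is_derive_epsP (u : R -> R) t l : is_derive t (1:R) u l <->
  forall e : R, 0 < e -> exists2 d : R, 0 < d &
    forall h : R, `|h| < d -> `|u (t + h) - u t - h * l| <= e * `|h|.
Proof.
have key : (fun h => h^-1 *: ((u \o shift t) (h *: 1) - u t)) @ 0^' --> l <->
  forall e : R, 0 < e -> exists2 d : R, 0 < d &
    forall h : R, `|h| < d -> `|u (t + h) - u t - h * l| <= e * `|h|.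
  split.
    move=> /cvgr_distC_le H e /H /nbhs_normP[d/= d0 {}H]; exists d => // h hd.
    have [->|h0] := eqVneq h 0.
      by rewrite addr0 subrr mul0r subrr !normr0 mulr0.
    have := H h; rewrite /= sub0r normrN => /(_ hd h0).
    rewrite -ler_pdivrMr ?normr_gt0// -normfV -normrM.
    rewrite [h%:A](_ : _ = h) ?[_%:A]mulr1// (addrC h t).
    by rewrite mulrBl (mulrC h) mulfK// /GRing.scale/= (mulrC h^-1).
  move=> H; apply/cvgrPdist_le => e /H[d d0 {}H]; apply/nbhs_normP.
  exists d => //= h /=; rewrite sub0r normrN => hd h0.
  rewrite distrC; have := H h hd.
  rewrite -ler_pdivrMr ?normr_gt0// -normfV -normrM.
  rewrite [h%:A](_ : _ = h) ?[_%:A]mulr1// (addrC h t).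
  by rewrite mulrBl (mulrC h) mulfK// /GRing.scale/= (mulrC h^-1).
split.
  by case=> df dl; apply/key; rewrite -dl; exact: df.
by move=> /key H; split; [apply: cvgP H | apply: cvg_lim H].
Qed.

Lemma rderRe f t l : rder f t l ->
  is_derive t (1 : R) (fun x => complex.Re (f x)) (complex.Re l).
Proof.
move=> H; apply/is_derive_epsP => e /H[d d0 {}H]; exists d => // h /H.
apply: le_trans; apply: le_trans (rnRe _).
by rewrite !ReImE/= mul0r subr0.
Qed.

Lemma rderIm f t l : rder f t l ->
  is_derive t (1 : R) (fun x => complex.Im (f x)) (complex.Im l).
Proof.
move=> H; apply/is_derive_epsP => e /H[d d0 {}H]; exists d => // h /H.
apply: le_trans; apply: le_trans (rnIm _).
by rewrite !ReImE/= mul0r addr0.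
Qed.

Lemma rderP f t l : 
  is_derive t (1 : R) (fun x => complex.Re (f x)) (complex.Re l) ->
  is_derive t (1 : R) (fun x => complex.Im (f x)) (complex.Im l) ->
  rder f t l.
Proof.
move=> /is_derive_epsP H1 /is_derive_epsP H2 e e0.
have e20 : 0 < e / 2 by rewrite divr_gt0.
have [d1 d10 {}H1] := H1 _ e20; have [d2 d20 {}H2] := H2 _ e20.
exists (Num.min d1 d2); first by rewrite lt_min d10.
move=> h; rewrite lt_min => /andP[/H1 h1 /H2 h2].
apply: le_trans (rn_ReIm _) _.
rewrite !ReImE/= !mul0r subr0 addr0.
rewrite (splitr e) mulrDl lerD//.
Qed.

Lemma rder_lin f g t l m (c : R[i]) : rder f t l -> rder g t m ->
  rder (fun x => f x + c * g x) t (l + c * m).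
Proof.
move=> H1 H2 e e0.
have c0 : 0 < rn c + 1 by rewrite ltr_wpDl ?rn_ge0.
have e20 : 0 < e / 2 by rewrite divr_gt0.
have e30 : 0 < e / 2 / (rn c + 1) by rewrite divr_gt0.
have [d1 d10 {}H1] := H1 _ e20; have [d2 d20 {}H2] := H2 _ e30.
exists (Num.min d1 d2); first by rewrite lt_min d10.
move=> h; rewrite lt_min => /andP[/H1 h1 /H2 h2].
rewrite (_ : _ - _ - _ = (f (t + h) - f t - h%:C * l) +
  c * (g (t + h) - g t - h%:C * m)); last by ring.
rewrite (le_trans (rnD _ _))// (splitr e) mulrDl lerD// rnM.
apply: (@le_trans _ _ ((rn c + 1) * rn (g (t + h) - g t - h%:C * m))).
  by rewrite ler_wpM2r ?rn_ge0// lerDl.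
by rewrite -ler_pdivlMl// mulrA (mulrC _^-1).
Qed.

Lemma rder_cst (c : R[i]) t : rder (fun=> c) t 0.
Proof.
move=> e e0; exists 1 => // h _.
by rewrite subrr mulr0 subrr rn0 mulr_ge0// ltW.
Qed.

Lemma rder_affine f (c d t : R) l : rder f (c * t + d) l ->
  rder (fun x => f (c * x + d)) t (c%:C * l).
Proof.
move=> H e e0.
have c0 : 0 < `|c| + 1 by rewrite ltr_wpDl.
have [d1 d10 {}H] := H _ (divr_gt0 e0 c0).
exists (d1 / (`|c| + 1)); first by rewrite divr_gt0.
move=> h; rewrite ltr_pdivlMr// => hd.
rewrite (_ : c * (t + h) + d = c * t + d + c * h); last by ring.
have ch : `|c * h| < d1.
  by rewrite normrM mulrC (le_lt_trans _ hd)// ler_wpM2l// lerDl.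
have := H _ ch; rewrite rmorphM/= (mulrC c%:C) -mulrA => /le_trans; apply.
rewrite normrM mulrAC -mulrA ler_wpM2l ?(ltW e0)//.
by rewrite ler_pdivrMr// mulrC ler_wpM2l// lerDl.
Qed.

Lemma rderM f g t l m : rder f t l -> rder g t m ->
  rder (fun x => f x * g x) t (l * g t + f t * m).
Proof.
move=> /[dup] /rderRe fr /rderIm fi /[dup] /rderRe gr /rderIm gi.
apply: rderP => /=.
- have := is_deriveB (is_deriveM fr gr) (is_deriveM fi gi).
  rewrite (_ : (fun x => complex.Re (f x * g x)) = ((fun x => complex.Re (f x)) *
    (fun x => complex.Re (g x)) - (fun x => complex.Im (f x)) *
    (fun x => complex.Im (g x)))); last by apply/funext => x; rewrite cReM.
  by move=> H; apply: is_derive_eq H _; rewrite !ReImE /GRing.scale/=; ring.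
- have := is_deriveD (is_deriveM fr gi) (is_deriveM fi gr).
  rewrite (_ : (fun x => complex.Im (f x * g x)) = ((fun x => complex.Re (f x)) *
    (fun x => complex.Im (g x)) + (fun x => complex.Im (f x)) *
    (fun x => complex.Re (g x)))); last by apply/funext => x; rewrite cImM.
  by move=> H; apply: is_derive_eq H _; rewrite !ReImE /GRing.scale/=; ring.
Qed.

(** [G - u] and [G + u] have nonnegative derivatives, hence are nondecreasing. A primitive [G] of
    the majorant stands in for its integral. *)
Lemma real_mvi (u du G g : R -> R) (a b : R) : a <= b ->
  (forall t, a <= t <= b -> is_derive t (1:R) u (du t)) ->
  (forall t, a <= t <= b -> is_derive t (1 : R) G (g t)) ->
  (forall t, a <= t <= b -> `|du t| <= g t) -> `|u b - u a| <= G b - G a.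
Proof.
move=> ab Hu HG Hg.
have key (v dv : R -> R) : (forall t, a <= t <= b -> is_derive t (1 : R) v (dv t)) ->
    (forall t, a <= t <= b -> 0 <= dv t) -> v a <= v b.
  move=> Hv dv0.
  have cv : {within `[a, b], continuous v}.
    apply: derivable_within_continuous => t; rewrite in_itv/= => tab.
    by have [] := Hv t tab.
  have Hv' t : t \in `]a, b[ -> is_derive t (1 : R) v (dv t).
    by rewrite in_itv/= => /andP[ta tb]; apply: Hv; rewrite !ltW.
  have [c cab] := MVT_segment ab Hv' cv.
  move=> /eqP; rewrite subr_eq => /eqP ->; rewrite lerDr mulr_ge0// ?subr_ge0//.
  by apply: dv0; rewrite in_itv/= in cab.
have e1 : (G - u) a <= (G - u) b.
  apply: (key _ (fun t => g t - du t)) => t tab.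
    have := Hu t tab; have := HG t tab; move=> ? ?; exact: is_deriveB.
  by rewrite subr_ge0 (le_trans (ler_norm _))// Hg.
have e2 : (G + u) a <= (G + u) b.
  apply: (key _ (fun t => g t + du t)) => t tab.
    have := Hu t tab; have := HG t tab; move=> ? ?; exact: is_deriveD.
  by rewrite -lerBlDr sub0r (le_trans (ler_norm _))// normrN Hg.
rewrite ler_norml; move: e1 e2; rewrite ![(_ + _) _]/= !fctE; lra.
Qed.

(** The real inequality is applied to the real and the imaginary part separately, which costs the
    factor [2] that reappears in later constants. *)
Lemma rder_mvi f df (G g : R -> R) (a b : R) : a <= b ->
  (forall t, a <= t <= b -> rder f t (df t)) ->
  (forall t, a <= t <= b -> is_derive t (1 : R) G (g t)) ->
  (forall t, a <= t <= b -> rn (df t) <= g t) ->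
  rn (f b - f a) <= 2 * (G b - G a).
Proof.
move=> ab Hf HG Hg.
apply: le_trans (rn_ReIm _) _; rewrite mulr_natl mulr2n !ReImE lerD//.
  apply: (real_mvi (u := fun t => complex.Re (f t))
    (du := fun t => complex.Re (df t)) ab _ HG) => t tab.
    exact/rderRe/Hf.
  by apply: le_trans (rnRe _) (Hg _ tab).
apply: (real_mvi (u := fun t => complex.Im (f t))
  (du := fun t => complex.Im (df t)) ab _ HG) => t tab.
  exact/rderIm/Hf.
by apply: le_trans (rnIm _) (Hg _ tab).
Qed.

Lemma rder_mvi_cst f df (M a b : R) : a <= b ->
  (forall t, a <= t <= b -> rder f t (df t)) ->
  (forall t, a <= t <= b -> rn (df t) <= M) ->
  rn (f b - f a) <= 2 * M * (b - a).
Proof.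
move=> ab Hf HM.
have := rder_mvi (G := fun t => M * t) (g := fun=> M) ab Hf _ HM.
rewrite -mulrBr mulrA; apply => t _.
have := @is_deriveZ _ _ _ id M t 1 1 (is_derive_id _ _).
by rewrite /GRing.scale/= mulr1.
Qed.

Lemma rder_eq f g (df : R -> R[i]) (a b : R) : a <= b ->
  (forall t, a <= t <= b -> rder f t (df t)) ->
  (forall t, a <= t <= b -> rder g t (df t)) -> f b - f a = g b - g a.
Proof.
move=> ab Hf Hg; apply/eqP; rewrite -subr_eq0 -rn_eq0 eq_le rn_ge0 andbT.
pose k x := f x + (-1) * g x.
have := @rder_mvi_cst k (fun=> 0) 0 _ _ ab.
rewrite (_ : k b - k a = f b - f a - (g b - g a)); last by rewrite /k; ring.
rewrite mulr0 mul0r; apply=> t tab; last by rewrite rn0.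
by have := rder_lin (-1) (Hf t tab) (Hg t tab); rewrite mulN1r subrr.
Qed.

End RealLine.

(** * Integrals over the unit interval, defined through primitives *)

Section UnitIntegral.
Context {R : realType}.
Implicit Types (f g P : R -> R[i]).

Definition cont01 f : Prop := forall t, 0 <= t <= 1 -> forall e : R, 0 < e ->
  exists2 d : R, 0 < d & forall t', 0 <= t' <= 1 -> `|t' - t| < d ->
    rn (f t' - f t) < e.

(** The derivative is two-sided also at [0] and [1]; to get such a primitive, a function on the
    segment is extended continuously to the line by [clamp]. *)
Definition prim01 f P : Prop := forall t, 0 <= t <= 1 -> rder P t (f t).

(* int_0^1 f; arbitrary unless f has a primitive. *)
Definition I01 f : R[i] := get (prim01 f) 1 - get (prim01 f) 0.

Lemma I01E f P : prim01 f P -> I01 f = P 1 - P 0.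
Proof.
move=> fP; have fQ : prim01 f (get (prim01 f)) by apply: (@getPex _ (prim01 f)); exists P.
by rewrite /I01; apply: rder_eq fQ fP.
Qed.

Let clamp (t : R) : R := Num.min 1 (Num.max 0 t).

Let clamp01 t : 0 <= clamp t <= 1.
Proof. by rewrite /clamp le_min ler01 le_max lexx/= ge_min lexx. Qed.

Let clampE (t : R) : 0 <= t <= 1 -> clamp t = t.
Proof. by rewrite /clamp => /andP[t0 t1]; rewrite max_r// min_r. Qed.

Let clamp_lip t t' : `|clamp t' - clamp t| <= `|t' - t|.
Proof.
have c0 x : x <= 0 -> clamp x = 0 by move=> x0; rewrite /clamp max_l// min_r.
have c1 x : 1 <= x -> clamp x = 1.
  by move=> x1; rewrite /clamp max_r ?(le_trans ler01)// min_l.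
have [t0|t0] := leP t 0; [rewrite (c0 t t0)|have [t1|t1] := leP 1 t;
    [rewrite (c1 t t1)|rewrite (clampE (t := t)) ?(ltW t0) ?(ltW t1)//]];
  (have [t'0|t'0] := leP t' 0; [rewrite (c0 t' t'0)|have [t'1|t'1] := leP 1 t';
    [rewrite (c1 t' t'1)|rewrite (clampE (t := t')) ?(ltW t'0) ?(ltW t'1)//]]);
  rewrite ler_norml; case: (ger0P (t' - t)) => ?; apply/andP; split; lra.
Qed.

Lemma real_prim (u : R -> R) : continuous u ->
  exists U : R -> R, forall t : R, 0 <= t <= 1 -> is_derive t (1 : R) U (u t).
Proof.
(* Integrating from [-1], inside the interval from [-1] to [2], makes all of [[0, 1]] interior, so
   the fundamental theorem gives two-sided derivatives. *)
move=> cu; exists (fun x => (\int[lebesgue_measure]_(t in `[(- 1)%R, x]) u t)%R).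
move=> t /andP[t0 t1].
have [||//|dU eU] := @continuous_FTC1_closed R u (-1) t 2 _ _ _ (cu t).
- by lra.
- apply: continuous_compact_integrable; first exact: segment_compact.
  exact: continuous_subspaceT.
- by lra.
by apply: DeriveDef; [exact: dU|rewrite -derive1E; exact: eU].
Qed.

Lemma prim01_ex f : cont01 f -> exists P, prim01 f P.
Proof.
move=> cf.
have cfc (p : R[i] -> R) : (forall x y, `|p x - p y| <= rn (x - y)) ->
    continuous (fun t => p (f (clamp t))).
  move=> pl t; apply/cvgrPdist_lt => e e0.
  have [d d0 H] := cf _ (clamp01 t) _ e0.
  apply/nbhs_normP; exists d => // t' /= td.
  rewrite distrC (le_lt_trans (pl _ _))//; apply: H => //.
  by rewrite (le_lt_trans (clamp_lip _ _))// distrC.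
have [U HU] : exists U : R -> R, forall t : R, 0 <= t <= 1 ->
    is_derive t (1 : R) U (complex.Re (f (clamp t))).
  apply/real_prim/cfc => x y; rewrite -cReN -cReD; exact: rnRe.
have [V HV] : exists V : R -> R, forall t : R, 0 <= t <= 1 ->
    is_derive t (1 : R) V (complex.Im (f (clamp t))).
  apply/real_prim/cfc => x y; rewrite -cImN -cImD; exact: rnIm.
exists (fun t => U t +i* V t) => t t01.
by apply: rderP => /=; [have := HU t t01|have := HV t t01]; rewrite clampE.
Qed.

Lemma I01_prim f : cont01 f -> exists2 P, prim01 f P & I01 f = P 1 - P 0.
Proof. by move=> /prim01_ex[P fP]; exists P => //; exact: I01E. Qed.

Lemma I01_eq f g : cont01 f -> (forall t, 0 <= t <= 1 -> f t = g t) ->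
  I01 f = I01 g.
Proof.
move=> /I01_prim[P fP ->] fg; symmetry; apply: I01E => t t01.
by rewrite -fg//; exact: fP.
Qed.

Lemma I01_lin f g c : cont01 f -> cont01 g ->
  I01 (fun t => f t + c * g t) = I01 f + c * I01 g.
Proof.
move=> /I01_prim[P fP ->] /I01_prim[Q gQ ->].
rewrite (@I01E _ (fun t => P t + c * Q t)); first by ring.
by move=> t t01; apply: rder_lin; [exact: fP|exact: gQ].
Qed.

Lemma cont01_lin f g c : cont01 f -> cont01 g -> cont01 (fun t => f t + c * g t).
Proof.
move=> cf cg t t01 e e0.
have c0 : 0 < rn c + 1 by rewrite ltr_wpDl ?rn_ge0.
have e20 : 0 < e / 2 by rewrite divr_gt0.
have e30 : 0 < e / 2 / (rn c + 1) by rewrite divr_gt0.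
have [d1 d10 {}H1] := cf _ t01 _ e20; have [d2 d20 {}H2] := cg _ t01 _ e30.
exists (Num.min d1 d2); first by rewrite lt_min d10.
move=> h h01; rewrite lt_min => /andP[/(H1 _ h01) h1 /(H2 _ h01) h2].
rewrite (_ : _ - _ = (f h - f t) + c * (g h - g t)); last by ring.
rewrite (le_lt_trans (rnD _ _))// (splitr e) ltrD// rnM.
apply: (@le_lt_trans _ _ ((rn c + 1) * rn (g h - g t))).
  by rewrite ler_wpM2r ?rn_ge0// lerDl.
by rewrite mulrC -ltr_pdivlMr.
Qed.

Lemma cont01_cst c : cont01 (fun=> c).
Proof. by move=> t _ e e0; exists 1 => // *; rewrite subrr rn0. Qed.

Lemma I01_cst c : I01 (fun=> c) = c.
Proof.
rewrite (@I01E _ (fun t => 0 + c * t%:C)); first by rewrite !mulr1 mulr0 addr0 add0r subr0.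
move=> t _; rewrite -{2}[c]mulr1 -[c * 1]add0r; apply: rder_lin (rder_cst _ _) _.
move=> e e0; exists 1 => // h _.
by rewrite (_ : _ - _ = 0) ?rn0 ?mulr_ge0 ?(ltW e0)// rcD; ring.
Qed.

Lemma I01B f g : cont01 f -> cont01 g -> I01 (fun t => f t - g t) = I01 f - I01 g.
Proof.
move=> cf cg; rewrite -[- I01 g]mulN1r -I01_lin//; congr I01.
by apply/funext => t; rewrite mulN1r.
Qed.

Lemma cont01B f g : cont01 f -> cont01 g -> cont01 (fun t => f t - g t).
Proof.
move=> cf cg; have := cont01_lin (-1) cf cg.
by congr cont01; apply/funext => t; rewrite mulN1r.
Qed.

Lemma cont01D f g : cont01 f -> cont01 g -> cont01 (fun t => f t + g t).
Proof.
move=> cf cg; have := cont01_lin 1 cf cg.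
by congr cont01; apply/funext => t; rewrite mul1r.
Qed.

Lemma cont01Z f c : cont01 f -> cont01 (fun t => c * f t).
Proof.
move=> cf; have := cont01_lin c (cont01_cst 0) cf.
by congr cont01; apply/funext => t; rewrite add0r.
Qed.

Lemma I01Z f c : cont01 f -> I01 (fun t => c * f t) = c * I01 f.
Proof.
move=> cf; rewrite -[RHS]add0r -[X in X + _](I01_cst 0) -I01_lin//; last exact: cont01_cst.
by congr I01; apply/funext => t; rewrite add0r.
Qed.

Lemma I01_major f (G g : R -> R) : cont01 f ->
  (forall t : R, 0 <= t <= 1 -> is_derive t (1 : R) G (g t)) ->
  (forall t, 0 <= t <= 1 -> rn (f t) <= g t) -> rn (I01 f) <= 2 * (G 1 - G 0).
Proof. by move=> /I01_prim[P fP ->]; exact: rder_mvi. Qed.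

Lemma I01_le f (M : R) : cont01 f ->
  (forall t, 0 <= t <= 1 -> rn (f t) <= M) -> rn (I01 f) <= 2 * M.
Proof.
move=> /I01_prim[P fP ->] H; have := rder_mvi_cst ler01 fP H.
by rewrite subr0 mulr1.
Qed.

(** Compares the integral of [f] with that of a function [p] whose primitive is explicit; in
    Goursat's argument [p] comes from the affine approximation of the integrand. *)
Lemma I01_near f p P (M : R) : cont01 f -> prim01 p P ->
  (forall t, 0 <= t <= 1 -> rn (f t - p t) <= M) ->
  rn (I01 f - (P 1 - P 0)) <= 2 * M.
Proof.
move=> /I01_prim[Q fQ ->] pP H.
have := @rder_mvi_cst _ (fun t => Q t + (-1) * P t) (fun t => f t + (-1) * p t) M 0 1 ler01.
rewrite subr0 mulr1 (_ : _ - _ = Q 1 - Q 0 - (P 1 - P 0)); last by ring.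
apply => t t01; first by apply: rder_lin; [exact: fQ|exact: pP].
by rewrite mulN1r; exact: H.
Qed.

Lemma rder_cont01 f df : (forall t, rder f t (df t)) -> cont01 f.
Proof.
move=> H t _ e e0; have [d d0 {}H] := H t _ ltr01.
have K0 : 0 < 1 + rn (df t) by rewrite ltr_pwDl ?rn_ge0.
exists (Num.min d (e / (1 + rn (df t)))); first by rewrite lt_min d0 divr_gt0.
move=> t' _; rewrite lt_min ltr_pdivlMr// => /andP[/H].
rewrite mul1r addrCA subrr addr0 => {}H H'; apply: le_lt_trans H'.
rewrite -[f t' - f t](subrK ((t' - t)%:C * df t)) (le_trans (rnD _ _))//.
by rewrite rnM rnR mulrDr mulr1 lerD2r.
Qed.

Lemma cont01_comp (F : R[i] -> R[i]) f : cont01 f ->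
  (forall t, 0 <= t <= 1 -> {for f t, continuous F}) -> cont01 (fun t => F (f t)).
Proof.
move=> cf cF t t01 e e0; have [d d0 H] := (continuous_rn _ _).1 (cF t t01) _ e0.
have [d' d'0 H'] := cf _ t01 _ d0; exists d' => // t' t'01 /(H' _ t'01); exact: H.
Qed.

Lemma cont01M f g : cont01 f -> cont01 g -> cont01 (fun t => f t * g t).
Proof.
move=> cf cg t t01 e e0.
have c0 : 0 < rn (f t) + 1 by rewrite ltr_wpDl ?rn_ge0.
have c1 : 0 < rn (g t) + 1 by rewrite ltr_wpDl ?rn_ge0.
have e20 : 0 < Num.min 1 (e / 2 / (rn (g t) + 1)) by rewrite lt_min ltr01 !divr_gt0.
have e30 : 0 < e / 2 / (rn (f t) + 1) by rewrite !divr_gt0.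
have [d1 d10 {}H1] := cf _ t01 _ e20; have [d2 d20 {}H2] := cg _ t01 _ e30.
exists (Num.min d1 d2); first by rewrite lt_min d10.
move=> h h01; rewrite lt_min => /andP[/(H1 _ h01) h1 /(H2 _ h01)].
rewrite ltr_pdivlMr// => h2.
move: h1; rewrite lt_min ltr_pdivlMr// => /andP[h1 h1'].
rewrite (_ : _ - _ = f h * (g h - g t) + (f h - f t) * g t); last by ring.
rewrite (le_lt_trans (rnD _ _))// (splitr e) ltrD// rnM.
  apply: le_lt_trans h2; rewrite mulrC ler_wpM2l ?rn_ge0//.
  rewrite -{1}(subrK (f t) (f h)) (le_trans (rnD _ _))// addrC lerD2l ltW//.
by apply: le_lt_trans h1'; rewrite ler_wpM2l ?rn_ge0// lerDl.
Qed.

Lemma I01_split f : cont01 f -> I01 f =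
  I01 (fun t => 2^-1 * f (2^-1 * t + 0)) + I01 (fun t => 2^-1 * f (2^-1 * t + 2^-1)).
Proof.
move=> /I01_prim[P fP ->].
have two : (2^-1 : R)%:C = 2^-1 :> R[i] by rewrite fmorphV rmorph_nat.
rewrite (@I01E _ (fun t => P (2^-1 * t + 0))); last first.
  move=> t t01; have := @rder_affine _ P 2^-1 0 t _ (fP _ _); rewrite two; apply.
  by lra.
rewrite (@I01E _ (fun t => P (2^-1 * t + 2^-1))); last first.
  move=> t t01; have := @rder_affine _ P 2^-1 2^-1 t _ (fP _ _); rewrite two; apply.
  by lra.
rewrite !mulr0 !addr0 !add0r !mulr1 (_ : 2^-1 + 2^-1 = 1 :> R); last by lra.
by ring.
Qed.

End UnitIntegral.

(** * Holomorphic functions on normed spaces *)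

Section Differentials.
Context {R : realType}.
Implicit Types (V W : normedModType R[i]).

Lemma linear_rn_continuous V W (L : {linear V -> W}) (K : R) :
  (forall v, rn (L v) <= K * rn v) -> continuous L.
Proof.
move=> LK x; apply/continuous_rn => e e0.
have K0 : 0 < `|K| + 1 by rewrite ltr_wpDl.
exists (e / (`|K| + 1)); first by rewrite divr_gt0.
move=> y; rewrite ltr_pdivlMr// mulrC; apply: le_lt_trans.
rewrite -linearB (le_trans (LK _))// ler_wpM2r ?rn_ge0//.
by rewrite (le_trans (ler_norm K))// lerDl.
Qed.

Lemma differentiable_eps V W (f : V -> W) (x : V) : differentiable f x ->
  forall e : R, 0 < e -> exists2 d : R, 0 < d &
  forall h, rn h < d -> rn (f (x + h) - f x - 'd f x h) <= e * rn h.
Proof.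
move=> /diff_locallyxC; set k := 'o _ => df e e0.
have /(littleoP [littleo of k]) /nbhs_rn[d d0 H] : 0 < e%:C :> R[i] by rewrite ltcR.
exists d => // h hd; have := H h; rewrite subr0 => /(_ hd).
rewrite df -(addrA (f x)) (addrAC (f x)) subrr add0r addrAC subrr add0r.
by rewrite -lecR rcM -!rnE.
Qed.

Lemma differentiable_from_eps V W (f : V -> W) (x : V) (L : {linear V -> W}) (K : R) :
  (forall v, rn (L v) <= K * rn v) ->
  (forall e : R, 0 < e -> exists2 d : R, 0 < d &
    forall h, rn h < d -> rn (f (x + h) - f x - L h) <= e * rn h) ->
  differentiable f x /\ 'd f x = L :> (V -> W).
Proof.
move=> /linear_rn_continuous cL H.
have Lo : f \o shift x = cst (f x) + L +o_ 0 id.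
  apply/eqaddoP => _ /posnumP[e]; have [e0 eE] := gt0_complex (gt0 e).
  have [d d0 {}H] := H _ e0; apply/nbhs_rn; exists d => // h; rewrite subr0 => /H.
  rewrite !fctE /= [h + x]addrC opprD addrA !rnE.
  by rewrite eE -rcM lecR.
have dL := diff_unique cL Lo; split => //.
by apply/diff_locallyP; rewrite dL.
Qed.

Lemma linear_pack V W (f : V -> W) : linear f -> exists L : {linear V -> W}, L = f :> (V -> W).
Proof.
move=> lf; pose Lin := GRing.isLinear.Build _ _ _ _ f lf.
by pose L : {linear V -> W} := HB.pack f Lin; exists L.
Qed.

(** Complex derivative as an inequality, which needs no case distinction at [w = z] and composes
    with [rder] along paths. It is equivalent to [is_derive z 1 f a]. *)
Definition cder (f : R[i] -> R[i]) (z a : R[i]) := forall e : R, 0 < e ->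
  exists2 d : R, 0 < d & forall w, rn (w - z) < d ->
    rn (f w - f z - a * (w - z)) <= e * rn (w - z).

Lemma differentiable_cder (f : R[i] -> R[i]) (z : R[i]) :
  differentiable f z -> cder f z ('d f z 1).
Proof.
move=> /differentiable_eps H e /H[d d0 {}H]; exists d => // w /H.
rewrite addrCA subrr addr0; congr (rn (_ - _) <= _).
by rewrite -{1}[w - z]mulr1 [(w - z) * 1](_ : _ = (w - z) *: 1)// linearZ/= mulrC.
Qed.

Lemma cder_differentiable (f : R[i] -> R[i]) (z a : R[i]) :
  cder f z a -> differentiable f z /\ is_derive z 1 f a.
Proof.
move=> H.
have [|L LE] := @linear_pack _ _ (fun h : R[i] => a * h).
  by move=> c x y; rewrite mulrDr -![_ *: _]/(_ * _) mulrCA.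
have [||df dE] := @differentiable_from_eps _ _ f z L (rn a); rewrite ?LE.
- by move=> v; rewrite rnM.
- move=> e /H[d d0 {}H]; exists d => // h hd.
  by have := H (z + h); rewrite addrAC subrr add0r => /(_ hd).
by split => //; apply: DeriveDef; [exact: diff_derivable|rewrite deriveE// dE LE mulr1].
Qed.

Lemma derivable_cder (f : R[i] -> R[i]) (z a : R[i]) : is_derive z 1 f a -> cder f z a.
Proof.
case=> df <-; rewrite deriveE; last exact/derivable1_diffP.
exact/differentiable_cder/derivable1_diffP.
Qed.

Lemma differentiable_line V W (f : V -> W) (x v : V) (z : R[i]) :
  differentiable f (x + z *: v) ->
  differentiable (fun z : R[i] => f (x + z *: v)) z.
Proof.
move=> df; apply: (@differentiable_comp _ _ _ _ (fun z : R[i] => x + z *: v) f) => //.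
Qed.

Lemma differentiable_rder V (f : V -> R[i]) (x v : V) (t : R) :
  differentiable f (x + t%:C *: v) ->
  rder (fun t => f (x + t%:C *: v)) t ('d f (x + t%:C *: v) v).
Proof.
move=> /differentiable_eps H e e0.
have K0 : 0 < rn v + 1 by rewrite ltr_wpDl ?rn_ge0.
have [d d0 {}H] := H _ (divr_gt0 e0 K0).
exists (d / (rn v + 1)); first by rewrite divr_gt0.
move=> h; rewrite ltr_pdivlMr// => hd.
have hv : rn (h%:C *: v) <= `|h| * (rn v + 1).
  by rewrite rnZ rnR ler_wpM2l// lerDl.
have := H (h%:C *: v) (le_lt_trans hv hd).
rewrite (_ : x + t%:C *: v + _ = x + (t + h)%:C *: v); last by rewrite -addrA -scalerDl -rcD.
rewrite linearZ/= => /le_trans; apply.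
apply: (le_trans (ler_wpM2l _ hv)); first by rewrite divr_ge0// ltW.
by rewrite mulrCA divfK ?gt_eqF// mulrC.
Qed.

End Differentials.

(** * Goursat's theorem for the image of a square *)

Section Goursat.
Context {R : realType}.
Variables (f : R[i] -> R[i]) (G Gu Gv : R -> R -> R[i]) (K : R).
Hypothesis Gu_der : forall u v, rder (fun x => G x v) u (Gu u v).
Hypothesis Gv_der : forall u v, rder (G u) v (Gv u v).
Hypothesis Gu_cont : forall a d v, cont01 (fun t => Gu (d * t + a) v).
Hypothesis Gv_cont : forall a d u, cont01 (fun t => Gv u (d * t + a)).
Hypothesis Gu_le : forall u v, 0 <= u <= 1 -> 0 <= v <= 1 -> rn (Gu u v) <= K.
Hypothesis Gv_le : forall u v, 0 <= u <= 1 -> 0 <= v <= 1 -> rn (Gv u v) <= K.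
Hypothesis f_diff : forall u v, 0 <= u <= 1 -> 0 <= v <= 1 -> differentiable f (G u v).

Definition hside (u v d : R) : R[i] :=
  I01 (fun t => d%:C * (f (G (d * t + u) v) * Gu (d * t + u) v)).
Definition vside (u v d : R) : R[i] :=
  I01 (fun t => d%:C * (f (G u (d * t + v)) * Gv u (d * t + v))).
(** Integral of [f] along the image under [G] of the boundary of the square with lower left corner
    [(u, v)] and side [d]. A general map [G], with partial derivatives [Gu] and [Gv], lets the
    argument treat homotopies of closed curves without cutting contours. *)
Definition boundary_integral (u v d : R) : R[i] :=
  hside u v d + vside (u + d) v d - hside u (v + d) d - vside u v d.

Let in01 (d u t : R) : 0 <= u -> 0 <= d -> u + d <= 1 -> 0 <= t <= 1 ->
  0 <= d * t + u <= 1.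
Proof. by move=> *; apply/andP; split; nra. Qed.

Let K_ge0 : 0 <= K.
Proof. by apply: le_trans (rn_ge0 _) (@Gu_le 0 0 _ _); rewrite lexx ler01. Qed.

Let hside_cont u v d : 0 <= u -> 0 <= d -> u + d <= 1 -> 0 <= v <= 1 ->
  cont01 (fun t => d%:C * (f (G (d * t + u) v) * Gu (d * t + u) v)).
Proof.
move=> *; apply/cont01Z/cont01M => //; apply: (@cont01_comp _ f).
  by apply: rder_cont01 => t; apply: (@rder_affine _ (fun x => G x v)).
by move=> t t01; apply/differentiable_continuous/f_diff => //; exact: in01.
Qed.

Let vside_cont u v d : 0 <= v -> 0 <= d -> v + d <= 1 -> 0 <= u <= 1 ->
  cont01 (fun t => d%:C * (f (G u (d * t + v)) * Gv u (d * t + v))).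
Proof.
move=> *; apply/cont01Z/cont01M => //; apply: (@cont01_comp _ f).
  by apply: rder_cont01 => t; apply: (@rder_affine _ (G u)).
by move=> t t01; apply/differentiable_continuous/f_diff => //; exact: in01.
Qed.

Let half_C : (2^-1 : R)%:C = 2^-1 :> R[i].
Proof. by rewrite rcV (rmorph_nat (real_complex R) 2). Qed.

Lemma hside_split u v d : 0 <= u -> 0 <= d -> u + d <= 1 -> 0 <= v <= 1 ->
  hside u v d = hside u v (d / 2) + hside (u + d / 2) v (d / 2).
Proof.
move=> *; rewrite /hside I01_split; last exact: hside_cont.
congr (_ + _); congr I01; apply/funext => t.
  rewrite (_ : d * (2^-1 * t + 0) + u = d / 2 * t + u); last by field.
  by rewrite rcM half_C !mulrA (mulrC 2^-1).
rewrite (_ : d * (2^-1 * t + 2^-1) + u = d / 2 * t + (u + d / 2)); last by field.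
by rewrite rcM half_C !mulrA (mulrC 2^-1).
Qed.

Lemma vside_split u v d : 0 <= v -> 0 <= d -> v + d <= 1 -> 0 <= u <= 1 ->
  vside u v d = vside u v (d / 2) + vside u (v + d / 2) (d / 2).
Proof.
move=> *; rewrite /vside I01_split; last exact: vside_cont.
congr (_ + _); congr I01; apply/funext => t.
  rewrite (_ : d * (2^-1 * t + 0) + v = d / 2 * t + v); last by field.
  by rewrite rcM half_C !mulrA (mulrC 2^-1).
rewrite (_ : d * (2^-1 * t + 2^-1) + v = d / 2 * t + (v + d / 2)); last by field.
by rewrite rcM half_C !mulrA (mulrC 2^-1).
Qed.

Lemma boundary_integral_split u v d : 0 <= d -> 0 <= u -> u + d <= 1 ->
  0 <= v -> v + d <= 1 ->
  boundary_integral u v d =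
  boundary_integral u v (d / 2) + boundary_integral (u + d / 2) v (d / 2) +
  boundary_integral u (v + d / 2) (d / 2) +
  boundary_integral (u + d / 2) (v + d / 2) (d / 2).
Proof.
move=> d0 u0 ud v0 vd; rewrite /boundary_integral.
have e x : x + d / 2 + d / 2 = x + d by field.
rewrite (@hside_split u v)//; last by apply/andP; split; lra.
rewrite (@hside_split u (v + d))//; last by apply/andP; split; lra.
rewrite (@vside_split u v)//; last by apply/andP; split; lra.
rewrite (@vside_split (u + d) v)//; last by apply/andP; split; lra.
by rewrite !e; ring.
Qed.

Let G_lip u v u' v' : 0 <= u <= 1 -> 0 <= v <= 1 -> 0 <= u' <= 1 -> 0 <= v' <= 1 ->
  rn (G u v - G u' v') <= 2 * K * (`|u - u'| + `|v - v'|).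
Proof.
have key (g dg : R -> R[i]) x y : (forall t, rder g t (dg t)) ->
    (forall t, 0 <= t <= 1 -> rn (dg t) <= K) -> 0 <= x <= 1 -> 0 <= y <= 1 ->
    rn (g x - g y) <= 2 * K * `|x - y|.
  move=> Hg Hb; wlog yx : x y / y <= x => [H|/andP[x0 x1] /andP[y0 y1]].
    by have [|/ltW] := leP y x; [exact: H|rewrite rnC distrC => *; exact: H].
  rewrite ger0_norm ?subr_ge0//; apply: (rder_mvi_cst (df := dg)) => // t /andP[? ?].
  by apply: Hb; apply/andP; split; lra.
move=> u01 v01 u'01 v'01; rewrite -[_ - _](subrKA (G u' v)) (le_trans (rnD _ _))// mulrDr lerD//.
  by apply: (key (fun x => G x v) (fun x => Gu x v)) => // t t01; exact: Gu_le.
by apply: (key (G u') (Gv u')) => // t t01; exact: Gv_le.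
Qed.

(** The affine part of [f] at [c = G u0 v0] has the quadratic primitive [Q], whose contributions
    cancel around the square. There [G] stays within [4 K d] of [c], so the error of [f] is at most
    [4 K e d] and each side contributes at most [2 d (4 K e d) K]; four sides give the [32]. *)
Lemma boundary_integral_local u0 v0 (e : R) : 0 <= u0 <= 1 -> 0 <= v0 <= 1 -> 0 < e ->
  exists2 dl : R, 0 < dl & forall u v d, 0 < d < dl -> 0 <= u -> u + d <= 1 ->
    0 <= v -> v + d <= 1 -> u <= u0 <= u + d -> v <= v0 <= v + d ->
    rn (boundary_integral u v d) <= 32 * K ^+ 2 * e * d ^+ 2.
Proof.
move=> u001 v001 e0.
pose c := G u0 v0.
have [dl dl0 Hf] := differentiable_cder (f_diff u001 v001) e0.
set a := 'd f _ 1 in Hf.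
have K1 : 0 < 4 * K + 1 by have := K_ge0; lra.
exists (dl / (4 * K + 1)); first by rewrite divr_gt0.
move=> u v d /andP[d0]; rewrite ltr_pdivlMr// => ddl u_0 ud v_0 vd /andP[uu0 u0u] /andP[vv0 v0v].
have near_c u' v' : u <= u' <= u + d -> v <= v' <= v + d ->
    rn (f (G u' v') - (f c - a * c + a * G u' v')) <= e * (4 * K * d).
  move=> /andP[uu' u'u] /andP[vv' v'v].
  have lip : rn (G u' v' - c) <= 4 * K * d.
    have du : `|u' - u0| <= d by rewrite ler_norml; apply/andP; split; lra.
    have dv : `|v' - v0| <= d by rewrite ler_norml; apply/andP; split; lra.
    apply: le_trans (@G_lip u' v' u0 v0 _ _ _ _) _ => //; try by apply/andP; split; lra.
    have := ler_wpM2l K_ge0 (lerD du dv); lra.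
  have := Hf (G u' v').
  rewrite (_ : f _ - f _ - _ = f (G u' v') - (f c - a * c + a * G u' v')); last by rewrite /c; ring.
  move=> H; apply: le_trans (H _) _; last by rewrite ler_wpM2l// ltW.
  by apply: le_lt_trans lip _; rewrite mulrC (lt_trans _ ddl)// ltr_pM2l//; lra.
pose Q z := (f c - a * c) * z + a * 2^-1 * (z * z).
have rQ (g : R -> R[i]) t l : rder g t l -> rder (fun t => Q (g t)) t ((f c - a * c + a * g t) * l).
  move=> rg.
  have r1 := rder_lin (f c - a * c) (rder_cst 0 t) rg.
  have := rder_lin (a * 2^-1) r1 (rderM rg rg).
  congr rder; first by apply/funext => x; rewrite add0r.
  by field.
have h_near v' : v <= v' <= v + d ->
    rn (hside u v' d - (Q (G (u + d) v') - Q (G u v'))) <= 2 * (4 * K ^+ 2 * e * d ^+ 2).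
  move=> vv'.
  have := @I01_near _ (fun t => d%:C * (f (G (d * t + u) v') * Gu (d * t + u) v'))
   (fun t => d%:C * ((f c - a * c + a * G (d * t + u) v') * Gu (d * t + u) v'))
   (fun t => Q (G (d * t + u) v')) (4 * K ^+ 2 * e * d ^+ 2).
  rewrite mulr1 mulr0 add0r (addrC d); apply.
  - by apply: hside_cont => //; [exact: ltW|move/andP : vv' => [? ?]; apply/andP; split; lra].
  - by move=> t _; apply: (@rder_affine _ (fun x => Q (G x v'))); exact: rQ.
  move=> t /andP[t0 t1]; rewrite -mulrBr -mulrBl !rnM rnR (gtr0_norm d0).
  rewrite (_ : _ * d ^+ 2 = d * ((e * (4 * K * d)) * K)); last by ring.
  rewrite ler_wpM2l ?(ltW d0)// ler_pM ?rn_ge0//.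
    by apply: near_c => //; apply/andP; split; nra.
  by apply: Gu_le; [apply: in01 => //; [exact: ltW|apply/andP]|move/andP : vv' => [? ?];
      apply/andP; split; lra].
have v_near u' : u <= u' <= u + d ->
    rn (vside u' v d - (Q (G u' (v + d)) - Q (G u' v))) <= 2 * (4 * K ^+ 2 * e * d ^+ 2).
  move=> uu'.
  have := @I01_near _ (fun t => d%:C * (f (G u' (d * t + v)) * Gv u' (d * t + v)))
   (fun t => d%:C * ((f c - a * c + a * G u' (d * t + v)) * Gv u' (d * t + v)))
   (fun t => Q (G u' (d * t + v))) (4 * K ^+ 2 * e * d ^+ 2).
  rewrite mulr1 mulr0 add0r (addrC d); apply.
  - by apply: vside_cont => //; [exact: ltW|move/andP : uu' => [? ?]; apply/andP; split; lra].
  - by move=> t _; apply: (@rder_affine _ (fun x => Q (G u' x))); exact: rQ.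
  move=> t /andP[t0 t1]; rewrite -mulrBr -mulrBl !rnM rnR (gtr0_norm d0).
  rewrite (_ : _ * d ^+ 2 = d * ((e * (4 * K * d)) * K)); last by ring.
  rewrite ler_wpM2l ?(ltW d0)// ler_pM ?rn_ge0//.
    by apply: near_c => //; apply/andP; split; nra.
  by apply: Gv_le; [move/andP : uu' => [? ?]; apply/andP; split; lra|apply: in01 => //; [exact:
      ltW|apply/andP]].
have [d0' vd' ud' vd'' ud''] : [/\ 0 <= d, v <= v <= v + d, u <= u <= u + d, v <= v + d <= v + d &
    u <= u + d <= u + d].
  by rewrite !lexx !lerDl (ltW d0).
have h1 := h_near _ vd'; have h2 := h_near _ vd''.
have v1 := v_near _ ud'; have v2 := v_near _ ud''.
rewrite /boundary_integral.
set M := 2 * _ in h1 h2 v1 v2.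
rewrite (_ : _ * d ^+ 2 = M + M + M + M); last by rewrite /M; ring.
rewrite (_ : hside u v d + _ - _ - _ = (hside u v d - (Q (G (u + d) v) - Q (G u v))) +
  (vside (u + d) v d - (Q (G (u + d) (v + d)) - Q (G (u + d) v))) -
  (hside u (v + d) d - (Q (G (u + d) (v + d)) - Q (G u (v + d)))) -
  (vside u v d - (Q (G u (v + d)) - Q (G u v)))); last by ring.
by do 3 (apply: le_trans (rnD _ _) _; rewrite ?rnN; apply: lerD => //).
Qed.

Lemma nested_point (a d : nat -> R) : (forall n, 0 <= d n) ->
  (forall n, a n <= a n.+1) -> (forall n, a n.+1 + d n.+1 <= a n + d n) ->
  exists x, forall n, a n <= x <= a n + d n.
Proof.
move=> d0 ai adi.
have mono m n : (m <= n)%N -> a m <= a n /\ a n + d n <= a m + d m.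
  elim: n => [|n IH]; first by rewrite leqn0 => /eqP ->; rewrite !lexx.
  rewrite leq_eqVlt => /predU1P[->|]; first by rewrite !lexx.
  by rewrite ltnS => /IH[h1 h2]; split; [exact: le_trans (ai n)|exact: le_trans h2].
have ub n : ubound (range a) (a n + d n).
  move=> _ [m _ <-]; have [mn|/ltnW nm] := leqP m n.
    by apply: (le_trans (mono _ _ mn).1); rewrite lerDl.
  by apply: le_trans (mono _ _ nm).2; rewrite lerDl.
exists (sup (range a)) => n; apply/andP; split.
  by apply: ub_le_sup; [exists (a 0%N + d 0%N); exact: ub|exists n].
by apply: ge_sup => //; exists (a 0%N), 0%N.
Qed.

(** Of the four quarters of a square one carries at least a quarter of the boundary integral.
    Bisection keeps it at least [eta * d n ^+ 2], whereas near the common point of the nested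
    squares the local bound is a smaller multiple of [d n ^+ 2]. *)
Lemma goursat : boundary_integral 0 0 1 = 0.
Proof.
apply/eqP; rewrite -rn_eq0; apply/negPn/negP => J0.
have {}J0 : 0 < rn (boundary_integral 0 0 1) by rewrite lt_neqAle eq_sym J0 rn_ge0.
set eta := rn _ in J0.
pose d (n : nat) : R := 2^-1 ^+ n.
have d_gt0 n : 0 < d n by rewrite exprn_gt0.
have dS n : d n.+1 = d n / 2 by rewrite /d exprSr.
pose good n (p : R * R) := [/\ 0 <= p.1, p.1 + d n <= 1, 0 <= p.2, p.2 + d n <= 1 &
  eta * d n ^+ 2 <= rn (boundary_integral p.1 p.2 (d n))].
pose next n (p q : R * R) := [/\ good n.+1 q, p.1 <= q.1, q.1 + d n.+1 <= p.1 + d n,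
  p.2 <= q.2 & q.2 + d n.+1 <= p.2 + d n].
have step (x : nat * (R * R)) : exists q, good x.1 x.2 -> next x.1 x.2 q.
  case: x => n [u v] /=; have [|ng] := pselect (good n (u, v)); last by exists (0, 0).
  rewrite {1}/good/= => -[u0 u1 v0 v1]; have dn := d_gt0 n.
  rewrite boundary_integral_split ?(ltW dn)// -dS => H.
  have {}dS := dS n; have dn' := d_gt0 n.+1.
  have [f1 f2 f3 f4] : [/\ 0 <= u + d n.+1, u + d n.+1 + d n.+1 <= 1, 0 <= v + d n.+1 &
    v + d n.+1 + d n.+1 <= 1] by clear H; split; lra.
  have [f5 f6 f7 f8] : [/\ u + d n.+1 <= 1, v + d n.+1 <= 1, u <= u + d n.+1 &
    v <= v + d n.+1] by clear H; split; lra.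
  have [f9 g1 g2 g3] : [/\ u + d n.+1 <= u + d n, v + d n.+1 <= v + d n,
    u + d n.+1 + d n.+1 <= u + d n & v + d n.+1 + d n.+1 <= v + d n] by clear H; split; lra.
  have [h|h1] := leP (eta * d n.+1 ^+ 2) (rn (boundary_integral u v (d n.+1))).
    by exists (u, v); rewrite /next/good /= => _; split.
  have [h|h2] := leP (eta * d n.+1 ^+ 2) (rn (boundary_integral (u + d n.+1) v (d n.+1))).
    by exists (u + d n.+1, v); rewrite /next/good /= => _; split.
  have [h|h3] := leP (eta * d n.+1 ^+ 2) (rn (boundary_integral u (v + d n.+1) (d n.+1))).
    by exists (u, v + d n.+1); rewrite /next/good /= => _; split.
  have [h|h4] := leP (eta * d n.+1 ^+ 2) (rn (boundary_integral (u + d n.+1) (v + d n.+1) (d n.+1))).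
    by exists (u + d n.+1, v + d n.+1); rewrite /next/good /= => _; split.
  exfalso; move: H; apply/negP; rewrite -ltNge.
  rewrite (_ : eta * d n ^+ 2 = eta * d n.+1 ^+ 2 + eta * d n.+1 ^+ 2 +
    eta * d n.+1 ^+ 2 + eta * d n.+1 ^+ 2); last by rewrite dS; field.
  do 3 (apply: (le_lt_trans (rnD _ _)); apply: ltrD => //).
have [F HF] := choice step.
pose s := fix s n := if n is m.+1 then F (m, s m) else (0, 0).
have gs n : good n (s n).
  elim: n => [|n IH]; last by have [] := HF (n, s n) IH.
  by rewrite /good/= /d expr0 expr1n mulr1 !add0r !lexx.
have ns n : next n (s n) (s n.+1) by exact: (HF (n, s n) (gs n)).
have [|||u0 Hu] := @nested_point (fun n => (s n).1) d.
- by move=> n; exact: ltW.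
- by move=> n; have [] := ns n.
- by move=> n; have [] := ns n.
have [|||v0 Hv] := @nested_point (fun n => (s n).2) d.
- by move=> n; exact: ltW.
- by move=> n; have [] := ns n.
- by move=> n; have [] := ns n.
have u001 : 0 <= u0 <= 1 by have := Hu 0%N; rewrite /= add0r /d expr0.
have v001 : 0 <= v0 <= 1 by have := Hv 0%N; rewrite /= add0r /d expr0.
have K1 : 0 < 32 * K ^+ 2 + 1 by rewrite ltr_wpDl// mulr_ge0// exprn_ge0.
have e0 : 0 < eta / (32 * K ^+ 2 + 1) by rewrite divr_gt0.
have [dl dl0 H] := boundary_integral_local u001 v001 e0.
have [n dn] : exists n, d n < dl.
  have : (fun n => 2^-1 ^+ n : R) @ \oo --> 0 by apply: cvg_expr; rewrite gtr0_norm ?invf_lt1// ltr1n.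
  move=> /cvgr0_norm_lt /(_ _ dl0)[n _ /(_ n (leqnn _))].
  by rewrite /= gtr0_norm ?exprn_gt0//; exists n.
have [h1 h2 h3 h4 h5] := gs n.
have := H (s n).1 (s n).2 (d n) _ h1 h2 h3 h4 (Hu n) (Hv n).
rewrite d_gt0 dn => /(_ isT); apply/negP; rewrite -ltNge; apply: lt_le_trans h5.
by rewrite ltr_pM2r ?exprn_gt0// mulrA ltr_pdivrMr// mulrC ltr_pM2l// ltrDl.
Qed.

End Goursat.

(** * Cauchy's formula and estimates of finite differences *)

Section CauchyFormula.
Context {R : realType}.

Let e (v : R) : R[i] := cos (2 * pi * v) +i* sin (2 * pi * v).

Let rn_e v : rn (e v) = 1.
Proof. by rewrite /rn normc_def/= cos2Dsin2 sqrtr1. Qed.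

Let e_der v : rder e v ((2 * pi)%:C * 'i%C * e v).
Proof.
have dl : is_derive v (1 : R) (fun x => 2 * pi * x) (2 * pi).
  have := @is_deriveZ _ _ _ id (2 * pi) v (1 : R) 1 (is_derive_id _ _).
  by rewrite /GRing.scale/= mulr1.
apply: rderP.
  have H : is_derive v (1 : R) (cos \o (fun x => 2 * pi * x)) (- sin (2 * pi * v) * (2 * pi)).
    by have := is_derive1_comp (is_derive_cos _) dl.
  apply: is_derive_eq H _; rewrite /= !(mulr0, mul0r, mulr1, mul1r, subr0, addr0, add0r, sub0r).
  by ring.
have H : is_derive v (1 : R) (sin \o (fun x => 2 * pi * x)) (cos (2 * pi * v) * (2 * pi)).
  by have := is_derive1_comp (is_derive_sin _) dl.
apply: is_derive_eq H _; rewrite /= !(mulr0, mul0r, mulr1, mul1r, subr0, addr0, add0r, sub0r).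
by ring.
Qed.

Let e0 : e 0 = 1.
Proof. by rewrite /e mulr0 cos0 sin0. Qed.

Let e1 : e 1 = 1.
Proof. by rewrite /e mulr1 (mulrC 2) mulr_natr cos2pi sin2pi. Qed.

Variables (phi : R[i] -> R[i]) (rho : R).
Hypothesis rho_gt0 : 0 < rho.
Hypothesis phi_diff : forall z, rn z <= rho -> differentiable phi z.

Let pi2i : R[i] := (2 * pi)%:C * 'i%C.

Let pi2i_neq0 : pi2i != 0.
Proof.
rewrite mulf_neq0//; last by rewrite eq_complex/= oner_eq0 andbF.
by rewrite eq_complex/= eqxx andbT mulf_neq0 ?gt_eqF// pi_gt0.
Qed.

Let cont_e : cont01 e.
Proof. exact: rder_cont01 e_der. Qed.

Let cont_e' a d : cont01 (fun t => e (d * t + a)).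
Proof. by apply: rder_cont01 => t; exact: rder_affine (e_der _). Qed.

Let rn_rhoe v : rn (rho%:C * e v) = rho.
Proof. by rewrite rnM rn_e rnR mulr1 gtr0_norm. Qed.

Let rho_sub s v : rn s < rho -> rho - rn s <= rn (rho%:C * e v - s).
Proof.
move=> sr; rewrite lerBlDr -[X in X <= _](rn_rhoe v).
by rewrite -{1}(subrK s (rho%:C * e v)) rnD.
Qed.

Let rhoe_neq s v : rn s < rho -> rho%:C * e v - s != 0.
Proof.
by move=> sr; rewrite -rn_eq0 gt_eqF// (lt_le_trans _ (rho_sub v sr))// subr_gt0.
Qed.

Let kern (s : R[i]) (t : R) : R[i] :=
  phi (rho%:C * e t) * (rho%:C * e t / (rho%:C * e t - s)).

Let kern_cont s : rn s < rho -> cont01 (kern s).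
Proof.
move=> sr; apply: cont01M.
  apply: (cont01_comp (F := phi)); first exact: cont01Z.
  by move=> t _; apply/differentiable_continuous/phi_diff; rewrite rn_rhoe.
apply: (cont01_comp (F := fun z => z / (z - s))); first exact: cont01Z.
move=> t _; apply/differentiable_continuous/differentiableM; first by [].
by apply: differentiableV; [exact: differentiableB|exact: rhoe_neq].
Qed.

(** [G u v = (1 - u) s + A u e(v)] deforms the circle of radius [eps] about [s] into the one of
    radius [rho] about [0]. As [e 0 = e 1], the horizontal sides coincide and cancel. The pole is
    avoided because [|G - s| >= A u - u |s| = (1 - u) eps + u (rho - |s|) > 0]. With
    [dz = 2 pi i z dt] on the large circle and [dz = 2 pi i (z - s) dt] on the small one, the factor
    [2 pi i] drops out. *)
Lemma cauchy_circles (s : R[i]) (eps : R) : rn s < rho -> 0 < eps -> eps + rn s <= rho ->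
  I01 (fun t => phi (rho%:C * e t) * (rho%:C * e t / (rho%:C * e t - s))) =
  I01 (fun t => phi (s + eps%:C * e t)).
Proof.
move=> sr eps0 epsr.
pose A (u : R) : R := (1 - u) * eps + u * rho.
pose G (u v : R) : R[i] := s + (- s) * u%:C + (A u)%:C * e v.
pose Gu (u v : R) : R[i] := - s + (rho - eps)%:C * e v.
pose Gv (u v : R) : R[i] := (A u)%:C * (pi2i * e v).
have A0 u : 0 <= u <= 1 -> 0 < A u <= rho.
  move=> /andP[u0 u1]; have := rn_ge0 s; rewrite /A => s0; apply/andP; split; nra.
have GE u v : G u v - s = (A u)%:C * e v - u%:C * s by rewrite /G; ring.
have G_neq u v : 0 <= u <= 1 -> G u v - s != 0.
  move=> /[dup] u01 /andP[u0 u1]; rewrite -rn_eq0 GE gt_eqF//.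
  have : rn ((A u)%:C * e v) <= rn ((A u)%:C * e v - u%:C * s) + rn (u%:C * s).
    by rewrite -{1}(subrK (u%:C * s) ((A u)%:C * e v)) rnD.
  have [Au _] := andP (A0 _ u01).
  rewrite !rnM !rnR rn_e mulr1 (gtr0_norm Au) ger0_norm// -lerBlDr; apply: lt_le_trans.
  by have := rn_ge0 s; rewrite /A => s0; nra.
have rdR (c d : R) u : rder (fun u => (c * u + d)%:C) u c%:C.
  apply: rderP => /=; last by apply: is_derive_cst.
  have := @is_deriveD _ _ _ _ _ u (1 : R) _ _ (@is_deriveZ _ _ _ id c u (1 : R) 1 (is_derive_id _
      _)) (is_derive_cst d _ _).
  by rewrite addr0 /GRing.scale/= mulr1.
have rid (u : R) : rder (fun u : R => u%:C) u 1.
  by have := rdR 1 0 u; congr rder; apply/funext => x; rewrite mul1r addr0.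
have rA u : rder (fun u => (A u)%:C) u (rho - eps)%:C.
  by have := rdR (rho - eps) eps u; congr rder; apply/funext => x; congr (_%:C); rewrite /A; ring.
have gG : boundary_integral (fun z => phi z / (z - s)) G Gu Gv 0 0 1 = 0.
  apply: (@goursat _ _ _ _ _ (rn s + `|rho - eps| + rho * rn pi2i)).
  - move=> u v.
    have := rder_lin (e v) (rder_lin (- s) (rder_cst s u) (rid u)) (rA u).
    congr rder; last by rewrite /Gu; ring.
    by apply/funext => x; rewrite /G; ring.
  - move=> u v.
    have := rder_lin (A u)%:C (rder_cst (s + (- s) * u%:C) v) (e_der v).
    by congr rder; rewrite /Gv add0r.
  - by move=> a d v; exact: cont01_cst.
  - by move=> a d u; apply/cont01Z/cont01Z/cont_e'.
  - move=> u v _ _; rewrite /Gu (le_trans (rnD _ _))// rnN rnM rnR rn_e mulr1 lerDl.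
    by rewrite mulr_ge0 ?rn_ge0// ltW.
  - move=> u v u01 _; have /andP[Au0 Au1] := A0 _ u01.
    rewrite /Gv rnM (rnM pi2i) rnR rn_e mulr1 (gtr0_norm Au0).
    by rewrite ler_wpDl ?addr_ge0 ?rn_ge0// ler_wpM2r// rn_ge0.
  - move=> u v u01 v01; apply: differentiableM.
      apply: phi_diff; rewrite /G (_ : s + _ = (1 - u)%:C * s); last by rewrite rcD rcN; ring.
      move: (u01) => /andP[u0 u1]; have /andP[Au0 Au1] := A0 _ u01.
      rewrite (le_trans (rnD _ _))// !rnM !rnR rn_e mulr1 (gtr0_norm Au0) ger0_norm ?subr_ge0//.
      by have := rn_ge0 s; rewrite /A => s0; nra.
    apply: differentiableV; last exact: G_neq.
    exact: differentiableB.
move: gG; rewrite /boundary_integral.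
have -> : hside (fun z => phi z / (z - s)) G Gu 0 (0 + 1) 1 =
          hside (fun z => phi z / (z - s)) G Gu 0 0 1.
  by rewrite add0r /hside; congr I01; apply/funext => t; rewrite /G /Gu e0 e1.
have AC (h a b : R[i]) : h + a - h - b = a - b by ring.
rewrite AC => /eqP; rewrite subr_eq0 => /eqP.
rewrite /vside add0r.
have -> : (fun t => 1%:C * (phi (G 1 (1 * t + 0)) / (G 1 (1 * t + 0) - s) * Gv 1 (1 * t + 0))) =
    (fun t => pi2i * (phi (rho%:C * e t) * (rho%:C * e t / (rho%:C * e t - s)))).
  apply/funext => t; rewrite mul1r addr0 /Gv /G /A subrr mul0r add0r !mul1r mulr1 subrr add0r.
  by ring.
have -> : (fun t => 1%:C * (phi (G 0 (1 * t + 0)) / (G 0 (1 * t + 0) - s) * Gv 0 (1 * t + 0))) =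
    (fun t => pi2i * phi (s + eps%:C * e t)).
  apply/funext => t; rewrite mul1r addr0 /Gv /G /A subr0 mul0r addr0 !mul1r mulr0 addr0.
  rewrite [s + _ - s]addrAC subrr add0r.
  have alg (p a b q : R[i]) : a * b != 0 -> p / (a * b) * (a * (q * b)) = q * p.
    by rewrite mulf_eq0 negb_or => /andP[a0 b0]; field; rewrite a0 b0.
  by rewrite alg// -rn_eq0 rnM rn_e rnR mulr1 normr_eq0 gt_eqF.
rewrite !I01Z; first by move/(mulfI pi2i_neq0).
  apply: (cont01_comp (F := phi)).
    exact: cont01D (cont01_cst s) (cont01Z eps%:C cont_e).
  move=> t _; apply/differentiable_continuous/phi_diff.
  rewrite (le_trans (rnD _ _))// rnM rnR rn_e mulr1 gtr0_norm// addrC//.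
exact: kern_cont.
Qed.

Lemma cauchy_formula (s : R[i]) : rn s < rho -> I01 (kern s) = phi s.
Proof.
move=> sr; apply/eqP; rewrite -subr_eq0 -rn_eq0; apply/negPn/negP => H.
have {}H : 0 < rn (I01 (kern s) - phi s) by rewrite lt_neqAle eq_sym H rn_ge0.
set eta := rn _ in H.
have eta4 : 0 < eta / 4 by rewrite divr_gt0.
have [d d0 Hd] := (continuous_rn _ _).1
  (differentiable_continuous (phi_diff (ltW sr))) _ eta4.
pose eps := Num.min (d / 2) (rho - rn s).
have eps0 : 0 < eps by rewrite lt_min divr_gt0//= subr_gt0.
have epsr : eps + rn s <= rho by rewrite -lerBrDr ge_min lexx orbT.
have epsd : eps < d.
  by apply: le_lt_trans (_ : d / 2 < d); [rewrite ge_min lexx|rewrite ltr_pdivrMr// ltr_pMr// ltr1n].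
have rne t : rn (eps%:C * e t) = eps by rewrite rnM rn_e rnR mulr1 gtr0_norm.
have cphi : cont01 (fun t => phi (s + eps%:C * e t)).
  apply: (cont01_comp (F := phi)); first exact: cont01D (cont01_cst s) (cont01Z eps%:C cont_e).
  by move=> t _; apply/differentiable_continuous/phi_diff; rewrite (le_trans (rnD _ _))// rne addrC.
suff : eta <= 2 * (eta / 4) by lra.
rewrite {1}/eta /kern (cauchy_circles sr eps0 epsr) -[X in rn (_ - X)]I01_cst -I01B//; last exact: cont01_cst.
apply: I01_le; first exact: cont01B cphi (cont01_cst _).
move=> t _; apply/ltW/Hd.
by rewrite addrAC subrr add0r rne.
Qed.

Variable M : R.
Hypothesis phi_le : forall z, rn z <= rho -> rn (phi z) <= M.

Let M_ge0 : 0 <= M.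
Proof. by apply: le_trans (rn_ge0 _) (phi_le (z := 0) _); rewrite rn0 ltW. Qed.

(** The Cauchy kernels at [1] and [0] differ by [1 / (z - 1)], at most [2 / rho] on the circle. Only
    values at [0] and [1] occur: applied to [z |-> f (x + z v)], with [rho] of the order of
    [r / |v|], this bounds an increment of [f] without any derivative. *)
Lemma cauchy_bound1 : 2 <= rho -> rn (phi 1 - phi 0) <= 4 * M / rho.
Proof.
move=> rho2; have r1 : rn (1 : R[i]) < rho by rewrite rn1; lra.
have r0 : rn (0 : R[i]) < rho by rewrite rn0; lra.
rewrite -!cauchy_formula// -I01B; [|exact: kern_cont..].
rewrite (_ : 4 * M / rho = 2 * (M * (2 / rho))); last by ring.
apply: I01_le => [|t _]; first by apply: cont01B; exact: kern_cont.
have n1 := rhoe_neq t r1; have n0 := rhoe_neq t r0.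
have -> : kern 1 t - kern 0 t = phi (rho%:C * e t) * (rho%:C * e t - 1)^-1.
  have alg (z p : R[i]) : z - 0 != 0 -> z - 1 != 0 ->
      p * (z / (z - 1)) - p * (z / (z - 0)) = p / (z - 1).
    by rewrite subr0 => h0 h1; field; rewrite h0 h1.
  exact: alg.
rewrite rnM rnV ler_pM ?rn_ge0 ?invr_ge0 ?rn_ge0//; first by rewrite phi_le// rn_rhoe.
have r2 : rho / 2 <= rn (rho%:C * e t - 1).
  by apply: le_trans (rho_sub _ r1); rewrite rn1; lra.
rewrite -[2 / rho]invf_div lef_pV2// posrE ?divr_gt0//.
by apply: lt_le_trans r2; rewrite divr_gt0.
Qed.

(** The combination of the three kernels is [s (s - 1) / ((z - s) (z - 1))], where [|s - 1| <= 2]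
    and both denominators are at least [rho / 2]. *)
Lemma cauchy_bound2 (s : R[i]) : 2 <= rho -> rn s <= 1 ->
  rn (phi s - phi 0 - s * (phi 1 - phi 0)) <= 16 * M * rn s / rho ^+ 2.
Proof.
move=> rho2 s1; have rs : rn s < rho by lra.
have r1 : rn (1 : R[i]) < rho by rewrite rn1; lra.
have r0 : rn (0 : R[i]) < rho by rewrite rn0; lra.
have c10 : cont01 (fun t => kern 1 t - kern 0 t) by apply: cont01B; exact: kern_cont.
have cs0 : cont01 (fun t => kern s t - kern 0 t) by apply: cont01B; exact: kern_cont.
rewrite -!cauchy_formula// -!I01B; [|exact: kern_cont..].
rewrite -I01Z// -I01B//; last exact: cont01Z.
rewrite (_ : 16 * M * rn s / rho ^+ 2 = 2 * (M * (rn s * 2 * (2 / rho) * (2 / rho)))); last first.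
  by rewrite expr2; field; rewrite gt_eqF.
apply: I01_le => [|t _]; first by apply: cont01B => //; exact: cont01Z.
have n1 := rhoe_neq t r1; have n0 := rhoe_neq t r0; have ns := rhoe_neq t rs.
have -> : kern s t - kern 0 t - s * (kern 1 t - kern 0 t) =
    phi (rho%:C * e t) * (s * (s - 1) / (rho%:C * e t - s) / (rho%:C * e t - 1)).
  have alg (z p : R[i]) : z - 0 != 0 -> z - 1 != 0 -> z - s != 0 ->
      p * (z / (z - s)) - p * (z / (z - 0)) - s * (p * (z / (z - 1)) - p * (z / (z - 0))) =
      p * (s * (s - 1) / (z - s) / (z - 1)).
    by rewrite subr0 => h0 h1 h2; field; rewrite h0 h1 h2.
  exact: alg.
have half (z : R[i]) : rn z <= 1 -> rn z < rho -> (rn (rho%:C * e t - z))^-1 <= 2 / rho.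
  move=> z1 zr; have r2 : rho / 2 <= rn (rho%:C * e t - z).
    by apply: le_trans (rho_sub _ zr); lra.
  rewrite -[2 / rho]invf_div lef_pV2// posrE ?divr_gt0//.
  by apply: lt_le_trans r2; rewrite divr_gt0.
rewrite !rnM !rnV ler_pM ?rn_ge0 ?mulr_ge0 ?invr_ge0 ?rn_ge0//.
  by rewrite phi_le// rn_rhoe.
rewrite ler_pM ?mulr_ge0 ?invr_ge0 ?rn_ge0 ?half ?rn1//; last by lra.
rewrite ler_pM ?mulr_ge0 ?invr_ge0 ?rn_ge0 ?half ?rn1//.
by rewrite ler_wpM2l ?rn_ge0// (le_trans (rnB _ _))// rn1; lra.
Qed.

End CauchyFormula.

Section ComplexSequences.
Context {R : realType}.
Implicit Types (u : nat -> R[i]) (l : R[i]).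

Lemma rn_cauchy_cvg u : (forall e : R, 0 < e -> exists N : nat, forall m n,
    (N <= m)%N -> (N <= n)%N -> rn (u m - u n) < e) ->
  exists l, u n @[n --> \oo] --> l.
Proof.
move=> H.
have key (p : R[i] -> R) : (forall x y, `|p x - p y| <= rn (x - y)) ->
    cvg (p (u n) @[n --> \oo]).
  move=> pl; apply/cauchy_cvgP/cauchy_exP => e /H[N HN].
  exists (p (u N)); exists N => // n /= Nn.
  by rewrite -ball_normE/= (le_lt_trans (pl _ _))// HN.
have /cvg_ex[a /cvgrPdist_lt ca] : cvg (complex.Re (u n) @[n --> \oo]).
  by apply: key => x y; rewrite -cReN -cReD rnRe.
have /cvg_ex[b /cvgrPdist_lt cb] : cvg (complex.Im (u n) @[n --> \oo]).
  by apply: key => x y; rewrite -cImN -cImD rnIm.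
exists (a +i* b); apply/cvg_rn => e e0.
have e20 : 0 < e / 2 by rewrite divr_gt0.
apply: filterS2 (ca _ e20) (cb _ e20) => n h1 h2.
by rewrite rnC (le_lt_trans (rn_ReIm _))// !ReImE (splitr e) ltrD.
Qed.

Lemma rn_lim_le u l (K : R) : u n @[n --> \oo] --> l ->
  (\forall n \near \oo, rn (u n) <= K) -> rn l <= K.
Proof.
move=> /cvg_rn ul uK; apply/ler_addgt0Pl => e e0.
have [n [h1 h2]] := @filter_ex _ \oo _ _ (filterI (ul _ e0) uK).
by rewrite -(subrK (u n) l) (le_trans (rnD _ _))// lerD// rnC ltW.
Qed.

Lemma rn_lim_eq u l l' : u n @[n --> \oo] --> l ->
  (forall e : R, 0 < e -> \forall n \near \oo, rn (u n - l') <= e) -> l = l'.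
Proof.
move=> ul H; apply/eqP; rewrite -subr_eq0 -rn_eq0 eq_le rn_ge0 andbT.
apply/ler_addgt0Pl => e e0; rewrite addr0; apply: rn_lim_le (H _ e0).
by apply: cvgB; [exact: ul|exact: cvg_cst].
Qed.

Lemma half_pow_small (K e : R) : 0 < e -> \forall n \near \oo, K * 2^-1 ^+ n < e.
Proof.
move=> e0; have : (fun n => K * 2^-1 ^+ n : R) @ \oo --> K * 0.
  apply: cvgMl_tmp; apply: cvg_expr; rewrite gtr0_norm ?invf_lt1// ltr1n//.
rewrite mulr0 => /cvgr0_norm_lt /(_ _ e0); apply: filterS => n.
exact/le_lt_trans/ler_norm.
Qed.

End ComplexSequences.

Section QuantitativeHolomorphy.
Context {R : realType}.
Implicit Types (V : normedModType R[i]).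

(* The linear difference inequalities characterizing holomorphy near [x]; being
   linear and derivative-free, they pass to integrals and pointwise limits. *)
Definition almost_linear V (f : V -> R[i]) (x : V) (C r : R) : Prop :=
  forall v v' (s : R[i]), rn v <= r -> rn v' <= r -> rn s <= 1 ->
  [/\ rn (f (x + v) - f x) <= C * rn v,
      rn (f (x + s *: v) - f x - s * (f (x + v) - f x)) <= C * rn s * rn v ^+ 2 &
      rn (f (x + v + v') - f (x + v) - (f (x + v') - f x)) <= C * rn v * rn v'].

(** On the complex line through [x] with direction [v] the function is bounded on a disc of radius
    of the order of [r / |v|], so the two Cauchy bounds yield one, respectively two, factors [|v|].
    For the mixed inequality the first bound is applied to [z |-> f (x + v' + z v) - f (x + z v)],
    which is itself of order [|v'|] on a smaller ball. *)
Lemma bounded_almost_linear V (f : V -> R[i]) (x : V) (M r : R) : 0 < r ->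
  (forall y, rn (y - x) < r -> differentiable f y) ->
  (forall y, rn (y - x) < r -> rn (f y) <= M) ->
  almost_linear f x (8 * M / r + 256 * M / r ^+ 2) (r / 8).
Proof.
move=> r0 df fM v v' s vr v'r s1.
have M0 : 0 <= M.
  by apply: le_trans (rn_ge0 _) (fM x _); rewrite subrr rn0.
have lip y w q : 0 < q -> rn w <= q / 4 -> (forall z, rn (z - y) <= q / 2 -> rn (z - x) < r) ->
    rn (f (y + w) - f y) <= 8 * M / q * rn w.
  move=> q0 wq Hq; have [->|w0] := eqVneq w 0; first by rewrite addr0 subrr !rn0 mulr0.
  have {}w0 : 0 < rn w by rewrite lt_neqAle eq_sym rn_eq0 w0 rn_ge0.
  have rho2 : 2 <= q / 2 / rn w by rewrite ler_pdivlMr//; lra.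
  have in_ball (z : R[i]) : rn z <= q / 2 / rn w -> rn (y + z *: w - x) < r.
    move=> zr; apply: Hq; rewrite addrAC subrr add0r rnZ.
    by rewrite -ler_pdivlMr.
  have := @cauchy_bound1 _ (fun z : R[i] => f (y + z *: w)) (q / 2 / rn w) _ _ M _ rho2.
  rewrite scale1r scale0r addr0 => H; apply: le_trans (H _ _ _) _.
  - by lra.
  - by move=> z /in_ball zr; exact/differentiable_line/df.
  - by move=> z /in_ball; exact: fM.
  by rewrite le_eqVlt; apply/predU1P; left; field; rewrite !gt_eqF.
have c1 : 0 <= 8 * M / r by rewrite divr_ge0 ?mulr_ge0// ltW.
have c2 : 0 <= 256 * M / r ^+ 2.
  by apply: divr_ge0; rewrite ?mulr_ge0 ?exprn_ge0 ?(ltW r0) ?ler0n.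
split.
- apply: le_trans (lip x v r r0 _ _) _.
  + by lra.
  + by move=> z /le_lt_trans; apply; lra.
  + by rewrite ler_wpM2r ?rn_ge0// lerDl.
- apply: (@le_trans _ _ (256 * M / r ^+ 2 * rn s * rn v ^+ 2)); last first.
    by rewrite ler_wpM2r ?exprn_ge0 ?rn_ge0// ler_wpM2r ?rn_ge0// lerDr.
  have [->|v0] := eqVneq v 0.
    by rewrite scaler0 addr0 subrr mulr0 subrr !rn0 expr0n mulr0.
  have {}v0 : 0 < rn v by rewrite lt_neqAle eq_sym rn_eq0 v0 rn_ge0.
  have rho2 : 2 <= r / 2 / rn v by rewrite ler_pdivlMr//; lra.
  have in_ball (z : R[i]) : rn z <= r / 2 / rn v -> rn (x + z *: v - x) < r.
    move=> zr; rewrite addrAC subrr add0r rnZ.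
    by rewrite -ltr_pdivlMr// (le_lt_trans zr)// ltr_pM2r ?invr_gt0//; lra.
  have := @cauchy_bound2 _ (fun z : R[i] => f (x + z *: v)) (r / 2 / rn v) _ _ M _ s rho2 s1.
  rewrite scale1r scale0r addr0 => H; apply: le_trans (H _ _ _) _.
  + by lra.
  + by move=> z /in_ball zr; exact/differentiable_line/df.
  + by move=> z /in_ball; exact: fM.
  rewrite (_ : 16 * M * rn s / _ = 64 * M / r ^+ 2 * rn s * rn v ^+ 2); last first.
    by field; rewrite !gt_eqF.
  do 2 (rewrite ler_wpM2r ?exprn_ge0 ?rn_ge0//).
  by rewrite ler_wpM2r ?invr_ge0 ?exprn_ge0 ?(ltW r0)// ler_wpM2r//; lra.
- apply: (@le_trans _ _ (256 * M / r ^+ 2 * rn v * rn v')); last first.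
    by rewrite ler_wpM2r ?rn_ge0// ler_wpM2r ?rn_ge0// lerDr.
  have [->|v0] := eqVneq v 0.
    by rewrite !addr0 subrr !rn0 mulr0 mul0r.
  have {}v0 : 0 < rn v by rewrite lt_neqAle eq_sym rn_eq0 v0 rn_ge0.
  have rho2 : 2 <= r / 4 / rn v by rewrite ler_pdivlMr//; lra.
  have in_ball (z : R[i]) : rn z <= r / 4 / rn v -> rn (z *: v) <= r / 4.
    by move=> zr; rewrite rnZ -ler_pdivlMr.
  have := @cauchy_bound1 _ (fun z : R[i] => f (x + v' + z *: v) - f (x + z *: v))
    (r / 4 / rn v) _ _ (16 * M / r * rn v') _ rho2.
  rewrite scale1r scale0r !addr0 => H.
  rewrite (addrAC x) [X in rn X](_ : _ = f (x + v' + v) - f (x + v) - (f (x + v') - f x)); last by ring.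
  apply: le_trans (H _ _ _) _.
  + by lra.
  + move=> z /in_ball zr; apply: differentiableB; apply/differentiable_line/df.
      rewrite addrAC (addrAC x) subrr add0r (le_lt_trans (rnD _ _))//; lra.
    by rewrite addrAC subrr add0r; lra.
  + move=> z /in_ball zr; rewrite (addrAC x).
    apply: le_trans (lip _ v' (r / 2) _ _ _) _; [by lra|by lra| |].
      move=> y yz; rewrite (_ : y - x = (y - (x + z *: v)) + z *: v); last first.
        by rewrite opprD addrA subrK.
      by apply: le_lt_trans (rnD _ _) _; lra.
    by rewrite le_eqVlt; apply/predU1P; left; field; rewrite gt_eqF.
  by rewrite le_eqVlt; apply/predU1P; left; field; rewrite !gt_eqF.
Qed.

(** The differential is the limit of [2^n (f (x + 2^-n v) - f x)]. The second inequality makes this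
    sequence Cauchy and the limit homogeneous for [|s| <= 1], hence for all scalars; the third makes
    it additive, the first bounded. The second one with [s = 2^-n] becomes the quadratic remainder
    in the limit. *)
Lemma almost_linear_differentiable V (f : V -> R[i]) (x : V) (C r : R) : 0 <= C ->
  0 < r -> almost_linear f x C r -> differentiable f x /\
  forall v, rn v <= r -> rn (f (x + v) - f x - 'd f x v) <= C * rn v ^+ 2.
Proof.
move=> C0 r0 Hal.
have rn01 : rn (0 : R[i]) <= 1 by rewrite rn0.
pose h (n : nat) : R[i] := 2^-1 ^+ n.
have rnh n : rn (h n) = 2^-1 ^+ n by rewrite rnX rnV (_ : 2 = (2 : R)%:C) ?rnR ?ger0_norm//
    (rmorph_nat (real_complex R) 2).
have rnh0 n : 0 < rn (h n) by rewrite rnh exprn_gt0.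
have rnh1 n : rn (h n) <= 1 by rewrite rnh exprn_ile1// invf_le1// ler1n.
have h0 n : h n != 0 by rewrite -rn_eq0 gt_eqF.
pose a v n := (h n)^-1 * (f (x + h n *: v) - f x).
have small (v : V) : \forall n \near \oo, rn (h n *: v) <= r.
  apply: filterS (half_pow_small (rn v) r0) => n /ltW.
  by rewrite rnZ rnh mulrC.
have diffa v n (s : R[i]) : rn (h n *: v) <= r -> rn s <= 1 ->
    rn (a (s *: v) n - s * a v n) <= C * rn s * rn v ^+ 2 * 2^-1 ^+ n.
  move=> vr s1; have [_ H _] := Hal _ _ s vr vr s1.
  rewrite /a (mulrCA s) -mulrBr rnM rnV ler_pdivrMl// -rnh.
  rewrite [h n *: _](_ : _ = s *: (h n *: v)); last by rewrite !scalerA mulrC.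
  by apply: le_trans H _; rewrite rnZ le_eqVlt; apply/predU1P; left; ring.
have cva v : exists l : R[i], a v n @[n --> \oo] --> l.
  have step n m : rn (h n *: v) <= r -> rn (a v (n + m)%N - a v n) <= C * rn v ^+ 2 * 2^-1 ^+ n.
    move=> vr; have := diffa v n (h m) vr (rnh1 m).
    have -> : a (h m *: v) n - h m * a v n = h m * (a v (n + m)%N - a v n).
      have alg (p q y : R[i]) : p != 0 -> q != 0 -> p^-1 * y = q * ((p * q)^-1 * y).
        by move=> p0 q0; field; rewrite p0 q0.
      rewrite mulrBr; congr (_ - _); rewrite /a scalerA.
      by have -> : h (n + m)%N = h n * h m by [exact: exprD]; rewrite (alg _ (h m)).
    rewrite rnM => H; rewrite -(ler_pM2l (rnh0 m)) (le_trans H)//.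
    by rewrite le_eqVlt; apply/predU1P; left; ring.
  apply: rn_cauchy_cvg => e e0; have e20 : 0 < e / 2 by rewrite divr_gt0.
  have [N [HN1 HN2]] := @filter_ex _ \oo _ _ (filterI (small v) (half_pow_small (C * rn v ^+ 2) e20)).
  exists N => m n Nm Nn; rewrite -(subnKC Nm) -(subnKC Nn).
  rewrite -[X in rn X](subrKA (a v N)) (le_lt_trans (rnD _ _))// (splitr e) ltrD//.
    exact: le_lt_trans (step _ _ HN1) HN2.
  by rewrite rnC; exact: le_lt_trans (step _ _ HN1) HN2.
have [L HL] := choice cva.
have LZ (c : R[i]) v : L (c *: v) = c * L v.
  have LZ1 (s : R[i]) w : rn s <= 1 -> L (s *: w) = s * L w.
    move=> s1; apply: (rn_lim_eq (HL (s *: w))) => e e0.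
    have e20 : 0 < e / 2 by rewrite divr_gt0.
    have /cvg_rn /(_ _ e20) H1 : s * a w n @[n --> \oo] --> s * L w by apply: cvgMl_tmp; exact: HL.
    have H2 := half_pow_small (C * rn s * rn w ^+ 2) e20.
    near=> n; rewrite -[X in rn X](subrKA (s * a w n)) (le_trans (rnD _ _))// (splitr e) lerD//.
      apply: le_trans (diffa _ _ _ _ s1) _; first by near: n; exact: small.
      by apply: ltW; near: n; exact: H2.
    by apply: ltW; near: n; exact: H1.
  have [c1|/ltW c1] := leP (rn c) 1; first exact: LZ1.
  have c0 : c != 0 by rewrite -rn_eq0 gt_eqF// (lt_le_trans ltr01).
  have := LZ1 c^-1 (c *: v); rewrite scalerA mulVf// scale1r rnV invf_le1; last first.
    exact: lt_le_trans ltr01 c1.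
  by move=> -> //; rewrite mulrA mulfV// mul1r.
have LD v w : L (v + w) = L v + L w.
  apply: (rn_lim_eq (HL (v + w))) => e e0.
  have e30 : 0 < e / 3 by rewrite divr_gt0.
  have /cvg_rn H1 := HL v; have /cvg_rn H2 := HL w.
  have H3 := half_pow_small (C * rn v * rn w) e30.
  near=> n.
  rewrite (_ : _ - _ = (a (v + w) n - (a v n + a w n)) + (a v n - L v) + (a w n - L w)); last by ring.
  have b1 : rn (a v n - L v) < e / 3 by near: n; exact: H1.
  have b2 : rn (a w n - L w) < e / 3 by near: n; exact: H2.
  suff b3 : rn (a (v + w) n - (a v n + a w n)) < e / 3.
    apply: le_trans (rnD _ _) _; have := rnD (a (v + w) n - (a v n + a w n)) (a v n - L v).
    move: b1 b2 b3; lra.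
  apply: (@le_lt_trans _ _ (C * rn v * rn w * 2^-1 ^+ n)); last by near: n; exact: H3.
  have vr : rn (h n *: v) <= r by near: n; exact: small.
  have wr : rn (h n *: w) <= r by near: n; exact: small.
  have [_ _ H] := Hal _ _ 0 vr wr rn01; move: H.
  have -> : a (v + w) n - (a v n + a w n) = (h n)^-1 *
      (f (x + h n *: v + h n *: w) - f (x + h n *: v) - (f (x + h n *: w) - f x)).
    by rewrite /a scalerDr addrA; ring.
  rewrite rnM rnV ler_pdivrMl// => /le_trans; apply; rewrite !rnZ -rnh.
  by rewrite le_eqVlt; apply/predU1P; left; ring.
have Ll : linear L by move=> c v w; rewrite LD LZ.
have LC v : rn (L v) <= C * rn v.
  apply: rn_lim_le (HL v) _; apply: filterS (small v) => n vr.
  have [H _ _] := Hal _ _ 0 vr vr rn01; move: H.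
  by rewrite /a rnM rnV ler_pdivrMl// rnZ mulrCA.
have rem v : rn v <= r -> rn (f (x + v) - f x - L v) <= C * rn v ^+ 2.
  move=> vr; rewrite rnC.
  have cl : a v n - (f (x + v) - f x) @[n --> \oo] --> L v - (f (x + v) - f x).
    by apply: cvgB; [exact: HL|exact: cvg_cst].
  apply: rn_lim_le cl _; near=> n.
  have [_ H _] := Hal _ _ (h n) vr vr (rnh1 n).
  rewrite (_ : _ - _ = (h n)^-1 * (f (x + h n *: v) - f x - h n * (f (x + v) - f x))); last first.
    by rewrite mulrBr mulrA mulVf// mul1r.
  rewrite rnM rnV ler_pdivrMl// (le_trans H)//.
  by rewrite le_eqVlt; apply/predU1P; left; ring.
have [L' L'E] := linear_pack Ll.
have [||df dE] := @differentiable_from_eps _ _ _ f x L' C.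
- by move=> v; rewrite L'E.
- move=> e e0; have C1 : 0 < C + 1 by rewrite ltr_wpDl.
  exists (Num.min r (e / (C + 1))); first by rewrite lt_min r0 divr_gt0.
  move=> v; rewrite lt_min ltr_pdivlMr// => /andP[/ltW vr ve]; rewrite L'E.
  apply: le_trans (rem _ vr) _; rewrite expr2 mulrA ler_wpM2r ?rn_ge0//.
  by rewrite mulrC (le_trans _ (ltW ve))// ler_wpM2l ?rn_ge0// lerDl.
by split => // v vr; rewrite dE L'E; exact: rem.
Unshelve. all: by end_near. Qed.

Lemma diffZE V (f : V -> R[i]) (x v : V) (c : R[i]) : 'd f x (c *: v) = c * 'd f x v.
Proof. exact: linearZ. Qed.

(** Weierstrass' theorem from pointwise convergence and a local bound: the constants of
    [almost_linear] depend on the bound only, so the inequalities survive the limit. For the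
    differentials, [F n] and [f] are compared at [x] and [x + t v] with [t] fixed first, so small
    that both quadratic remainders are negligible against [t]. *)
Lemma differentiable_limit V (F : nat -> V -> R[i]) (f : V -> R[i]) (x : V) (M r : R) :
  0 < r ->
  (forall n y, rn (y - x) < r -> differentiable (F n) y) ->
  (forall n y, rn (y - x) < r -> rn (F n y) <= M) ->
  (forall y, rn (y - x) < r -> F n y @[n --> \oo] --> f y) ->
  differentiable f x /\ (forall v, 'd (F n) x v @[n --> \oo] --> 'd f x v).
Proof.
have fin (p q u w K T e : R) : p <= K -> q <= K -> u < T * (e / 4) -> w < T * (e / 4) ->
  K < T * (e / 4) -> p + q + u + w < T * e by lra.
move=> r0 dF FM Ff.
have M0 : 0 <= M.
  by apply: le_trans (rn_ge0 _) (FM 0%N x _); rewrite subrr rn0.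
pose C := 8 * M / r + 256 * M / r ^+ 2.
have C0 : 0 <= C.
  by apply: addr_ge0; apply: divr_ge0; rewrite ?mulr_ge0 ?exprn_ge0 ?(ltW r0) ?ler0n.
have r80 : 0 < r / 8 by rewrite divr_gt0.
have Fal n : almost_linear (F n) x C (r / 8).
  by apply: bounded_almost_linear => // y yr; [exact: dF|exact: FM].
have Fx v : rn v < r -> F n (x + v) @[n --> \oo] --> f (x + v).
  by move=> vr; apply: Ff; rewrite addrAC subrr add0r.
have Fx0 : F n x @[n --> \oo] --> f x by rewrite -[x]addr0; apply: Fx; rewrite rn0.
have fal : almost_linear f x C (r / 8).
  move=> v v' s vr v'r s1.
  have c1 : F n (x + v) @[n --> \oo] --> f (x + v) by apply: Fx; lra.
  have c2 : F n (x + v') @[n --> \oo] --> f (x + v') by apply: Fx; lra.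
  have c3 : F n (x + v + v') @[n --> \oo] --> f (x + v + v').
    by rewrite -addrA; apply: Fx; have := rnD v v'; lra.
  have c4 : F n (x + s *: v) @[n --> \oo] --> f (x + s *: v).
    apply: Fx; rewrite rnZ; apply: le_lt_trans (_ : rn v < r); last by lra.
    by rewrite ler_piMl ?rn_ge0.
  split.
  - apply: (rn_lim_le (cvgB c1 Fx0)); near=> n.
    by have [] := Fal n v v' s vr v'r s1.
  - have c5 : F n (x + s *: v) - F n x - s * (F n (x + v) - F n x) @[n --> \oo] -->
        f (x + s *: v) - f x - s * (f (x + v) - f x).
      by apply: cvgB; [exact: cvgB c4 Fx0|apply: cvgMl_tmp; exact: cvgB c1 Fx0].
    apply: (rn_lim_le c5); near=> n.
    by have [] := Fal n v v' s vr v'r s1.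
  - apply: (rn_lim_le (cvgB (cvgB c3 c1) (cvgB c2 Fx0))); near=> n.
    by have [] := Fal n v v' s vr v'r s1.
have [df rem] := almost_linear_differentiable C0 r80 fal.
split; first exact: df.
move=> v; apply/cvg_rn => e e0.
have [Fdf Frem] : (forall n, differentiable (F n) x) /\ (forall n v, rn v <= r / 8 ->
    rn (F n (x + v) - F n x - 'd (F n) x v) <= C * rn v ^+ 2).
  by split => n; have [? H] := almost_linear_differentiable C0 r80 (Fal n).
have v10 : 0 < rn v + 1 by rewrite ltr_wpDl ?rn_ge0.
have e40 : 0 < e / 4 by rewrite divr_gt0.
have [m [m1 m2]] := @filter_ex _ \oo _ _ (filterI (half_pow_small (rn v) r80)
  (half_pow_small (C * rn v ^+ 2) e40)).
pose t : R := 2^-1 ^+ m; have t0 : 0 < t by rewrite exprn_gt0.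
have tv : rn (t%:C *: v) <= r / 8 by rewrite rnZ rnR gtr0_norm// mulrC ltW.
have te0 : 0 < t * (e / 4) by rewrite mulr_gt0.
have c1 : F n (x + t%:C *: v) @[n --> \oo] --> f (x + t%:C *: v).
  by apply: Fx; lra.
have /cvg_rn /(_ _ te0) H1 := c1; have /cvg_rn /(_ _ te0) H2 := Fx0.
near=> n.
have b1 : rn (F n (x + t%:C *: v) - f (x + t%:C *: v)) < t * (e / 4) by near: n; exact: H1.
have b2 : rn (F n x - f x) < t * (e / 4) by near: n; exact: H2.
have b3 := Frem n _ tv; have b4 := rem _ tv.
have b5 : C * rn (t%:C *: v) ^+ 2 < t * (e / 4).
  rewrite rnZ rnR gtr0_norm// exprMn mulrCA expr2 -mulrA ltr_pM2l//.
  by rewrite mulrC.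
rewrite -(ltr_pM2l t0) -{1}(gtr0_norm t0) -rnR -rnM mulrBr.
rewrite diffZE in b3; rewrite diffZE in b4.
have alg (a b c d p q : R[i]) :
  p - q = - (a - b - p) + (c - d - q) + (a - c) - (b - d) by ring.
rewrite (alg (F n (x + t%:C *: v)) (F n x) (f (x + t%:C *: v)) (f x)).
apply: le_lt_trans (rnB _ _) _.
apply: le_lt_trans (lerD (rnD _ _) (lexx _)) _.
apply: le_lt_trans (lerD (lerD (rnD _ _) (lexx _)) (lexx _)) _.
by rewrite rnN; exact: fin b3 b4 b1 b2 b5.
Unshelve. all: by end_near. Qed.

(** The difference inequalities hold for all [g t] with the same constants, and [I01] preserves them
    up to the factor [2]. *)
Lemma differentiable_I01 V (g : R -> V -> R[i]) (x : V) (M r : R) : 0 < r ->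
  (forall t y, 0 <= t <= 1 -> rn (y - x) < r -> differentiable (g t) y) ->
  (forall t y, 0 <= t <= 1 -> rn (y - x) < r -> rn (g t y) <= M) ->
  (forall y, rn (y - x) < r -> cont01 (fun t => g t y)) ->
  differentiable (fun y => I01 (fun t => g t y)) x.
Proof.
move=> r0 dg gM gc.
have M0 : 0 <= M.
  by apply: le_trans (rn_ge0 _) (gM 0 x _ _); rewrite ?subrr ?rn0 ?lexx ?ler01.
pose C := 8 * M / r + 256 * M / r ^+ 2.
have C0 : 0 <= C.
  by apply: addr_ge0; apply: divr_ge0; rewrite ?mulr_ge0 ?exprn_ge0 ?(ltW r0) ?ler0n.
have r80 : 0 < r / 8 by rewrite divr_gt0.
have gal t : 0 <= t <= 1 -> almost_linear (g t) x C (r / 8).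
  by move=> t01; apply: bounded_almost_linear => // y yr; [exact: dg|exact: gM].
suff fal : almost_linear (fun y => I01 (fun t => g t y)) x (2 * C) (r / 8).
  by have [] := almost_linear_differentiable (mulr_ge0 (ler0n _ 2) C0) r80 fal.
move=> v v' s vr v'r s1.
have cx w : rn w < r -> cont01 (fun t => g t (x + w)).
  by move=> wr; apply: gc; rewrite addrAC subrr add0r.
have c0 : cont01 (fun t => g t x) by apply: gc; rewrite subrr rn0.
have c1 : cont01 (fun t => g t (x + v)) by apply: cx; lra.
have c2 : cont01 (fun t => g t (x + v')) by apply: cx; lra.
have c3 : cont01 (fun t => g t (x + v + v')).
  by rewrite -addrA; apply: cx; have := rnD v v'; lra.
have c4 : cont01 (fun t => g t (x + s *: v)).
  apply: cx; rewrite rnZ; apply: le_lt_trans (_ : rn v < r); last by lra.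
  by rewrite ler_piMl ?rn_ge0.
have c10 := cont01B c1 c0; have c40 := cont01B c4 c0.
have c20 := cont01B c2 c0; have c31 := cont01B c3 c1.
rewrite -!I01B// -I01Z// -!(mulrA 2) -I01B//; last exact: cont01Z.
split; apply: I01_le => //; do ?[exact: cont01B|by apply: cont01B => //; exact: cont01Z].
- by move=> t t01; have [] := gal t t01 v v' s vr v'r s1.
- by move=> t t01; have [] := gal t t01 v v' s vr v'r s1.
- by move=> t t01; have [] := gal t t01 v v' s vr v'r s1.
Qed.

End QuantitativeHolomorphy.

(** * The exponential and the universal cover *)

Section ComplexExponential.
Context {R : realType}.
Implicit Types (z w : R[i]).

Lemma cexpD z w : cexp (z + w) = cexp z * cexp w.
Proof.
case: z => a b; case: w => c d; rewrite /cexp/= expRD cosD sinD.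
by apply/eqP; rewrite eq_complex/=; apply/andP; split; apply/eqP; ring.
Qed.

Lemma cexp0 : cexp 0 = 1 :> R[i].
Proof. by rewrite /cexp/= expR0 cos0 sin0 mulr1 mulr0. Qed.

Lemma rn_cexp z : rn (cexp z) = expR (complex.Re z).
Proof.
rewrite /rn normc_def/= !exprMn -mulrDr cos2Dsin2 mulr1 sqrtr_sqr.
by rewrite ger0_norm// expR_ge0.
Qed.

Lemma cexp_neq0 z : cexp z != 0.
Proof. by rewrite -rn_eq0 rn_cexp gt_eqF// expR_gt0. Qed.

Lemma cexpN z : cexp (- z) = (cexp z)^-1.
Proof.
apply: (mulfI (cexp_neq0 z)); rewrite -cexpD subrr cexp0 mulfV//.
exact: cexp_neq0.
Qed.

Lemma is_derive_real_comp (f g : R -> R) (x df dg : R) :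
  is_derive (g x) (1 : R) f df -> is_derive x (1 : R) g dg ->
  is_derive x (1 : R) (fun t => f (g t)) (df * dg).
Proof. by move=> hf hg; exact: is_derive1_comp hf hg. Qed.

Lemma cexp_rder z (t : R) : rder (fun t => cexp (t%:C * z)) t (z * cexp (t%:C * z)).
Proof.
case: z => a b.
have dl (c : R) : is_derive t (1 : R) (fun x => x * c) c.
  have := is_deriveM (is_derive_id t (1 : R)) (is_derive_cst c t (1 : R)).
  by move=> H; apply: is_derive_eq H _; rewrite /GRing.scale/= mulr0 add0r mulr1.
have de := is_derive_real_comp (g := fun x => x * a) (is_derive_expR (t * a)) (dl a).
have dc := is_derive_real_comp (g := fun x => x * b) (is_derive_cos (t * b)) (dl b).
have ds := is_derive_real_comp (g := fun x => x * b) (is_derive_sin (t * b)) (dl b).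
apply: rderP.
  have := is_deriveM de dc; rewrite (_ : (fun x => complex.Re _) =
      (fun t0 => expR (t0 * a)) * (fun t0 => cos (t0 * b))); last first.
    by apply/funext => x; rewrite /cexp/= !mul0r subr0 addr0.
  move=> H; apply: is_derive_eq H _; rewrite !ReImE /cexp /GRing.scale/= !mul0r subr0 addr0.
  by ring.
have := is_deriveM de ds; rewrite (_ : (fun x => complex.Im _) =
    (fun t0 => expR (t0 * a)) * (fun t0 => sin (t0 * b))); last first.
  by apply/funext => x; rewrite /cexp/= !mul0r subr0 addr0.
move=> H; apply: is_derive_eq H _; rewrite !ReImE /cexp /GRing.scale/= !mul0r subr0 addr0.
by ring.
Qed.

Lemma rder_id (t : R) : rder (fun t => t%:C) t 1.
Proof.
move=> e e0; exists 1 => // h _.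
by rewrite rcD mulr1 [t%:C + _]addrC addrK subrr rn0 mulr_ge0// ltW.
Qed.

Definition exp_sum z n : R[i] := \sum_(0 <= k < n) (k`!%:R)^-1 * z ^+ k.

Lemma natr_neq0 n : (n.+1%:R : R[i]) != 0.
Proof. by rewrite pnatr_eq0. Qed.

Lemma fact_neq0 n : (n`!%:R : R[i]) != 0.
Proof. by rewrite pnatr_eq0 -lt0n fact_gt0. Qed.

Lemma exp_sum_rder z n (t : R) :
  rder (fun t => exp_sum (t%:C * z) n.+1) t (z * exp_sum (t%:C * z) n).
Proof.
have dX k : rder (fun t => (t%:C * z) ^+ k.+1) t (k.+1%:R * z * (t%:C * z) ^+ k).
  have d1 : rder (fun t => t%:C * z) t z.
    by have := rderM (rder_id t) (rder_cst z t); rewrite mul1r mulr0 addr0.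
  elim: k => [|k IH]; first by rewrite expr0 mulr1 mul1r.
  have := rderM d1 IH; congr rder.
  by rewrite (exprS _ k) -[k.+2]addn1 natrD; ring.
elim: n => [|n IH].
  have := rder_cst (1 : R[i]) t; congr rder; last by rewrite /exp_sum big_nil mulr0.
  by apply/funext => x; rewrite /exp_sum big_nat1 expr0 fact0 invr1 mulr1.
have := rder_lin (n.+1`!%:R^-1) IH (dX n); congr rder.
  by apply/funext => x; rewrite [in RHS]/exp_sum big_nat_recr.
rewrite [in RHS]/exp_sum big_nat_recr//= mulrDr -/(exp_sum _ n); congr (_ + _).
have alg (p q y : R[i]) : p != 0 -> q != 0 -> (p * q)^-1 * (p * z * y) = z * (q^-1 * y).
  by move=> p0 q0; field; rewrite p0 q0.
by rewrite factS natrM alg// ?fact_neq0 ?natr_neq0.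
Qed.

Lemma rn_nat n : rn (n%:R : R[i]) = n%:R.
Proof. by rewrite -(rmorph_nat (real_complex R)) rnR ger0_norm. Qed.

(** In the derivative of [t |-> e^(- t z) S(t z)], with [S] the partial sum, only the last term of
    [S] is left; integrating from [0] to [1] compares the product with [1]. This ties [cexp],
    defined by real functions, to the series in [mexp], and its case [n = 1] gives the complex
    derivative of [cexp]. *)
Lemma exp_sum_bound z n : rn (cexp z - exp_sum z n.+1) <=
  2 * expR (2 * rn z) * rn z ^+ n.+1 / n`!%:R.
Proof.
pose E := expR (rn z).
have cE (t : R) : 0 <= t <= 1 -> rn (cexp (t%:C * - z)) <= E.
  move=> /andP[t0 t1]; rewrite rn_cexp ler_expR (le_trans (ler_norm _))//.
  rewrite (le_trans (rnRe _))// rnM rnN rnR ger0_norm//.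
  by rewrite ler_piMl// rn_ge0.
have H (t : R) : rder (fun t => cexp (t%:C * - z) * exp_sum (t%:C * z) n.+1) t
    (- z * cexp (t%:C * - z) * ((n`!%:R)^-1 * (t%:C * z) ^+ n)).
  have := rderM (cexp_rder (- z) t) (exp_sum_rder z n t); congr rder.
  rewrite {1}/exp_sum big_nat_recr//= -/(exp_sum _ n); ring.
have := rder_mvi_cst (M := E * rn z ^+ n.+1 / n`!%:R) ler01 (fun t _ => H t).
rewrite subr0 mulr1 !mul1r !mul0r cexp0 mul1r.
have -> : exp_sum 0 n.+1 = 1 :> R[i].
  rewrite /exp_sum big_nat_recl//= big1 ?addr0 => [|i _].
    by rewrite expr0 fact0 invr1 mulr1.
  by rewrite exprS mul0r mulr0.
move=> /(_ _)/wrap[|H2].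
  move=> t /[dup] t01 /andP[t0 t1]; rewrite !rnM rnN rnV rn_nat rnX rnM rnR (ger0_norm t0).
  rewrite (_ : _ / _ = (rn z * E) * (n`!%:R^-1 * (1 * rn z) ^+ n)); last by rewrite exprS mul1r; ring.
  rewrite ler_pM ?mulr_ge0 ?invr_ge0 ?exprn_ge0 ?mulr_ge0 ?rn_ge0//.
    by rewrite ler_wpM2l ?rn_ge0 ?cE.
  rewrite ler_wpM2l ?invr_ge0// lerXn2r ?nnegrE ?mulr_ge0 ?rn_ge0//.
  by rewrite ler_wpM2r ?rn_ge0.
have -> : cexp z - exp_sum z n.+1 = - cexp z * (cexp (- z) * exp_sum z n.+1 - 1).
  by rewrite cexpN; field; exact: cexp_neq0.
rewrite rnM rnN (_ : 2 * expR _ * _ / _ = E * (2 * (E * rn z ^+ n.+1 / n`!%:R))); last first.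
  by rewrite (mulrC 2 (rn z)) mulr_natr mulr2n expRD -/E; ring.
rewrite ler_pM ?rn_ge0//.
by rewrite rn_cexp ler_expR (le_trans (ler_norm _))// rnRe.
Qed.

Lemma cexp_cder z : cder cexp z (cexp z).
Proof.
move=> e e0.
pose K := expR (complex.Re z) * (2 * expR 2).
have K0 : 0 < K by rewrite !mulr_gt0// expR_gt0.
exists (Num.min 1 (e / K)); first by rewrite lt_min ltr01 divr_gt0.
move=> w; rewrite lt_min ltr_pdivlMr// => /andP[w1 we].
set h := w - z in w1 we *.
have -> : cexp w - cexp z - cexp z * h = cexp z * (cexp h - exp_sum h 2).
  rewrite /exp_sum big_nat_recr//= big_nat1 expr0 expr1 fact0 factS fact0 muln1 invr1 !mul1r.
  by rewrite -{1}(subrK z w) -/h cexpD; ring.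
rewrite rnM rn_cexp.
have := exp_sum_bound h 1; rewrite factS fact0 muln1 divr1 => H.
rewrite (le_trans (ler_wpM2l (expR_ge0 _) H))//.
apply: (@le_trans _ _ (K * rn h ^+ 2)).
  rewrite mulrA ler_wpM2r ?exprn_ge0 ?rn_ge0// ler_wpM2l ?expR_ge0// ler_wpM2l//.
  by rewrite ler_expR; lra.
by rewrite expr2 mulrA ler_wpM2r ?rn_ge0// mulrC ltW.
Qed.

Lemma differentiable_cexp z : differentiable cexp z.
Proof. by have [] := cder_differentiable (cexp_cder z). Qed.

Lemma is_derive_cexp z : is_derive z 1 (cexp : R[i] -> R[i]) (cexp z).
Proof. by have [] := cder_differentiable (cexp_cder z). Qed.

Lemma is_derive_ccomp (f g : R[i] -> R[i]) (z df dg : R[i]) :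
  is_derive (g z) 1 f df -> is_derive z 1 g dg ->
  is_derive z 1 (fun z => f (g z)) (df * dg).
Proof.
move=> /derivable_cder hf /derivable_cder hg.
suff /cder_differentiable[] : cder (fun z => f (g z)) z (df * dg) by [].
move=> e e0.
have a0 : 0 < 2 * (rn df + 1) by rewrite mulr_gt0// ltr_wpDl ?rn_ge0.
have b0 : 0 < 2 * (rn dg + 1) by rewrite mulr_gt0// ltr_wpDl ?rn_ge0.
have e10 : 0 < Num.min 1 (e / (2 * (rn df + 1))) by rewrite lt_min ltr01 divr_gt0.
have e20 : 0 < e / (2 * (rn dg + 1)) by rewrite divr_gt0.
have [d1 d10 H1] := hg _ e10; have [d2 d20 H2] := hf _ e20.
have b1 : 0 < rn dg + 1 by rewrite ltr_wpDl ?rn_ge0.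
exists (Num.min d1 (d2 / (rn dg + 1))); first by rewrite lt_min d10 divr_gt0.
move=> w; rewrite lt_min ltr_pdivlMr// => /andP[/H1 {}H1 wd].
set h := w - z in H1 wd *; set k := g w - g z in H1.
have h0 := rn_ge0 h.
have [m1 m2] : Num.min 1 (e / (2 * (rn df + 1))) <= 1 /\
    Num.min 1 (e / (2 * (rn df + 1))) <= e / (2 * (rn df + 1)).
  by rewrite !ge_min !lexx orbT.
have kle : rn k <= (rn dg + 1) * rn h.
  rewrite -[k](subrK (dg * h)) (le_trans (rnD _ _))// rnM mulrDl mul1r addrC lerD2l.
  by rewrite (le_trans H1)// ler_piMl.
have kd : rn (g w - g z) < d2 by apply: le_lt_trans kle _; rewrite mulrC.
have := H2 _ kd; rewrite -/k => {}H2.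
have -> : f (g w) - f (g z) - df * dg * h = (f (g w) - f (g z) - df * k) + df * (k - dg * h) by ring.
apply: le_trans (rnD _ _) _; rewrite rnM.
have t1 : e / (2 * (rn dg + 1)) * rn k <= e / 2 * rn h.
  apply: le_trans (ler_wpM2l (ltW e20) kle) _.
  by rewrite le_eqVlt; apply/predU1P; left; field; rewrite gt_eqF.
have t2 : rn df * rn (k - dg * h) <= e / 2 * rn h.
  apply: le_trans (ler_wpM2l (rn_ge0 _) H1) _.
  rewrite mulrA ler_wpM2r//; apply: le_trans (ler_wpM2l (rn_ge0 df) m2) _.
  by rewrite mulrCA ler_wpM2l ?(ltW e0)// ler_pdivrMr// mulrA mulVf// mul1r lerDl.
by rewrite [X in _ <= X * _](splitr e) mulrDl; exact: lerD (le_trans H2 t1) t2.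
Qed.

Lemma upowE w (s : R) : upow w s = cexp (s%:C * w).
Proof.
case: w => a b; rewrite /upow /umod /uarg /cexp/= expR0 !mul1r !mul0r subr0 addr0.
rewrite /powR gt_eqF ?expR_gt0// expRK.
by apply/eqP; rewrite eq_complex/= !mul0r subr0 addr0 !eqxx.
Qed.

Lemma is_derive_upow w (s : R) :
  is_derive w 1 (fun w => upow w s : R[i]) (s%:C * upow w s).
Proof.
rewrite (_ : (fun w => _) = (fun w : R[i] => cexp (s%:C * w))); last first.
  by apply/funext => u; rewrite upowE.
rewrite upowE mulrC; apply: is_derive_ccomp; first exact: is_derive_cexp.
have := @is_deriveZ _ _ _ id s%:C w 1 1 (is_derive_id _ _).
by rewrite /GRing.scale/= mulr1.
Qed.

Lemma differentiable_ccomp (V : normedModType R[i]) (f : R[i] -> R[i]) (g : V -> R[i]) (x : V) :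
  differentiable f (g x) -> differentiable g x -> differentiable (fun x => f (g x)) x.
Proof. by move=> hf hg; exact: (@differentiable_comp _ _ _ _ g f x hg hf). Qed.

Lemma differentiable_cexp_comp (V : normedModType R[i]) (g : V -> R[i]) (x : V) :
  differentiable g x -> differentiable (fun x => cexp (g x)) x.
Proof. by move=> hg; apply: differentiable_ccomp hg; exact: differentiable_cexp. Qed.

(* The inverse chart of the covering map on the half-plane [Re x > 0], rotated by [phi]. *)
Definition lchart (phi : R) (x : R[i]) : R[i] := ell phi (complex.Re x) (complex.Im x).

Lemma uarg_lchart phi (x : R[i]) : uarg (lchart phi x) = phi + atan (complex.Im x / complex.Re x).
Proof. by []. Qed.

Lemma norm_sqr (x : R[i]) : rn x = Num.sqrt (complex.Re x ^+ 2 + complex.Im x ^+ 2).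
Proof. by rewrite /rn normc_def. Qed.

Lemma umod_lchart phi (x : R[i]) : 0 < complex.Re x -> umod (lchart phi x) = rn x.
Proof.
move=> x0; rewrite /umod /lchart /ell/= lnK -?norm_sqr// posrE.
by apply: lt_le_trans (rnRe x); rewrite normr_gt0 gt_eqF.
Qed.

Lemma cexp_lchart phi (x : R[i]) : 0 < complex.Re x ->
  cexp (lchart phi x) = cexp (0 +i* phi) * x.
Proof.
move=> x0; have rx0 : 0 < rn x by apply: lt_le_trans (rnRe x); rewrite normr_gt0 gt_eqF.
have -> : lchart phi x = (0 +i* phi) + (ln (rn x) +i* atan (complex.Im x / complex.Re x)).
  by apply/eqP; rewrite eq_complex/= add0r norm_sqr !eqxx.
rewrite cexpD; congr (_ * _); rewrite /cexp/= lnK ?posrE//.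
have c0 : 0 < cos (atan (complex.Im x / complex.Re x)).
  by apply: cos_gt0_pihalf; rewrite atan_gtNpi2 atan_ltpi2.
have := cos2Dsin2 (atan (complex.Im x / complex.Re x)).
have : sin (atan (complex.Im x / complex.Re x)) * complex.Re x =
       cos (atan (complex.Im x / complex.Re x)) * complex.Im x.
  have := atanK (complex.Im x / complex.Re x); rewrite /tan.
  set c := cos _ in c0 *; set s := sin _ => e.
  rewrite -(divfK (lt0r_neq0 c0) s) e; move: (lt0r_neq0 x0) (lt0r_neq0 c0).
  by move=> ? ?; field.
move: c0; set c := cos _; set s := sin _ => c0 es cs.
have r2 : rn x ^+ 2 = complex.Re x ^+ 2 + complex.Im x ^+ 2.
  by rewrite norm_sqr sqr_sqrtr// addr_ge0// sqr_ge0.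
have cr : rn x * c = complex.Re x.
  apply/eqP; rewrite -(@eqrXn2 _ 2) ?mulr_ge0 ?(ltW c0) ?(ltW rx0) ?(ltW x0)//.
  rewrite exprMn r2 -(mulr1 (complex.Re x ^+ 2)) -cs; apply/eqP.
  have : (s * complex.Re x) ^+ 2 = (c * complex.Im x) ^+ 2 by rewrite es.
  by rewrite !exprMn; nra.
have sr : rn x * s = complex.Im x.
  apply: (mulfI (lt0r_neq0 c0)); rewrite -es -cr; ring.
by rewrite cr sr; case: (x).
Qed.

Lemma real_continuous_eps (g : R -> R) (u : R) (e : R) : {for u, continuous g} -> 0 < e ->
  exists2 d : R, 0 < d & forall v, `|v - u| < d -> `|g v - g u| < e.
Proof.
move=> /cvgrPdist_lt cg /cg/nbhs_normP[d/= d0 H]; exists d => // v vu.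
by rewrite distrC; apply: H; rewrite /= distrC.
Qed.

Lemma lchart_continuous phi (x : R[i]) (e : R) : 0 < complex.Re x -> 0 < e ->
  exists2 d : R, 0 < d & forall y, rn (y - x) < d ->
    rn (lchart phi y - lchart phi x) < e.
Proof.
move=> x0 e0; have e20 : 0 < e / 2 by rewrite divr_gt0.
have rx0 : 0 < rn x by apply: lt_le_trans (rnRe x); rewrite normr_gt0 gt_eqF.
have [d1 d10 H1] := real_continuous_eps (continuous_ln rx0) e20.
have [d2 d20 H2] := real_continuous_eps (@continuous_atan _ (complex.Im x / complex.Re x)) e20.
pose d3 := d2 * complex.Re x ^+ 2 / (4 * rn x).
have d30 : 0 < d3 by rewrite !divr_gt0 ?mulr_gt0// exprn_gt0.
exists (Num.min d1 (Num.min d3 (complex.Re x / 2))).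
  by rewrite !lt_min d10 d30 divr_gt0.
move=> y; rewrite !lt_min => /andP[yd1 /andP[yd3 yd4]].
have y0 : complex.Re x / 2 < complex.Re y.
  have := le_lt_trans (rnRe _) yd4; rewrite !ReImE ltr_norml => /andP[+ _]; lra.
rewrite (le_lt_trans (rn_ReIm _))// (splitr e) ltrD//.
  rewrite !ReImE /= -!norm_sqr; apply: H1; apply: le_lt_trans yd1.
  rewrite ler_norml lerBrDl lerBlDr.
  have := rnD (y - x) x; have := rnD (x - y) y; rewrite !subrK (rnC x y); lra.
rewrite !ReImE /= opprD addrACA subrr add0r; apply: H2.
have -> : complex.Im y / complex.Re y - complex.Im x / complex.Re x =
    (complex.Im (y - x) * complex.Re x - complex.Im x * complex.Re (y - x)) /
    (complex.Re y * complex.Re x).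
  by rewrite !ReImE; field; rewrite !gt_eqF//; lra.
have yx0 : 0 < complex.Re y * complex.Re x by rewrite mulr_gt0//; lra.
rewrite normrM normfV (gtr0_norm yx0) ltr_pdivrMr//.
apply: (@le_lt_trans _ _ (2 * rn x * rn (y - x))).
  apply: le_trans (ler_normB _ _) _; rewrite !normrM.
  have a1 := rnIm (y - x); have a2 := rnRe (y - x); have a3 := rnIm x; have a4 := rnRe x.
  have := ler_pM (normr_ge0 _) (normr_ge0 _) a1 a4.
  have := ler_pM (normr_ge0 _) (normr_ge0 _) a3 a2; lra.
move: yd3; rewrite /d3 ltr_pdivlMr ?mulr_gt0// => h.
have : d2 * (complex.Re x / 2 * complex.Re x) <= d2 * (complex.Re y * complex.Re x).
  by rewrite ler_pM2l// ler_pM2r// ltW.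
rewrite expr2 in h; lra.
Qed.

(** Derivative of an inverse function: [cexp (lchart phi x)] is a constant times [x], [lchart] is
    continuous, and the derivative [E] of [cexp] does not vanish. The estimate [wle] shows that the
    increment of [lchart] is at most of the order of that of [x]. *)
Lemma lchart_cder phi (x : R[i]) : 0 < complex.Re x -> cder (lchart phi) x x^-1.
Proof.
move=> x0 e e0.
have xn0 : x != 0 by apply: contraTneq x0 => ->; rewrite ltxx.
set c := cexp (0 +i* phi); have c0 : c != 0 := cexp_neq0 _.
set E := cexp (lchart phi x); have EE : E = c * x := cexp_lchart phi x0.
have E0 : 0 < rn E by rewrite rn_cexp expR_gt0.
have rc0 : 0 < rn c by rewrite rn_cexp expR_gt0.
pose e' := Num.min (rn E / 2) (e * (rn E) ^+ 2 / (2 * rn c)).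
have e'0 : 0 < e' by rewrite lt_min !divr_gt0 ?mulr_gt0// exprn_gt0.
have [d d0 Hd] := cexp_cder (lchart phi x) e'0.
have [d2 d20 Hd2] := lchart_continuous phi x0 d0.
exists (Num.min d2 (complex.Re x)); first by rewrite lt_min d20.
move=> y; rewrite lt_min => /andP[yx yx'].
have y0 : 0 < complex.Re y.
  have := le_lt_trans (rnRe _) yx'; rewrite !ReImE ltr_norml => /andP[+ _]; lra.
have := Hd _ (Hd2 _ yx); rewrite (cexp_lchart phi y0) -/c -/E.
set w := lchart phi y - lchart phi x; rewrite EE -EE -/E => H.
have eq1 : w - x^-1 * (y - x) = - E^-1 * (c * y - E - E * w).
  by rewrite EE; field; rewrite xn0 c0.
have e'1 : e' <= rn E / 2 by rewrite ge_min lexx.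
have e'2 : e' <= e * (rn E) ^+ 2 / (2 * rn c) by rewrite ge_min lexx orbT.
have wle : rn w <= 2 * rn c * rn (y - x) / rn E.
  rewrite ler_pdivlMr//.
  have : rn (E * w) <= rn (c * y - E - E * w) + rn (c * y - E).
    have -> : E * w = (c * y - E) - (c * y - E - E * w) by ring.
    rewrite (le_trans (rnB _ _))// addrC.
    by have -> : c * y - E - (c * y - E - (c * y - E - E * w)) = c * y - E - E * w by ring.
  have -> : c * y - E = c * (y - x) by rewrite EE; ring.
  rewrite !rnM => h1; have h2 := rn_ge0 w; have := le_trans H (ler_wpM2r h2 e'1).
  have eq2 : c * (y - x) - E * w = c * y - E - E * w by rewrite EE; ring.
  rewrite eq2 in h1; move: h1.
  lra.
rewrite eq1 rnM rnN rnV mulrC ler_pdivrMr//.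
apply: le_trans H _; apply: le_trans (ler_wpM2l (ltW e'0) wle) _.
have K0 : 0 <= 2 * rn c * rn (y - x) / rn E by rewrite divr_ge0 ?mulr_ge0 ?rn_ge0// ltW.
apply: le_trans (ler_wpM2r K0 e'2) _.
by rewrite le_eqVlt; apply/predU1P; left; field; rewrite !gt_eqF.
Qed.

Lemma differentiable_lchart phi (x : R[i]) : 0 < complex.Re x -> differentiable (lchart phi) x.
Proof. by move=> /(lchart_cder phi)/cder_differentiable[]. Qed.

End ComplexExponential.

(** * Matrices entry by entry *)

Section MatrixNorm.
Context {R : realType} {m n : nat}.
Implicit Types A B : 'M[R[i]]_(m, n).

Lemma rn_mx_lt A (e : R) : 0 < e -> (rn A < e <-> forall i j, rn (A i j) < e).
Proof.
move=> e0; have := @mx_norm_ball R[i] m n; move/(congr1 (fun f => f 0 e%:C A)).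
rewrite /ball/= /mx_ball sub0r normrN => E; split.
  rewrite -ltcR -rnE => Ae i j.
  have [_ /(_ i j)] : 0 < e%:C /\ (forall i j, ball ((0 : 'M[R[i]]_(m, n)) i j) e%:C (A i j)) by rewrite E.
  by rewrite -ball_normE/= mxE sub0r normrN rnE ltcR.
move=> H; rewrite -ltcR -rnE -E; split; first by rewrite ltcR.
by move=> i j; rewrite -ball_normE/= mxE sub0r normrN rnE ltcR.
Qed.

Lemma rn_entry_le A i j : rn (A i j) <= rn A.
Proof.
apply/ler_addgt0Pr => e e0; apply: ltW.
by apply: (rn_mx_lt A _).1; [rewrite ltr_wpDl ?rn_ge0|rewrite ltrDl].
Qed.

Lemma rn_mx_le A (e : R) : 0 <= e -> (forall i j, rn (A i j) <= e) -> rn A <= e.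
Proof.
move=> e0 H; apply/ler_addgt0Pr => d d0; apply: ltW.
apply: (rn_mx_lt A _).2 => [|i j]; first by rewrite ltr_wpDl.
by apply: le_lt_trans (H i j) _; rewrite ltrDl.
Qed.

Lemma cvg_mx_entries {T} {F : set_system T} {FF : Filter F} (f : T -> 'M[R[i]]_(m, n)) A :
  f @ F --> A <-> forall i j, f t i j @[t --> F] --> A i j.
Proof.
split=> [/cvg_rn H i j|H].
  apply/cvg_rn => e /H; apply: filterS => t; apply: le_lt_trans.
  by have := rn_entry_le (f t - A) i j; rewrite !mxE.
apply/cvg_rn => e e0.
have Hij i : \forall t \near F, forall j, rn (f t i j - A i j) < e.
  apply: filter_forall => j; have /cvg_rn := H i j; exact.
have := filter_forall FF Hij; apply: filterS => t Ht.
by apply/rn_mx_lt => // i j; rewrite !mxE.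
Qed.

Lemma differentiable_entries (V : normedModType R[i]) (f : V -> 'M[R[i]]_(m, n)) x :
  differentiable f x <-> forall i j, differentiable (fun y => f y i j) x.
Proof.
split=> [df i j|H].
  exact: (@differentiable_comp _ _ _ _ f (fun M : 'M[R[i]]_(m, n) => M i j) x df
      (differentiable_coord _ _ _)).
have Hs i j : differentiable (fun y => f y i j *: (delta_mx i j : 'M[R[i]]_(m, n))) x.
  exact: differentiableZl.
rewrite (_ : f = (fun y => \sum_(i < m) \sum_(j < n) f y i j *: delta_mx i j)); last first.
  by apply/funext => y; exact: matrix_sum_delta.
have -> : (fun y => \sum_(i < m) \sum_(j < n) f y i j *: delta_mx i j) =
    \sum_(i < m) \sum_(j < n) (fun y => f y i j *: (delta_mx i j : 'M[R[i]]_(m, n))).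
  by apply/funext => y; rewrite fct_sumE; apply: eq_bigr => i _; rewrite fct_sumE.
apply: differentiable_sum => i; apply: differentiable_sum => j; exact: Hs.
Qed.

End MatrixNorm.

(** * Derivatives with respect to z and exponentials of diagonal matrices *)

Section IsDz.
Context {R : realType} {n : nat}.
Implicit Types (f : R[i] -> 'M[R[i]]_n) (w : R[i]).

Lemma nbhs_complex w (P : set R[i]) :
  nbhs w P <-> exists2 d : R, 0 < d & forall y, rn (y - w) < d -> P y.
Proof. exact: (@nbhs_rn R R[i] w P). Qed.

Lemma cvg_dnbhs_complex (g : R[i] -> R[i]) w (l : R[i]) : g u @[u --> w^'] --> l <->
  forall e : R, 0 < e -> exists2 d : R, 0 < d &
    forall u, u != w -> rn (u - w) < d -> rn (g u - l) < e.
Proof.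
split.
  move=> /cvg_rn H e /H; rewrite near_withinE => /nbhs_complex[d d0 Hd].
  by exists d => // u uw /Hd; exact.
move=> H; apply/cvg_rn => e /H[d d0 Hd]; rewrite near_withinE; apply/nbhs_complex.
by exists d => // u ud uw; exact: Hd.
Qed.

(** With [z = e^w] one has [d/dw = e^w d/dz]. By [small] the increment of [cexp] near [w] is
    comparable to that of its argument and does not vanish, so either difference quotient can be
    turned into the other. *)
Lemma is_dzP f w df : is_dz f w df <->
  forall i j, is_derive w 1 (fun u => f u i j) (cexp w * df i j).
Proof.
have E0 := cexp_neq0 w; set E := cexp w in E0 *.
have rE0 : 0 < rn E by rewrite lt_neqAle eq_sym rn_eq0 E0 rn_ge0.
have small (e : R) : 0 < e -> exists2 d : R, 0 < d & forall u, u != w -> rn (u - w) < d ->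
    cexp u - E != 0 /\ rn (cexp u - E - E * (u - w)) <= e * rn (u - w).
  move=> e0; have e'0 : 0 < Num.min e (rn E / 2) by rewrite lt_min e0 divr_gt0.
  have [d d0 H] := cexp_cder w e'0; exists d => // u uw /H; rewrite -/E => {}H.
  have r0 : 0 < rn (u - w) by rewrite lt_neqAle eq_sym rn_eq0 subr_eq0 uw rn_ge0.
  split; last by apply: le_trans H _; rewrite ler_wpM2r ?(ltW r0)// ge_min lexx.
  apply/negP => /eqP ue; move: H; rewrite ue sub0r rnN rnM; apply/negP; rewrite -ltNge.
  rewrite ltr_pM2r// (@le_lt_trans _ _ (rn E / 2))//; first by rewrite ge_min lexx orbT.
  by rewrite ltr_pdivrMr// ltr_pMr// ltr1n.
rewrite /is_dz cvg_mx_entries; split => H i j.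
  suff /cder_differentiable[] : cder (fun u => f u i j) w (E * df i j) by [].
  have /cvg_dnbhs_complex {}H := H i j.
  move=> e e0; set l := df i j in H *.
  have e10 : 0 < Num.min 1 (e / (2 * (2 * rn E))) by rewrite lt_min ltr01 !divr_gt0 ?mulr_gt0.
  have e20 : 0 < Num.min (rn E) (e / (2 * (rn l + 1))).
    by rewrite lt_min rE0 divr_gt0// mulr_gt0// ltr_wpDl ?rn_ge0.
  have [d1 d10 H1] := H _ e10; have [d2 d20 H2] := small _ e20.
  exists (Num.min d1 d2); first by rewrite lt_min d10.
  move=> u; rewrite lt_min => /andP[ud1 ud2].
  have [->|uw] := eqVneq u w; first by rewrite !subrr mulr0 subrr rn0 mulr0.
  have {}H1 := H1 u uw ud1; have [ne {}H2] := H2 u uw ud2.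
  move: H1; rewrite !mxE => H1.
  set h := u - w in H2 ud1 ud2 *; set D := cexp u - E in H1 H2 ne.
  set Df := f u i j - f w i j in H1 *.
  have -> : Df - E * l * h = D * (D^-1 * Df - l) + l * (D - E * h) by field.
  have D2 : rn D <= 2 * rn E * rn h.
    rewrite -[D](subrK (E * h)) (le_trans (rnD _ _))// rnM.
    have := le_trans H2 (ler_wpM2r (rn_ge0 h) (_ : _ <= rn E)); rewrite ge_min lexx => /(_ isT).
    lra.
  have t1 : rn (D * (D^-1 * Df - l)) <= e / 2 * rn h.
    rewrite rnM.
    have := ler_pM (rn_ge0 _) (rn_ge0 _) D2 (le_trans (ltW H1) (_ : _ <= e / (2 * (2 * rn E)))).
    rewrite ge_min lexx orbT => /(_ isT)/le_trans; apply.
    by rewrite le_eqVlt; apply/predU1P; left; field; rewrite gt_eqF.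
  have l0 : 0 < 2 * (rn l + 1) by rewrite mulr_gt0// ltr_wpDl ?rn_ge0.
  have t2 : rn (l * (D - E * h)) <= e / 2 * rn h.
    rewrite rnM; apply: le_trans (ler_wpM2l (rn_ge0 l) H2) _.
    rewrite mulrA ler_wpM2r ?rn_ge0//.
    apply: (@le_trans _ _ (rn l * (e / (2 * (rn l + 1))))).
      by rewrite ler_wpM2l ?rn_ge0// ge_min lexx orbT.
    rewrite mulrCA ler_wpM2l ?(ltW e0)// ler_pdivrMr// mulrA mulVf// mul1r lerDl//.
  apply: le_trans (rnD _ _) _; apply: le_trans (lerD t1 t2) _.
  by rewrite -mulrDl -splitr.
have /derivable_cder {}H := H i j.
apply/cvg_dnbhs_complex => e e0; set l := df i j in H *.
have e10 : 0 < e * rn E / 8 by rewrite !divr_gt0 ?mulr_gt0.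
have e20 : 0 < Num.min (rn E / 2) (e * rn E / (8 * (rn l + 1))).
  by rewrite lt_min !divr_gt0 ?mulr_gt0// ltr_wpDl ?rn_ge0.
have [d1 d10 H1] := H _ e10; have [d2 d20 H2] := small _ e20.
exists (Num.min d1 d2); first by rewrite lt_min d10.
move=> u uw; rewrite lt_min => /andP[ud1 ud2].
have {}H1 := H1 u ud1; have [ne {}H2] := H2 u uw ud2.
rewrite !mxE.
have r0 : 0 < rn (u - w) by rewrite lt_neqAle eq_sym rn_eq0 subr_eq0 uw rn_ge0.
set h := u - w in H1 H2 ud1 ud2 r0 *; set D := cexp u - E in H1 H2 ne *.
set Df := f u i j - f w i j in H1 *.
have -> : D^-1 *: Df - l = D^-1 * ((Df - E * l * h) - l * (D - E * h)).
  have alg (D' Df' E' l' h' : R[i]) : D' != 0 ->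
      D'^-1 * Df' - l' = D'^-1 * (Df' - E' * l' * h' - l' * (D' - E' * h')).
    by move=> D0; field.
  exact: alg.
have D2 : rn E / 2 * rn h <= rn D.
  have : rn (E * h) <= rn D + rn (D - E * h).
    by rewrite {1}(_ : E * h = D - (D - E * h)) ?rnB//; ring.
  rewrite rnM.
  have := le_trans H2 (ler_wpM2r (rn_ge0 h) (_ : _ <= rn E / 2)); rewrite ge_min lexx => /(_ isT).
  lra.
have D0 : 0 < rn D by apply: lt_le_trans D2; rewrite mulr_gt0 ?divr_gt0.
rewrite rnM rnV ltr_pdivrMl//.
apply: (@lt_le_trans _ _ (rn E / 2 * rn h * e)); last by rewrite ler_wpM2r// ltW.
apply: le_lt_trans (rnB _ _) _; rewrite rnM.
have l0 : 0 < rn l + 1 by rewrite ltr_wpDl ?rn_ge0.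
have t2 : rn l * rn (D - E * h) <= e * rn E / 8 * rn h.
  apply: le_trans (ler_wpM2l (rn_ge0 l) H2) _.
  rewrite mulrA ler_wpM2r ?rn_ge0//.
  apply: (@le_trans _ _ (rn l * (e * rn E / (8 * (rn l + 1))))).
    by rewrite ler_wpM2l ?rn_ge0// ge_min lexx orbT.
  rewrite (_ : rn l * _ = rn l / (rn l + 1) * (e * rn E / 8)); last by field; rewrite gt_eqF.
  by rewrite ler_piMl ?(ltW e10)// ler_pdivrMr// mul1r lerDl.
apply: le_lt_trans (lerD H1 t2) _.
have : 0 < e * rn E * rn h by rewrite !mulr_gt0.
lra.
Qed.

Lemma mexp_diag (d : 'rV[R[i]]_n) : mexp (diag_mx d) = diag_mx (map_mx cexp d).
Proof.
rewrite /mexp; apply: cvg_lim; first exact: norm_hausdorff.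
apply/cvg_mx_entries => i j.
have powE k : diag_mx d ^+ k = diag_mx (\row_j (d 0 j) ^+ k).
  elim: k => [|k IH].
    by rewrite expr0; apply/matrixP => a b; rewrite !mxE.
  rewrite exprS IH -[_ * _]/(_ *m _).
  by apply/matrixP => a b; rewrite mul_diag_mx !mxE mulrnAr exprS.
have sumE N : (\sum_(0 <= k < N) (k`!%:R : R[i])^-1 *: diag_mx d ^+ k) i j =
    exp_sum (d 0 i) N *+ (i == j).
  elim: N => [|N IH]; first by rewrite /exp_sum !big_nil mxE mul0rn.
  by rewrite big_nat_recr//= mxE IH /exp_sum big_nat_recr//= powE !mxE mulrnDl mulrnAr.
apply/cvg_rn => e e0.
pose r := rn (d 0 i); pose K := 2 * expR (2 * r) * r.
(* The bound on the remainder of the series is [K] times the general term of the real exponential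
   series of [r], which tends to [0]. *)
have /cvgr0Pnorm_lt/(_ _ e0)[M _ HM] : K * exp_coeff r n0 @[n0 --> \oo] --> (0 : R).
  rewrite -(mulr0 K); apply: cvgMl_tmp.
  exact/cvg_series_cvg_0/is_cvg_series_exp_coeff.
exists M.+1 => // -[|N] //= MN; rewrite sumE !mxE.
case: eqP => [ij|_]; last by rewrite !mulr0n subrr rn0.
rewrite !mulr1n rnC (le_lt_trans (exp_sum_bound _ _))//.
apply: le_lt_trans (HM N MN); rewrite (le_trans _ (ler_norm _))//= /K -/r /exp_coeff/=.
by rewrite exprS !mulrA.
Qed.

End IsDz.

(** * Separating directions and monotonicity of the exponents *)

Section Compactness.
Context {R : realType}.

Lemma complex_box_compact (K : R) :
  compact [set z : R[i] | `|complex.Re z| <= K /\ `|complex.Im z| <= K].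
Proof.
have -> : [set z : R[i] | `|complex.Re z| <= K /\ `|complex.Im z| <= K] =
    (fun p : R * R => p.1 +i* p.2) @` (`[-K, K] `*` `[-K, K]).
  apply/seteqP; split => [z /= [zr zi]|_ [[a b] /= [h1 h2] <-]].
    exists (complex.Re z, complex.Im z); last by case: (z).
    by split; rewrite /= in_itv/= -ler_norml.
  by move: h1 h2; rewrite /= !in_itv/= -!ler_norml.
apply: continuous_compact; last by apply: compact_setX; exact: segment_compact.
apply: continuous_subspaceT => -[a b]; apply/cvg_rn => e e0.
have e20 : 0 < e / 2 by rewrite divr_gt0.
have n1 : \forall p \near nbhs (a, b), `|a - p.1| < e / 2.
  have : p.1 @[p --> (a, b)] --> a by exact: cvg_fst.
  by move=> /cvgrPdist_lt; apply.
have n2 : \forall p \near nbhs (a, b), `|b - p.2| < e / 2.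
  have : p.2 @[p --> (a, b)] --> b by exact: cvg_snd.
  by move=> /cvgrPdist_lt; apply.
apply: filterS2 n1 n2 => p h1 h2.
rewrite rnC (le_lt_trans (rn_ReIm _))// (splitr e) !ReImE ltrD//.
Qed.

(** A box of row vectors is a product of compact boxes of the plane; [vec_mx] carries it to a
    compact set of matrices containing [A]. *)
Lemma mx_closed_bounded_compact (m n : nat) (A : set 'M[R[i]]_(m, n)) (K : R) :
  closed A -> (forall M, A M -> rn M <= K) -> compact A.
Proof.
move=> cA AK.
have c1 : compact [set v : 'rV[R[i]]_(m * n) | forall i,
    [set z : R[i] | `|complex.Re z| <= K /\ `|complex.Im z| <= K] (v ord0 i)].
  apply: (@rV_compact R[i] (m * n)%N
      (fun=> [set z : R[i] | `|complex.Re z| <= K /\ `|complex.Im z| <= K])) => i.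
    exact: complex_box_compact.
have c2 : compact (vec_mx @` [set v : 'rV[R[i]]_(m * n) | forall i,
    [set z : R[i] | `|complex.Re z| <= K /\ `|complex.Im z| <= K] (v ord0 i)]
    : set 'M[R[i]]_(m, n)).
  apply: continuous_compact => //; apply: continuous_subspaceT => v.
  apply: (@continuous_rn R _ _ (vec_mx : 'rV[R[i]]_(m * n) -> 'M[R[i]]_(m, n)) v).2 => e e0.
  exists e => // u uv; apply/rn_mx_lt => // i j.
  have := rn_entry_le (u - v) ord0 (mxvec_index i j).
  by rewrite !mxE => /le_lt_trans; apply.
apply: subclosed_compact cA c2 _ => M AM; exists (mxvec M); last exact: mxvecK.
move=> i /=; case/mxvec_indexP: i => i j; rewrite mxvecE.
have := le_trans (rn_entry_le M i j) (AK _ AM) => H.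
by split; apply: le_trans H; [exact: rnRe|exact: rnIm].
Qed.

Lemma bounded_set_rn (V : normedModType R[i]) (A : set V) : bounded_set A ->
  exists K, forall x, closure A x -> rn x <= K.
Proof.
move=> [M [Mr HM]].
have [K MK] : exists K : R, M < K%:C.
  move/RRe_real: Mr => Mr; exists (complex.Re M + 1).
  by rewrite -Mr ltcR ltrDl.
exists (K + 1) => x Ax.
have nx : nbhs x [set y | rn (y - x) < 1] by apply/nbhs_rn; exists 1.
have [y [Ay /= yx]] := Ax _ nx.
have := HM _ MK y Ay; rewrite /= rnE lecR => yK.
by rewrite -(subrK y x) (le_trans (rnD _ _))// addrC lerD// rnC ltW.
Qed.

Lemma compact_min_pos (T : topologicalType) (A : set T) (f : T -> R) :
  compact A -> {within A, continuous f} -> (forall x, A x -> 0 < f x) ->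
  exists2 m : R, 0 < m & forall x, A x -> m <= f x.
Proof.
move=> cA cf f0; have [[x Ax]|A0] := pselect (A !=set0); last first.
  by exists 1 => // x Ax; case: A0; exists x.
have [c /[!inE] Ac H] := compact_EVT_min (ex_intro _ x Ax) cA cf.
by exists (f c); [exact: f0|move=> y Ay; apply: H; rewrite inE].
Qed.

Lemma finite_pos_min (I : finType) (P : I -> R -> Prop) :
  (forall i m m', m' <= m -> P i m -> P i m') ->
  (forall i, exists m, 0 < m /\ P i m) -> exists m, 0 < m /\ forall i, P i m.
Proof.
move=> Pm H; have [f Hf] := choice H.
exists (\big[Order.min/1]_i f i); split.
  by elim/big_ind : _ => // [x y x0 y0|i _]; [rewrite lt_min x0|have [] := Hf i].
move=> i; apply: Pm (Hf i).2; exact: bigmin_le_cond.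
Qed.

Lemma rn_mx_continuous (m n : nat) (f : 'M[R[i]]_(m, n) -> R) (K : R) :
  (forall A B, `|f A - f B| <= K * rn (A - B)) -> continuous f.
Proof.
move=> fK A; have FF : Filter (nbhs A) by exact: nbhs_filter.
apply/cvgrPdist_lt => e e0; apply: (@nbhs_rn R _ A _).2.
have K0 : 0 < `|K| + 1 by rewrite ltr_wpDl.
exists (e / (`|K| + 1)); first by rewrite divr_gt0.
move=> B; rewrite ltr_pdivlMr// mulrC rnC; apply: le_lt_trans.
rewrite (le_trans (fK _ _))// ler_wpM2r ?rn_ge0//.
by rewrite (le_trans (ler_norm K))// lerDl.
Qed.

End Compactness.

(** * Equivalence of the given norm with the maximum norm *)

Section NormEquivalence.
Context {R : realType} {n : nat}.
Variable N : 'M[R[i]]_n -> R.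
Hypothesis N_norm : is_norm N.

Let ND A B : N (A + B) <= N A + N B. Proof. by case: N_norm. Qed.

Let NZ (c : R[i]) A : N (c *: A) = rn c * N A.
Proof. by case: N_norm => _ H _; apply: complexI; rewrite H rcM -rnE. Qed.

Let N0 : N 0 = 0. Proof. by rewrite -(scale0r 0) NZ rn0 mul0r. Qed.

Let NN A : N (- A) = N A.
Proof. by rewrite -scaleN1r NZ rnN rn1 mul1r. Qed.

Lemma norm_ge0 A : 0 <= N A.
Proof. by have := ND A (- A); rewrite subrr N0 NN; lra. Qed.

Lemma norm_le_entries : exists2 K : R, 0 < K & forall (A : 'M[R[i]]_n) (e : R), 0 <= e ->
  (forall i j, rn (A i j) <= e) -> N A <= K * e.
Proof.
pose K := \sum_i \sum_j N (delta_mx i j).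
have K0 : 0 <= K by apply: sumr_ge0 => i _; apply: sumr_ge0 => j _; exact: norm_ge0.
exists (K + 1); first by rewrite ltr_wpDl.
move=> A e e0 Ae; rewrite (@le_trans _ _ (K * e))//; last by rewrite ler_wpM2r// lerDl.
have Nsum (I : finType) (f : I -> 'M[R[i]]_n) : N (\sum_i f i) <= \sum_i N (f i).
  elim/big_ind2 : _ => //; first by rewrite N0.
  by move=> x a y b xa yb; rewrite (le_trans (ND _ _))// lerD.
rewrite {1}[A]matrix_sum_delta (le_trans (Nsum _ _))// /K mulr_suml ler_sum// => i _.
rewrite (le_trans (Nsum _ _))// mulr_suml ler_sum// => j _.
by rewrite NZ mulrC ler_wpM2l// norm_ge0.
Qed.

Lemma norm_lip : exists2 K : R, 0 < K & forall A B, `|N A - N B| <= K * rn (A - B).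
Proof.
have [K K0 HK] := norm_le_entries; exists K => // A B.
have H C : N C <= K * rn C by apply: HK; [exact: rn_ge0|exact: rn_entry_le].
have h1 := ND (A - B) B; have h2 := ND (B - A) A.
rewrite !subrK -(NN (B - A)) opprB in h1 h2.
by have := H (A - B); rewrite ler_norml; move=> ?; apply/andP; split; lra.
Qed.

(** By compactness [N] has a positive minimum [m] on the unit sphere of the maximum norm;
    homogeneity gives the constant [m^-1]. *)
Lemma entries_le_norm : exists2 c : R, 0 < c & forall (A : 'M[R[i]]_n) i j, rn (A i j) <= c * N A.
Proof.
have [K K0 Nl] := norm_lip.
pose S := [set A : 'M[R[i]]_n | rn A = 1].
have cS : compact S.
  apply: (@mx_closed_bounded_compact _ _ _ _ 1); last by move=> A ->.
  have cr : continuous (fun A : 'M[R[i]]_n => rn A).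
    by apply: (@rn_mx_continuous _ _ _ _ 1) => A B; rewrite mul1r rn_dist.
  rewrite (_ : S = (fun A => rn A) @^-1` [set 1]); last by [].
  by apply: closed_comp; [move=> A _; exact: cr|exact: closed_eq].
have [|A SA|m m0 Hm] := compact_min_pos cS (f := N).
- by apply: continuous_subspaceT; exact: rn_mx_continuous Nl.
- rewrite lt_neqAle norm_ge0 andbT eq_sym; apply/eqP => NA.
  have [_ _ /(_ _ NA) A0] := N_norm; move: SA; rewrite /S/= A0 rn0 => /eqP.
  by rewrite eq_sym oner_eq0.
exists m^-1; rewrite ?invr_gt0// => A i j; apply: le_trans (rn_entry_le A i j) _.
have [->|A0] := eqVneq A 0; first by rewrite rn0 mulr_ge0 ?norm_ge0// invr_ge0 ltW.
have rA0 : 0 < rn A by rewrite lt_neqAle eq_sym rn_eq0 A0 rn_ge0.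
have := Hm ((rn A)^-1%:C *: A); rewrite /S/= rnZ rnR ger0_norm ?invr_ge0 ?(ltW rA0)//.
rewrite mulVf ?gt_eqF// => /(_ erefl).
by rewrite NZ rnR ger0_norm ?invr_ge0 ?(ltW rA0)// ler_pdivlMl// mulrC ler_pdivlMl// mulrC.
Qed.

Lemma is_norm_continuous : continuous N.
Proof. by have [K _ H] := norm_lip; exact: rn_mx_continuous H. Qed.

End NormEquivalence.

(** * Arguments of complex numbers *)

Section Arguments.
Context {R : realType}.

Lemma Re_cexp_polar (r t : R) : complex.Re (r%:C * cexp (0 +i* t)) = r * cos t.
Proof. by rewrite cReM /cexp/= expR0 !mul1r mul0r subr0. Qed.

Lemma Re_scale (r : R) (z : R[i]) : complex.Re (r%:C * z) = r * complex.Re z.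
Proof. by rewrite cReM /= mul0r subr0. Qed.

Lemma cexp_imD (s t : R) : cexp (0 +i* (s + t)) = cexp (0 +i* s) * cexp (0 +i* t).
Proof. by rewrite -cexpD; congr cexp; apply/eqP; rewrite eq_complex/= addr0 !eqxx. Qed.

Lemma cexp_im_pi : cexp (0 +i* pi) = -1 :> R[i].
Proof.
by rewrite /cexp/= expR0 cospi sinpi mulr0 mul1r; apply/eqP; rewrite eq_complex/= oppr0 !eqxx.
Qed.

Lemma cexp_im_intpi (m : int) : exists b : bool, cexp (0 +i* (m%:~R * pi)) = (-1) ^+ b :> R[i].
Proof.
have nat_case (n : nat) : exists b : bool, cexp (0 +i* (n%:R * pi)) = (-1) ^+ b :> R[i].
  elim: n => [|n [b IH]].
    exists false; rewrite mul0r (_ : 0 +i* 0 = 0) ?cexp0//.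
  by exists (~~ b); rewrite -natr1 mulrDl mul1r cexp_imD IH cexp_im_pi; case: (b); rewrite /=
      ?expr1 ?expr0; ring.
case: m => n; first exact: nat_case.
have [b Hb] := nat_case n.+1; exists b; rewrite NegzE mulrNz mulNr.
rewrite (_ : 0 +i* _ = - (0 +i* (n.+1%:R * pi))); last by apply/eqP; rewrite eq_complex/= oppr0 !eqxx.
by rewrite cexpN Hb; case: b {Hb}; rewrite ?expr1 ?expr0 ?invrN1 ?invr1.
Qed.

Lemma is_arg_ex (z : R[i]) : z != 0 -> exists t, is_arg z t.
Proof.
move=> z0; have r0 : 0 < rn z by rewrite lt_neqAle eq_sym rn_eq0 z0 rn_ge0.
pose a := complex.Re z / rn z; pose b := complex.Im z / rn z.
have ab : a ^+ 2 + b ^+ 2 = 1.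
  rewrite /a /b !expr_div_n -mulrDl (_ : _ + _ = rn z ^+ 2) ?divff ?expf_neq0 ?gt_eqF//.
  by rewrite norm_sqr sqr_sqrtr// addr_ge0// sqr_ge0.
have a1 : -1 <= a <= 1.
  by rewrite -ler_norml -[X in _ <= X](@sqrtr1 R) -sqrtr_sqr ler_wsqrtr// -ab lerDl sqr_ge0.
have zE : z = (rn z)%:C * (a +i* b).
  apply/eqP; rewrite eq_complex/= !mul0r subr0 addr0 /a /b !(mulrC (rn z)).
  by rewrite (divfK (lt0r_neq0 r0)) (divfK (lt0r_neq0 r0)) !eqxx.
have sE : sin (acos a) = `|b|.
  by rewrite sin_acos// -ab addrAC subrr add0r sqrtr_sqr.
have [b0|b0] := leP 0 b.
  exists (acos a); rewrite /is_arg rnE {1}zE; congr (_ * _).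
  by rewrite /cexp/= expR0 !mul1r acosK// sE ger0_norm.
exists (- acos a); rewrite /is_arg rnE {1}zE; congr (_ * _).
by rewrite /cexp/= expR0 !mul1r cosN sinN acosK// sE ltr0_norm// opprK.
Qed.

(** A multiple [m pi] moves an argument of [z] into the window closed on the left, and the left end
    is excluded by hypothesis. The parity of [m] decides whether the shifted angle belongs to [z] or
    to [- z]. *)
Lemma is_arg_window (eta : R) (z : R[i]) : z != 0 ->
  (forall t (m : int), is_arg z t -> eta <> t + m%:~R * pi) ->
  arg_window eta z !=set0 \/ arg_window eta (- z) !=set0.
Proof.
move=> z0 Hm; have [t0 zt0] := is_arg_ex z0.
pose m := Num.floor ((t0 - eta) / pi) + 1.
have pi0 := @pi_gt0 R.
have h1 : m%:~R * pi <= t0 - eta + pi.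
  rewrite /m rmorphD/= mulrDl mul1r lerD2r -ler_pdivlMr//; exact: floor_le_tmp.
have h2 : t0 - eta < m%:~R * pi.
  by rewrite -ltr_pdivrMr// /m; exact: lt_succ_floor.
pose t := t0 - m%:~R * pi.
have tw : eta - pi < t < eta.
  rewrite /t; apply/andP; split; last by lra.
  rewrite lt_neqAle; apply/andP; split; last by lra.
  apply/eqP => e; apply: (Hm t0 (- m + 1) zt0).
  by rewrite rmorphD/= rmorphN/= mulrDl mul1r mulNr addrA -e subrK.
have [b Hb] := cexp_im_intpi (- m).
have zt : cexp (0 +i* t) = cexp (0 +i* t0) * (-1) ^+ b.
  by rewrite /t cexp_imD -Hb rmorphN/= mulNr.
have : z = `|z| * cexp (0 +i* t0) by [].
case: b Hb zt => Hb zt ze; [right|left]; exists t; split => //; rewrite /is_arg.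
  by rewrite normrN zt mulrA -ze expr1 mulrN1.
by rewrite zt expr0 mulr1.
Qed.

Lemma upow_polar (w : R[i]) (s : R) :
  upow w s = (expR (s * complex.Re w))%:C * cexp (0 +i* (s * complex.Im w)).
Proof. by rewrite /upow /umod -expRM (mulrC _ s). Qed.

Lemma cos_ge_sin (y ga : R) : 0 < ga -> `|y| <= pi / 2 - ga -> sin ga <= cos y.
Proof.
move=> ga0 yle; have y0 := normr_ge0 y; have pi0 := @pi_gt0 R.
rewrite -(cos_norm y) (_ : sin ga = cos (pi / 2 - ga)); last first.
  by rewrite cosB cos_pihalf sin_pihalf mul0r mul1r add0r.
rewrite leNgt; apply/negP => cl; have := yle; rewrite leNgt => /negP; apply.
by rewrite ltr_cos in cl => //; rewrite in_itv/=; apply/andP; split; lra.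
Qed.

(** The part of [A] where [f > 0] is relatively open, and relatively closed because on [A] it is
    also the part where [f >= 0]. *)
Lemma connected_sign (T : topologicalType) (A : set T) (f : T -> R) :
  connected A -> continuous f -> (forall x, A x -> f x != 0) ->
  forall x y, A x -> A y -> (0 < f x) = (0 < f y).
Proof.
move=> cA cf f0.
have H x y : A x -> A y -> 0 < f x -> 0 < f y.
  move=> Ax Ay fx; pose B := A `&` [set t | 0 < f t].
  suff BA : B = A by have [] : B y by rewrite BA.
  apply: cA; first by exists x.
    exists [set t | 0 < f t] => //.
    by apply: (@open_comp _ _ f [set t | 0 < t]) => [t _|]; [exact: cf|exact: open_gt].
  exists [set t | 0 <= f t].
    by apply: (@closed_comp _ _ f [set t | 0 <= t]) => [t _|]; [exact: cf|exact: closed_ge].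
  apply/seteqP; split => t [At /= ft]; split => //=; first exact: ltW.
  by rewrite lt_neqAle eq_sym f0.
by move=> x y Ax Ay; apply/idP/idP; exact: H.
Qed.

End Arguments.

(** * The sector of an adequate tuple and the signs of the exponents *)

Section SectorGeometry.
Context {R : realType} {l h mu : nat}.
Variables (sigma : 'I_h.+1 -> R) (Omega : set 'M[R[i]]_(l, h.+1)) (eta : R)
  (sg : 'I_mu -> R) (tau : 'I_mu -> 'M[R[i]]_(l, h.+1) -> R) (k : 'I_mu -> int).
Hypothesis l_ge2 : (2 <= l)%N.
Hypothesis sigma0 : sigma ord0 = 1.
Hypothesis sigma_gt0 : forall j, 0 < sigma j.
Hypothesis sigma_decr : forall j j' : 'I_h.+1, (j < j')%N -> sigma j' < sigma j.
Hypothesis Omega_neq0 : Omega !=set0.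
Hypothesis Omega_connected : connected Omega.
Hypothesis Omega_bounded : bounded_set Omega.
Hypothesis Omega_degrees : constant_degrees Omega.
Hypothesis Omega_enum : preserved_enumeration eta Omega.
Hypothesis tau_enum : tau_enumeration sigma eta Omega sg tau.

Let Sigma := Sigma_set Omega sg tau k.

Lemma closure_Omega_compact : compact (closure Omega).
Proof.
have [K HK] := bounded_set_rn Omega_bounded.
by apply: mx_closed_bounded_compact HK; exact: closed_closure.
Qed.

(** The leading index of a pair is the same for all parameters, so it is read off at one chosen
    point of [Omega]. *)
Let kf i j := k_first (get Omega) i j.

Let Omega_get : Omega (get Omega).
Proof. by case: Omega_neq0 => x; exact: getI. Qed.

Let closure_get : closure Omega (get Omega).
Proof. exact: subset_closure. Qed.

Lemma k_firstE omega i j : closure Omega omega -> i != j -> k_first omega i j = kf i j.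
Proof. by move=> co ij; have [_ _ H] := Omega_degrees ij; exact: H. Qed.

Lemma lamE omega i j : closure Omega omega -> i != j ->
  lam omega i j = omega i (kf i j) - omega j (kf i j).
Proof. by move=> co ij; rewrite /lam k_firstE. Qed.

Lemma lam_neq0 omega i j : closure Omega omega -> i != j -> lam omega i j != 0.
Proof. by move=> co ij; have [_ H _] := Omega_degrees ij; exact: H. Qed.

Lemma k_firstP (omega : 'M[R[i]]_(l, h.+1)) (i j : 'I_l) (k' : 'I_h.+1) :
  (k' < k_first omega i j)%N -> omega i k' = omega j k'.
Proof.
rewrite /k_first /arg_min /extremum; case: pickP => [k0 /andP[_ /forallP H]|no] //= kk.
apply/eqP/negPn/negP => nk; have := H k'; rewrite nk/= leqNgt.
by rewrite kk.
Qed.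

Lemma k_first_sym (omega : 'M[R[i]]_(l, h.+1)) (i j : 'I_l) : k_first omega j i = k_first omega i j.
Proof.
by rewrite /k_first; congr (arg_min _ _ _); apply/funext => k'; rewrite eq_sym.
Qed.

Lemma lam_sym (omega : 'M[R[i]]_(l, h.+1)) (i j : 'I_l) : lam omega j i = - lam omega i j.
Proof. by rewrite /lam k_first_sym opprB. Qed.

(** [Z] will be the number [tau_rho + k_rho pi / sigma] attached to the pair: for [arg z = Z] the
    leading term [lam z^sigma] of [q_i - q_j] is purely imaginary, and [b] records the signs of its
    real part on the two sides. The second clause places [Sigma] in the interval of length [pi] to
    the left of [Z]. *)
Definition zero_direction (omega : 'M[R[i]]_(l, h.+1)) (i j : 'I_l) (Z : R) (b : bool) :=
  (forall be : R, complex.Re (lam omega i j * cexp (0 +i* be)) =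
    (-1) ^+ b * rn (lam omega i j) * sin (be - sigma (k_first omega i j) * Z)) /\
  (forall x, Sigma x -> Z - pi < x < Z).

Lemma windowed_zero_direction omega i j : closure Omega omega -> windowed eta omega i j ->
  exists Z b, zero_direction omega i j Z b.
Proof.
move=> co w; have [ij wne] := w.
have [_ arg_t] : arg_window eta (lam omega i j) (arg_det eta (lam omega i j)) by exact: xgetPex wne.
have [tE _] := tau_enum; have [_ rngE _] := tE _ co.
have [rho _ [sgE tauE]] : range (fun rho => (sg rho, tau rho omega))
    (sigma (k_first omega i j), tau_pair sigma eta omega i j).
  by rewrite rngE; exists (i, j).
set t := arg_det _ _ in arg_t.
have sg0 : sigma (k_first omega i j) != 0 by rewrite gt_eqF.
pose Z := tau rho omega + (k rho)%:~R * pi / sg rho.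
have ZE : sigma (k_first omega i j) * Z = 3 * pi / 2 - t + (k rho)%:~R * pi.
  rewrite /Z tauE sgE /tau_pair -/t mulrDr mulrC (divfK sg0); congr (_ + _).
  by rewrite mulrC (divfK sg0).
have [b Hb] := cexp_im_intpi (- k rho : int) (R := R).
exists Z, b; split; last first.
  move=> x /(_ _ co rho I); rewrite /= in_itv/= => /andP[x1 x2].
  by rewrite /Z; apply/andP; split; lra.
move=> be; rewrite ZE.
have -> : lam omega i j * cexp (0 +i* be) = (rn (lam omega i j))%:C * cexp (0 +i* (t + be)).
  by rewrite cexp_imD mulrA -rnE -arg_t.
rewrite Re_cexp_polar.
rewrite -mulrA [RHS]mulrCA; congr (_ * _).
(* The summand [3 pi / 2] in [tau] turns the cosine into a sine that vanishes at [be = sigma Z]; the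
   multiple [k_rho pi] contributes only the sign [(-1)^b]. *)
have e1 : cos (t + be) = sin (t + be + pi / 2) by rewrite sinDpihalf.
have e2 : t + be + pi / 2 = be - (3 * pi / 2 - t + (k rho)%:~R * pi) + (k rho)%:~R * pi + pi *+ 2.
  by rewrite (mulr2n pi); lra.
rewrite e1 e2 sinD2pi; set y := be - _.
have Hs (x : R) : sin (x + (- k rho)%:~R * pi) = (-1) ^+ b * sin x.
  have := cexp_imD x ((- k rho)%:~R * pi); rewrite Hb => /(congr1 (@complex.Im R)).
  rewrite /cexp/= expR0 !mul1r => ->.
  by case: (b); rewrite ?expr1 ?expr0 /=; ring.
rewrite -[in RHS](addrK ((k rho)%:~R * pi) y) -mulNr -rmorphN Hs.
by rewrite mulrA -expr2 sqrr_sign mul1r.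
Qed.

(** Either [lam] or its negative has an argument in the window. In the second case the pair [(j, i)]
    provides [Z], and the sign is reversed. *)
Lemma zero_direction_ex omega i j : closure Omega omega -> i != j ->
  exists Z b, zero_direction omega i j Z b.
Proof.
move=> co ij; have [E1 _ _] := Omega_enum.
have [||w|w] := is_arg_window (eta := eta) (z := lam omega i j).
- exact: lam_neq0.
- by move=> t m; exact: E1.
- exact: windowed_zero_direction.
have [||Z [b [H1 H2]]] := @windowed_zero_direction omega j i => //.
  by split; [rewrite eq_sym|rewrite lam_sym].
exists Z, (~~ b); split => // be; have := H1 be.
rewrite lam_sym mulNr cReN rnN k_first_sym => /eqP; rewrite eqr_oppLR => /eqP ->.
by case: (b); rewrite /= ?expr1 ?expr0; ring.
Qed.

Lemma lam_lower : exists m, 0 < m /\ forall i j omega, closure Omega omega -> i != j ->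
  m <= rn (lam omega i j).
Proof.
have H (p : 'I_l * 'I_l) : exists m, 0 < m /\ (forall omega, closure Omega omega -> p.1 != p.2 ->
    m <= rn (lam omega p.1 p.2)).
  case: p => i j /=; have [->|ij] := eqVneq i j.
    by exists 1; split => // omega _; rewrite eqxx.
  pose f (om : 'M[R[i]]_(l, h.+1)) : R := rn (om i (kf i j) - om j (kf i j)).
  have cf : continuous f.
    apply: (@rn_mx_continuous _ _ _ _ 2) => A B.
    rewrite (le_trans (rn_dist _ _))//.
    rewrite (_ : _ - _ = (A - B) i (kf i j) - (A - B) j (kf i j)); last by rewrite !mxE; ring.
    by rewrite (le_trans (rnB _ _))// mulr_natl mulr2n lerD// rn_entry_le.
  have [||m m0 Hm] := compact_min_pos closure_Omega_compact (f := f).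
  - exact: continuous_subspaceT.
  - move=> om co; rewrite /f -lamE// lt_neqAle eq_sym rn_eq0 lam_neq0//=; exact: rn_ge0.
  by exists m; split => // om co _; rewrite lamE//; exact: Hm.
have [|m [m0 Hm]] := finite_pos_min _ H.
  by move=> p m m' mm' Hp om co pn; apply: le_trans mm' _; exact: Hp.
by exists m; split => // i j om co ij; exact: (Hm (i, j)).
Qed.

Lemma Sigma_convex x y t : Sigma x -> Sigma y -> x <= t <= y -> Sigma t.
Proof.
move=> Sx Sy /andP[xt ty] om co rho _.
have := Sx om co rho I; have := Sy om co rho I; rewrite /= !in_itv/=.
by move=> /andP[a1 a2] /andP[a3 a4]; apply/andP; split; [exact: lt_le_trans xt|exact: le_lt_trans a2].
Qed.

(** The parameter ranges over an infinite set in the intersection defining [Sigma]. Continuity of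
    [tau] on the compact closure of [Omega] gives a distance [m] to the end points that is uniform
    in it; [m / 2] restores the strict inequalities. *)
Lemma Sigma_open x : Sigma x -> exists2 de, 0 < de & Sigma (x - de) /\ Sigma (x + de).
Proof.
move=> Sx.
have H (rho : 'I_mu) : exists m, 0 < m /\ forall om, closure Omega om ->
    m <= tau rho om + (k rho)%:~R * pi / sg rho - x /\
    m <= x - (tau rho om + (k rho)%:~R * pi / sg rho - pi).
  pose f1 om := tau rho om + (k rho)%:~R * pi / sg rho - x.
  pose f2 om := x - (tau rho om + (k rho)%:~R * pi / sg rho - pi).
  have [_ ct] := tau_enum.
  have [||m1 m10 Hm1] := compact_min_pos closure_Omega_compact (f := f1).
  - by move=> z; apply: cvgB; [apply: cvgD; [exact: ct|exact: cvg_cst]|exact: cvg_cst].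
  - by move=> om co; have := Sx om co rho I; rewrite /= in_itv/= /f1 => /andP[? ?]; lra.
  have [||m2 m20 Hm2] := compact_min_pos closure_Omega_compact (f := f2).
  - move=> z; apply: cvgB; first exact: cvg_cst.
    by apply: cvgB; [apply: cvgD; [exact: ct|exact: cvg_cst]|exact: cvg_cst].
  - by move=> om co; have := Sx om co rho I; rewrite /= in_itv/= /f2 => /andP[? ?]; lra.
  exists (Num.min m1 m2); split; first by rewrite lt_min m10.
  move=> om co; rewrite !ge_min; split; apply/orP; [left|right]; [exact: Hm1|exact: Hm2].
have [|m [m0 Hm]] := finite_pos_min _ H.
  by move=> rho m m' mm' Hp om /Hp[? ?]; split; apply: le_trans mm' _.
exists (m / 2); first by rewrite divr_gt0.
have pi0 := @pi_gt0 R.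
split => om co rho _; have [h1 h2] := Hm rho om co; have := Sx om co rho I;
  rewrite /= !in_itv/= => /andP[? ?]; apply/andP; split; lra.
Qed.

(** [l >= 2] provides a pair of distinct indices, whose direction [Z] confines [Sigma]. *)
Lemma Sigma_bounded : exists Z, forall x, Sigma x -> Z - pi < x < Z.
Proof.
have l0 : (0 < l)%N by exact: leq_trans l_ge2.
have [|Z [b [_ H]]] := zero_direction_ex closure_get (i := Ordinal l0) (j := Ordinal l_ge2).
  by [].
by exists Z.
Qed.

Lemma Sigma_lt x y : inf Sigma < x -> Sigma y -> exists2 z, Sigma z & z < x.
Proof.
move=> ix Sy; have [|z Sz zx] := @inf_lt R Sigma x _ ix; last by exists z.
by exists y.
Qed.

Lemma Sigma_gt x y : x < sup Sigma -> Sigma y -> exists2 z, Sigma z & x < z.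
Proof.
move=> ix Sy; have [|z Sz zx] := @sup_gt R Sigma x _ ix; last by exists z.
by exists y.
Qed.

Lemma sigma_gap : exists m, 0 < m /\ forall j j' : 'I_h.+1, (j < j')%N -> m <= sigma j - sigma j'.
Proof.
have [||m [m0 Hm]] := @finite_pos_min R ('I_h.+1 * 'I_h.+1)%type
    (fun p m => (p.1 < p.2)%N -> m <= sigma p.1 - sigma p.2).
- by move=> p m m' mm' H /H; exact: le_trans.
- move=> [j j'] /=; have [jj|jj] := ltnP j j'; last by exists 1; split.
  by exists (sigma j - sigma j'); split => //; rewrite subr_gt0 sigma_decr.
by exists m; split => // j j' jj; exact: (Hm (j, j')).
Qed.

Lemma sigma_le1 j : sigma j <= 1.
Proof.
have [->|j0] := eqVneq j ord0; first by rewrite sigma0.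
by rewrite -sigma0 ltW// sigma_decr// lt0n.
Qed.

(** With [de] the least gap between exponents, every later term is at most [C e^(- de r) E], and
    [e^(de r) >= de r >= M] keeps their sum below [eps E]. [L] depends only on [C], [eps] and the
    exponents, whence uniformity in the parameters. The shift [e] is [0] for [q_i - q_j] and [1] for
    its derivative. *)
Lemma leading_term (C eps : R) : 0 <= C -> 0 < eps -> exists L : R,
  forall (c : 'I_h.+1 -> R[i]) (u : R[i]) (w : R[i]) (e : R) (k0 : 'I_h.+1) (sgn : bool),
  (forall j : 'I_h.+1, (j < k0)%N -> c j = 0) -> (forall j, rn (c j) <= C) -> rn u = 1 ->
  L <= complex.Re w ->
  eps * expR ((sigma k0 - e) * complex.Re w) <=
    (-1) ^+ sgn * complex.Re (u * (c k0 * upow w (sigma k0 - e))) ->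
  0 <= (-1) ^+ sgn * complex.Re (u * \sum_(j < h.+1) c j * upow w (sigma j - e)).
Proof.
move=> C0 eps0; have [de [de0 Hde]] := sigma_gap.
pose M := h.+1%:R * C / eps.
have M0 : 0 <= M by rewrite /M divr_ge0 ?mulr_ge0// ltW.
exists (M / de) => c u w e k0 sgn c0 cC u1 Lw lead.
set r := complex.Re w in Lw lead *.
have r0 : 0 <= r by apply: le_trans Lw; rewrite divr_ge0// ltW.
have Mr : h.+1%:R * C * expR (- (de * r)) <= eps.
  have ME : M <= expR (de * r).
    rewrite ler_pdivrMr// mulrC in Lw; rewrite (le_trans Lw)//.
    by rewrite (le_trans _ (expR_ge1Dx _))// lerDr.
  by move: ME; rewrite /M ler_pdivrMr// expRN ler_pdivrMr ?expR_gt0// (mulrC eps).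
set E := expR ((sigma k0 - e) * r) in lead *.
have E0 : 0 < E by exact: expR_gt0.
have tl : rn (u * \sum_(j < h.+1 | j != k0) c j * upow w (sigma j - e)) <= eps * E.
  rewrite rnM u1 mul1r; apply: le_trans (rn_sum _ _ _) _.
  apply: le_trans (ler_wpM2r (ltW E0) Mr).
  apply: (@le_trans _ _ (\sum_(j < h.+1 | j != k0) (C * expR (- (de * r)) * E))).
    apply: ler_sum => j jk; have [jk0|kj] := ltnP j k0.
      by rewrite c0// mul0r rn0 mulr_ge0 ?mulr_ge0 ?expR_ge0.
    rewrite rnM -mulrA ler_pM ?rn_ge0// upowE rn_cexp /E -expRD ler_expR.
    rewrite cReM/= mul0r subr0 -/r.
    have {}kj : (k0 < j)%N by rewrite ltn_neqAle kj andbT eq_sym.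
    rewrite -mulNr -mulrDl ler_wpM2r//; have := Hde _ _ kj; lra.
  rewrite sumr_const -[X in X <= _]mulr_natl !mulrA ler_wpM2r ?(ltW E0)// ler_wpM2r ?expR_ge0//.
  by rewrite ler_wpM2r// ler_nat (leq_trans (max_card _))// card_ord.
have split_sum : \sum_(j < h.+1) c j * upow w (sigma j - e) =
   c k0 * upow w (sigma k0 - e) + \sum_(j < h.+1 | j != k0) c j * upow w (sigma j - e).
  by rewrite (bigD1 k0).
rewrite split_sum mulrDr cReD mulrDr.
set T := u * \sum_(_ < _ | _) _ in tl *.
have : - rn T <= (-1) ^+ sgn * complex.Re T.
  have := le_trans (rnRe T) (lexx _); rewrite ler_norml => /andP[? ?].
  by case: (sgn); rewrite ?expr1 ?expr0; lra.
by lra.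
Qed.

Lemma sin_sector_lt0 j x Z : Z - pi < x < Z -> sin (sigma j * x - sigma j * Z) < 0.
Proof.
move=> /andP[x1 x2]; have s1 := sigma_le1 j; have s0 := sigma_gt0 j.
rewrite -oppr_gt0 -sinN; apply: sin_gt0_pi; apply/andP; split; nra.
Qed.

(** The sine in [zero_direction] is negative at [be = sigma x], so [Re (lam e^(i sigma x))] vanishes
    for no parameter and its sign, constant by connectedness, determines [b]. *)
Lemma direction_sign i j x : Sigma x -> i != j -> exists b0 : bool,
  forall omega Z b, Omega omega -> zero_direction omega i j Z b -> b = b0.
Proof.
move=> Sx ij.
pose f (om : 'M[R[i]]_(l, h.+1)) : R :=
  complex.Re ((om i (kf i j) - om j (kf i j)) * cexp (0 +i* (sigma (kf i j) * x))).
have fE om Z b : Omega om -> zero_direction om i j Z b ->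
    (f om != 0) /\ (b = (0 < f om)).
  move=> Oo [H1 H2]; have co := subset_closure Oo.
  have := H1 (sigma (kf i j) * x); rewrite lamE// k_firstE// -/(f om) => ->.
  have l0 : 0 < rn (om i (kf i j) - om j (kf i j)).
    by rewrite -lamE// lt_neqAle eq_sym rn_eq0 lam_neq0//= rn_ge0.
  have s0 := sin_sector_lt0 (kf i j) (H2 x Sx).
  case: b H1 => _; rewrite ?expr1 ?expr0 ?mulN1r ?mul1r.
    rewrite mulNr -mulrN.
    have P : 0 < rn (om i (kf i j) - om j (kf i j)) * - sin (sigma (kf i j) * x - sigma (kf i j) * Z).
      by apply: mulr_gt0 => //; rewrite oppr_gt0.
    by rewrite P (gt_eqF P).
  have : rn (om i (kf i j) - om j (kf i j)) * sin (sigma (kf i j) * x - sigma (kf i j) * Z) < 0 by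
      rewrite pmulr_rlt0.
  by move=> P; rewrite (lt_eqF P) lt_gtF.
have cf : continuous f.
  apply: (@rn_mx_continuous _ _ _ _ 2) => A B; rewrite /f.
  set u := cexp _.
  have -> : complex.Re ((A i (kf i j) - A j (kf i j)) * u) - complex.Re ((B i (kf i j) - B j (kf i j)) * u)
    = complex.Re (((A - B) i (kf i j) - (A - B) j (kf i j)) * u).
    by rewrite !mxE !ReImE; ring.
  apply: le_trans (rnRe _) _; rewrite rnM rn_cexp/= expR0 mulr1.
  by rewrite (le_trans (rnB _ _))// mulr_natl mulr2n lerD// rn_entry_le.
exists (0 < f (get Omega)) => om Z b Oo zd.
rewrite (fE _ _ _ Oo zd).2; apply: (connected_sign Omega_connected cf) => //.
move=> om' Oo'; have [Z' [b' zd']] := zero_direction_ex (subset_closure Oo') ij.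
exact: (fE _ _ _ Oo' zd').1.
Qed.

(** In the direction [x + pi / 2] the derivative of [p] along a vertical line is [e^(i (x + pi))]
    times the difference of the derivatives of [q_i] and [q_j] in [z]. Up to the sign [b], the real
    part of its leading term is a positive multiple of [cos y], where [y = s (x + pi/2 - Z) + (1 -
    s) (x + pi/2 - arg w)] is a convex combination of an angle of size at most [pi/2 - de] and one
    of size below [pi/2]. Hence [|y| <= pi/2 - s de] up to the very edges of the half-plane; [de] is
    the room left around [[c, d]] in [Sigma]. *)
Lemma monotone_exponents c d : Sigma c -> Sigma d -> c <= d -> exists L,
  forall x, c <= x <= d -> exists sgn : 'I_l -> 'I_l -> bool,
  forall omega i j w, Omega omega -> `|uarg w - (x + pi / 2)| < pi / 2 -> L <= complex.Re w ->
  0 <= (-1) ^+ sgn i j * complex.Re (cexp (0 +i* (x + pi)) *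
    \sum_(k' < h.+1) ((sigma k')%:C * (omega i k' - omega j k')) * upow w (sigma k' - 1)).
Proof.
move=> Sc Sd cd.
have [d1 d10 [Sc1 _]] := Sigma_open Sc; have [d2 d20 [_ Sd2]] := Sigma_open Sd.
have [m1 [m10 Hm1]] := lam_lower.
pose de := Num.min d1 d2.
have de0 : 0 < de by rewrite lt_min d10.
have [de1 de2] : de <= d1 /\ de <= d2 by rewrite !ge_min !lexx orbT.
have [K HK] := bounded_set_rn Omega_bounded.
have K0 : 0 <= K by apply: le_trans (HK _ closure_get); exact: rn_ge0.
have depi : de < pi.
  by have [Z HZ] := Sigma_bounded; have := HZ _ Sc1; have := HZ _ Sd2; move=> /andP[? ?] /andP[? ?]; lra.
have [||m [m0 Hm]] := @finite_pos_min R _ (fun (j : 'I_h.+1) m => m <= sigma j * sin (sigma j * de)).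
- by move=> j m m'; exact: le_trans.
- move=> j; exists (sigma j * sin (sigma j * de)); split => //.
  have s1 := sigma_le1 j; have s0 := sigma_gt0 j.
  by rewrite mulr_gt0// sin_gt0_pi//; apply/andP; split; nra.
have [||L HL] := @leading_term (K + K) (m * m1); [by rewrite addr_ge0|by rewrite mulr_gt0|].
exists L => x /andP[cx xd].
have Sx : Sigma x by apply: Sigma_convex Sc Sd _; rewrite cx.
have H (p : 'I_l * 'I_l) : exists b0 : bool, p.1 != p.2 -> forall omega Z b, Omega omega ->
    zero_direction omega p.1 p.2 Z b -> b = b0.
  case: p => i j /=; have [->|ij] := eqVneq i j; first by exists true.
  by have [b0 Hb] := direction_sign Sx ij; exists b0.
have {H}[sgn Hsgn] := choice H.
exists (fun i j => sgn (i, j)) => om i j w Oo warg Lw; have co := subset_closure Oo.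
have [->|ij] := eqVneq i j.
  by rewrite big1 ?mulr0 ?mulr0// => k' _; rewrite subrr mulr0 mul0r.
have [Z [b zd]] := zero_direction_ex co ij.
have bE : b = sgn (i, j) by exact: (Hsgn (i, j) ij om Z b Oo zd).
have {Hsgn}[H1 H2] := zd; rewrite -bE.
apply: (HL _ _ _ _ (kf i j)) => //.
- by move=> j' jk; rewrite (k_firstP (omega := om) (i := i) (j := j)) ?subrr ?mulr0// k_firstE.
- move=> j'; rewrite rnM rnR gtr0_norm//.
  rewrite -[X in _ <= X]mul1r.
  apply: ler_pM; rewrite ?rn_ge0 ?sigma_le1// ?(ltW (sigma_gt0 _))//.
  apply: le_trans (rnB _ _) _; have Ko := HK _ co.
  by rewrite lerD// (le_trans (rn_entry_le om _ _)).
- by rewrite rn_cexp/= expR0.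
rewrite -lamE// upow_polar -/(uarg w).
set r := complex.Re w; set th := uarg w in warg *; set s := sigma (kf i j).
set E := expR _.
have -> : cexp (0 +i* (x + pi)) * (s%:C * lam om i j * (E%:C * cexp (0 +i* ((s - 1) * th)))) =
    (s * E)%:C * (lam om i j * cexp (0 +i* (x + pi + (s - 1) * th))).
  by rewrite (cexp_imD (x + pi)) rcM; set A := cexp _; set B := cexp _; ring.
rewrite Re_scale H1 k_firstE// -/s.
have s1 := sigma_le1 (kf i j) : s <= 1; have s0 := sigma_gt0 (kf i j) : 0 < s.
set y := s * (x + pi / 2 - Z) + (1 - s) * (x + pi / 2 - th).
have -> : x + pi + (s - 1) * th - s * Z = y + pi / 2 by rewrite /y; lra.
rewrite sinDpihalf.
have ylt : `|y| <= pi / 2 - s * de.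
  have /andP[z1 z2] := H2 _ Sc1; have /andP[z3 z4] := H2 _ Sd2.
  move: warg; rewrite ltr_norml ler_norml => /andP[w1 w2].
  rewrite /y; apply/andP; split; nra.
have cosy : sin (s * de) <= cos y by apply: cos_ge_sin ylt; rewrite mulr_gt0.
have E0 : 0 < E by exact: expR_gt0.
have -> : (-1) ^+ b * (s * E * ((-1) ^+ b * rn (lam om i j) * cos y)) = s * cos y * rn (lam om i j) * E.
  by case: (b); rewrite ?expr1 ?expr0; ring.
rewrite ler_wpM2r ?(ltW E0)// ler_pM ?(ltW m0) ?(ltW m10)//; last exact: Hm1.
by apply: le_trans (Hm (kf i j)) _; rewrite ler_wpM2l// ltW.
Qed.

(** [Z] lies strictly between [x2] and [x1 + pi]. A step [ep] off [Z], to the side chosen by [b],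
    makes the real part of the leading term equal to [|lam| sin (s ep) e^(s r)]. *)
Lemma dominance_direction x1 x2 omega i j : Sigma x1 -> Sigma x2 -> x1 <= x2 ->
  closure Omega omega -> i != j -> exists2 th, x2 < th < x1 + pi &
  exists L, forall r, L <= r ->
    0 <= complex.Re (q_fun sigma (r +i* th) omega i - q_fun sigma (r +i* th) omega j).
Proof.
move=> S1 S2 x12 co ij; have [Z [b [H1 H2]]] := zero_direction_ex co ij.
have /andP[z1 z2] := H2 _ S1; have /andP[z3 z4] := H2 _ S2.
pose ep := Num.min (Z - x2) (x1 + pi - Z) / 2.
have ep0 : 0 < ep by rewrite divr_gt0// lt_min !subr_gt0; apply/andP; split => //; lra.
have [ep1 ep2] : ep <= (Z - x2) / 2 /\ ep <= (x1 + pi - Z) / 2.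
  by rewrite /ep !ler_wpM2r ?invr_ge0// ge_min lexx ?orbT.
set s := sigma (k_first omega i j) in H1.
have s1 := sigma_le1 (k_first omega i j) : s <= 1.
have s0 := sigma_gt0 (k_first omega i j) : 0 < s.
exists (Z + (-1) ^+ b * ep); first by case: (b); rewrite ?expr1 ?expr0; apply/andP; split; lra.
have l0 : 0 < rn (lam omega i j) by rewrite lt_neqAle eq_sym rn_eq0 lam_neq0//= rn_ge0.
have sn0 : 0 < sin (s * ep) by apply: sin_gt0_pi; apply/andP; split; nra.
have [||L HL] := @leading_term (rn omega + rn omega) (rn (lam omega i j) * sin (s * ep)).
- by rewrite addr_ge0 ?rn_ge0.
- by rewrite mulr_gt0.
exists L => r Lr; set w := _ +i* _.
have := HL (fun k' => omega i k' - omega j k') 1 w 0 (k_first omega i j) false.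
rewrite expr0 !mul1r subr0 => H.
rewrite /q_fun -sumrB.
rewrite (eq_bigr (fun j0 => (omega i j0 - omega j j0) * upow w (sigma j0 - 0))); last first.
  by move=> j' _; rewrite subr0 mulrBl.
apply: H => //.
- by move=> j' jk; rewrite (k_firstP jk) subrr.
- by move=> j'; rewrite (le_trans (rnB _ _))// lerD// rn_entry_le.
- exact: rn1.
rewrite -/(lam omega i j) -/s upow_polar [X in _ <= complex.Re X]mulrCA Re_scale H1 mulrC.
rewrite ler_wpM2l ?expR_ge0//.
have -> : s * (Z + (-1) ^+ b * ep) - s * Z = (-1) ^+ b * (s * ep) by ring.
have -> : sin ((-1) ^+ b * (s * ep)) = (-1) ^+ b * sin (s * ep).
  by case: (b); rewrite ?expr1 ?expr0 ?mulN1r ?mul1r ?sinN.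
by case: (b); rewrite ?expr1 ?expr0 ?mulN1r ?mul1r ?mulrNN.
Qed.

End SectorGeometry.

(** * Linear differential equations with holomorphic parameters *)

Section ProductNorm.
Context {R : realType} {V W : normedModType R[i]}.
Implicit Types (x : (V * W)%type).

Lemma rn_pairE x : rn x = Num.max (rn x.1) (rn x.2).
Proof.
apply: complexI; rewrite -rnE prod_normE.
have [le|lt] := leP (rn x.1) (rn x.2).
  by rewrite max_r ?rnE// lecR.
by rewrite max_l ?rnE// lecR ltW.
Qed.

End ProductNorm.

Section UniformOnSegment.
Context {R : realType}.

(** Compactness of the segment, for a property that persists when its constant shrinks. One number
    [d] is both the size of the neighbourhood and the constant, which suits bounds by [m^-1] on a
    ball of radius [m]. *)
Lemma uniform01 (Q : R -> R -> Prop) :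
  (forall t m m', 0 < m' -> m' <= m -> Q t m -> Q t m') ->
  (forall t, 0 <= t <= 1 -> exists d, 0 < d /\
    forall t', 0 <= t' <= 1 -> `|t' - t| < d -> Q t' d) ->
  exists m, 0 < m /\ forall t, 0 <= t <= 1 -> Q t m.
Proof.
move=> Qm Ql.
have /compact_near_coveringP/(_ R (at_right 0) (fun i x => 0 <= x <= 1 -> Q x i)) H :=
  @segment_compact R 0 1.
have nr : \forall i \near (0 : R)^'+, 0 < i by exact: nbhs_right_gt.
have {}H : \forall i \near (0 : R)^'+, `[0, 1] `<=` (fun x => 0 <= x <= 1 -> Q x i).
  apply: H => t; rewrite /= in_itv/= => t01; have [d [d0 Hd]] := Ql t t01.
  exists ([set t' | `|t' - t| < d], [set i | 0 < i <= d]) => /=.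
    split; first by apply/nbhs_ballP; exists d => //= y; rewrite /ball/= distrC.
    near=> i; apply/andP; split; near: i; [exact: nbhs_right_gt|exact: nbhs_right_le].
  move=> [t' i] /= [tt /andP[i0 id]] t'01; apply: Qm i0 id _; exact: Hd.
have [m [m0 Hm]] : exists m : R, 0 < m /\ `[0, 1] `<=` (fun x => 0 <= x <= 1 -> Q x m).
  have [m []] := filter_ex (filterI nr H); by exists m.
exists m; split => // t t01; apply: Hm => //; by rewrite /= in_itv.
Unshelve. all: by end_near.
Qed.

End UniformOnSegment.

Section Holomorphy.
Context {R : realType} {V : normedModType R[i]}.
Implicit Types (f g : V -> R[i]) (x : V).

Lemma hol_cst (c : R[i]) x : differentiable (fun _ : V => c) x.
Proof. exact: differentiable_cst. Qed.

Lemma holD f g x : differentiable f x -> differentiable g x -> differentiable (fun y => f y + g y) x.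
Proof. exact: differentiableD. Qed.

Lemma holN f x : differentiable f x -> differentiable (fun y => - f y) x.
Proof. exact: differentiableN. Qed.

Lemma holB f g x : differentiable f x -> differentiable g x -> differentiable (fun y => f y - g y) x.
Proof. exact: differentiableB. Qed.

Lemma holM f g x : differentiable f x -> differentiable g x -> differentiable (fun y => f y * g y) x.
Proof. exact: differentiableM. Qed.

Lemma holZ (c : R[i]) f x : differentiable f x -> differentiable (fun y => c * f y) x.
Proof. by move=> df; apply: holM => //; exact: hol_cst. Qed.

Lemma hol_sum (I : Type) (r : seq I) (P : pred I) (F : I -> V -> R[i]) x :
  (forall i, P i -> differentiable (F i) x) -> differentiable (fun y => \sum_(i <- r | P i) F i y) x.
Proof.
move=> dF; elim: r => [|i r IH].
  by rewrite (_ : (fun _ => _) = fun=> 0); [exact: hol_cst|apply/funext => y; rewrite big_nil].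
have [Pi|nPi] := boolP (P i).
  rewrite (_ : (fun _ => _) = fun y => F i y + \sum_(i <- r | P i) F i y).
    by apply: holD IH; exact: dF.
  by apply/funext => y; rewrite big_cons Pi.
by rewrite (_ : (fun _ => _) = fun y => \sum_(i <- r | P i) F i y)//; apply/funext => y; rewrite
    big_cons (negbTE nPi).
Qed.

Lemma hol_mulmx m n p (A : V -> 'M[R[i]]_(m, n)) (B : V -> 'M[R[i]]_(n, p)) x :
  (forall i j, differentiable (fun y => A y i j) x) ->
  (forall i j, differentiable (fun y => B y i j) x) ->
  forall i j, differentiable (fun y => (A y *m B y) i j) x.
Proof.
move=> dA dB i j.
rewrite (_ : (fun _ => _) = fun y => \sum_k A y i k * B y k j).
  by apply: hol_sum => k _; exact: holM.
by apply/funext => y; rewrite mxE.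
Qed.

End Holomorphy.

Section MatrixProductBound.
Context {R : realType}.

Lemma rn_mulmx m n p (A : 'M[R[i]]_(m, n)) (B : 'M[R[i]]_(n, p)) (a b : R) :
  (forall i j, rn (A i j) <= a) -> (forall i j, rn (B i j) <= b) ->
  forall i j, rn ((A *m B) i j) <= n%:R * (a * b).
Proof.
move=> Aa Bb i j; rewrite mxE (le_trans (rn_sum _ _ _))//.
rewrite (@le_trans _ _ (\sum_(k < n) (a * b)))//.
  by apply: ler_sum => k _; rewrite rnM ler_pM ?rn_ge0.
by rewrite sumr_const card_ord mulr_natl.
Qed.

End MatrixProductBound.

Section GeometricLimit.
Context {R : realType}.

Lemma geometric_bound (u : nat -> R[i]) (C : R) :
  (forall k, rn (u k.+1 - u k) <= C * 2^-1 ^+ k) ->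
  forall k m, rn (u (k + m)%N - u k) <= 2 * C * 2^-1 ^+ k.
Proof.
move=> H k m.
have C0 : 0 <= C by have := H 0; rewrite expr0 mulr1; apply: le_trans; exact: rn_ge0.
suff : rn (u (k + m)%N - u k) <= 2 * C * 2^-1 ^+ k * (1 - 2^-1 ^+ m).
  move/le_trans; apply; rewrite ler_piMr// ?mulr_ge0 ?exprn_ge0//.
elim: m => [|m IH]; first by rewrite addn0 subrr rn0 expr0 subrr mulr0.
rewrite addnS -(subrK (u (k + m)%N) (u _.+1)) -addrA.
apply: le_trans (rnD _ _) _; apply: le_trans (lerD (H _) IH) _.
by rewrite exprD exprS; set x := 2^-1 ^+ k; set y := 2^-1 ^+ m; lra.
Qed.

Lemma geometric_cvg (u : nat -> R[i]) (C : R) :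
  (forall k, rn (u k.+1 - u k) <= C * 2^-1 ^+ k) ->
  exists l : R[i], u k @[k --> \oo] --> l.
Proof.
move=> H; apply: rn_cauchy_cvg => e e0.
have e20 : 0 < e / 2 by rewrite divr_gt0.
have [N _ HN] := half_pow_small (2 * C) e20.
exists N => m n Nm Nn.
have h1 := geometric_bound H N (m - N); have h2 := geometric_bound H N (n - N).
rewrite subnKC// in h1; rewrite subnKC// in h2.
have := HN N (leqnn N) => /= h3.
rewrite (_ : u m - u n = (u m - u N) - (u n - u N)); last by ring.
by apply: le_lt_trans (rnB _ _) _; lra.
Qed.

Lemma cvg_succ (u : nat -> R[i]) (l : R[i]) : u k @[k --> \oo] --> l -> u k.+1 @[k --> \oo] --> l.
Proof. by rewrite -(cvg_shiftS u). Qed.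

Lemma cvg_sum_ord (n : nat) (f : 'I_n -> nat -> R[i]) (l : 'I_n -> R[i]) :
  (forall i, f i k @[k --> \oo] --> l i) -> \sum_i f i k @[k --> \oo] --> \sum_i l i.
Proof.
elim: n f l => [|n IH] f l H.
  rewrite big_ord0 (_ : (fun _ => _) = fun=> 0); first exact: cvg_cst.
  by apply/funext => k; rewrite big_ord0.
rewrite big_ord_recr (_ : (fun _ => _) = fun k => \sum_(i < n) f (widen_ord (leqnSn n) i) k + f ord_max k).
  by apply: cvgD (H _); exact: IH.
by apply/funext => k; rewrite big_ord_recr.
Qed.

(** Geometric convergence on a small ball also bounds the whole sequence there, which is what
    [differentiable_limit] requires. *)
Lemma hol_limit (V : normedModType R[i]) (D : set V) (F : nat -> V -> R[i]) :
  (forall k x, D x -> differentiable (F k) x) ->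
  (forall x, D x -> exists r C, [/\ 0 < r, forall y, rn (y - x) < r -> D y,
     forall y, rn (y - x) < r -> rn (F 0 y) <= C &
     forall k y, rn (y - x) < r -> rn (F k.+1 y - F k y) <= C * 2^-1 ^+ k]) ->
  exists f : V -> R[i], forall x, D x ->
    [/\ differentiable f x, F k x @[k --> \oo] --> f x &
        forall v, 'd (F k) x v @[k --> \oo] --> 'd f x v].
Proof.
move=> dF HF.
have cF x : exists l : R[i], D x -> F k x @[k --> \oo] --> l.
  have [Dx|nD] := pselect (D x); last by exists 0.
  have [r [C [r0 _ _ H]]] := HF x Dx.
  have [k|l Hl] := @geometric_cvg (fun k => F k x) C; first by apply: H; rewrite subrr rn0.
  by exists l.
have [f Hf] := choice cF; exists f => x Dx.
have [r [C [r0 HD H0 H]]] := HF x Dx.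
have [|||d1 d2] := @differentiable_limit R V F f x (3 * C) r r0.
- by move=> k y yr; apply: dF; exact: HD.
- move=> k y yr; have := @geometric_bound (fun k => F k y) C (fun k => H k y yr) 0 k.
  rewrite add0n expr0 mulr1 => h1; have h0 := H0 y yr.
  by rewrite -(subrK (F 0 y) (F k y)) (le_trans (rnD _ _))//; lra.
- by move=> y yr; apply: Hf; exact: HD.
by split => //; exact: Hf.
Qed.

End GeometricLimit.

Section Slices.
Context {R : realType}.

Lemma differentiable_bounded_linear (V W : normedModType R[i]) (f : V -> W) (K : R) (x : V) :
  linear f -> (forall v, rn (f v) <= K * rn v) -> differentiable f x.
Proof.
move=> /linear_pack[L Lf] fK; have LK v : rn (L v) <= K * rn v by rewrite Lf.
have [|//] := differentiable_from_eps (f := f) (x := x) LK.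
move=> e e0; exists 1 => // h _.
by rewrite -Lf linearD [L x + L h]addrC addrK subrr rn0 mulr_ge0 ?rn_ge0// ltW.
Qed.

Lemma differentiable_fst (V W : normedModType R[i]) (x : (V * W)%type) :
  differentiable (fun x : (V * W)%type => x.1) x.
Proof.
by apply: (@differentiable_bounded_linear _ _ _ 1) => // v; rewrite mul1r rn_pairE le_max lexx.
Qed.

Lemma differentiable_snd (V W : normedModType R[i]) (x : (V * W)%type) :
  differentiable (fun x : (V * W)%type => x.2) x.
Proof.
by apply: (@differentiable_bounded_linear _ _ _ 1) => // v; rewrite mul1r rn_pairE le_max lexx orbT.
Qed.

Lemma slice_cder (T : normedModType R[i]) (f : (R[i] * T)%type -> R[i]) (w : R[i]) (o : T) :
  differentiable f (w, o) -> cder (fun z => f (z, o)) w ('d f (w, o) (1, 0)).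
Proof.
move=> /differentiable_eps H e /H[d d0 Hd]; exists d => // z zd.
have zE : (z - w, 0 : T) = (z - w) *: ((1, 0) : (R[i] * T)%type).
  have -> : (z - w) *: ((1, 0) : (R[i] * T)%type) = ((z - w) *: (1 : R[i]), (z - w) *: (0 : T)) by [].
  by rewrite scaler0 [_ *: 1]mulr1.
have rnz : rn ((z - w, 0) : (R[i] * T)%type) = rn (z - w).
  by rewrite rn_pairE/= rn0 max_l ?rn_ge0.
have := Hd (z - w, 0); rewrite rnz => /(_ zd).
rewrite (_ : (w, o) + _ = (z, o)); last by rewrite /GRing.add/=/add_pair/= addr0 addrC subrK.
by rewrite {1}zE diffZE (mulrC (z - w)).
Qed.

Lemma slice_differentiable (T : normedModType R[i]) (f : (R[i] * T)%type -> R[i]) (w : R[i]) (o : T) :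
  differentiable f (w, o) -> differentiable (fun z => f (z, o)) w.
Proof. by move=> /slice_cder/cder_differentiable[]. Qed.

Lemma cder_unique (f : R[i] -> R[i]) (w a b : R[i]) : cder f w a -> cder f w b -> a = b.
Proof.
move=> /cder_differentiable[_ Ha] /cder_differentiable[_ Hb].
by rewrite -(@derive_val _ _ _ _ _ _ _ Ha) -(@derive_val _ _ _ _ _ _ _ Hb).
Qed.

Lemma cder_rder (f : R[i] -> R[i]) (x v a : R[i]) (t : R) : cder f (x + t%:C * v) a ->
  rder (fun t => f (x + t%:C * v)) t (v * a).
Proof.
move=> Hf e e0; have v0 : 0 < rn v + 1 by rewrite ltr_wpDl ?rn_ge0.
have [|d d0 Hd] := Hf (e / (rn v + 1)); first by rewrite divr_gt0.
exists (d / (rn v + 1)); first by rewrite divr_gt0.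
move=> h; rewrite ltr_pdivlMr// => hd.
have hv : `|h| * rn v <= `|h| * (rn v + 1) by rewrite ler_wpM2l// lerDl.
have E : x + (t + h)%:C * v - (x + t%:C * v) = h%:C * v by rewrite rcD; ring.
have := Hd (x + (t + h)%:C * v); rewrite E rnM rnR => /(_ (le_lt_trans hv hd)).
rewrite (_ : h%:C * (v * a) = a * (h%:C * v)); last by ring.
move=> /le_trans; apply.
by rewrite mulrAC -mulrA ler_wpM2l ?(ltW e0)// ler_pdivrMr.
Qed.

Lemma cderM (f g : R[i] -> R[i]) (w a b : R[i]) :
  cder f w a -> cder g w b -> cder (fun z => f z * g z) w (a * g w + f w * b).
Proof.
move=> /cder_differentiable[_ Ha] /cder_differentiable[_ Hb].
apply: derivable_cder; have H := is_deriveM Ha Hb; apply: is_derive_eq H _.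
by rewrite /GRing.scale/= addrC mulrC.
Qed.

Lemma cderD (f g : R[i] -> R[i]) (w a b : R[i]) :
  cder f w a -> cder g w b -> cder (fun z => f z + g z) w (a + b).
Proof.
move=> /cder_differentiable[_ Ha] /cder_differentiable[_ Hb].
by apply: derivable_cder; exact: is_deriveD Ha Hb.
Qed.

Lemma cder_cst (c w : R[i]) : cder (fun=> c) w 0.
Proof. by move=> e e0; exists 1 => // z _; rewrite subrr mul0r subrr rn0 mulr_ge0 ?rn_ge0// ltW. Qed.

Lemma cder_sum (n : nat) (f : 'I_n -> R[i] -> R[i]) (w : R[i]) (a : 'I_n -> R[i]) :
  (forall i, cder (f i) w (a i)) -> cder (fun z => \sum_i f i z) w (\sum_i a i).
Proof.
elim: n f a => [|n IH] f a H.
  by rewrite big_ord0 (_ : (fun _ => _) = fun=> 0); [exact: cder_cst|apply/funext => z; rewrite big_ord0].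
rewrite big_ord_recr (_ : (fun _ => _) = fun z => \sum_(i < n) f (widen_ord (leqnSn n) i) z + f ord_max z).
  by apply: cderD (H _); exact: IH.
by apply/funext => z; rewrite big_ord_recr.
Qed.

Lemma cder_mulmx (m n p : nat) (A : R[i] -> 'M[R[i]]_(m, n)) (B : R[i] -> 'M[R[i]]_(n, p))
    (A' : 'M[R[i]]_(m, n)) (B' : 'M[R[i]]_(n, p)) (w : R[i]) :
  (forall i j, cder (fun z => A z i j) w (A' i j)) ->
  (forall i j, cder (fun z => B z i j) w (B' i j)) ->
  forall i j, cder (fun z => (A z *m B z) i j) w ((A' *m B w + A w *m B') i j).
Proof.
move=> dA dB i j.
rewrite (_ : (fun z => _) = fun z => \sum_k A z i k * B z k j); last first.
  by apply/funext => z; rewrite mxE.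
rewrite mxE [X in X + _]mxE [X in _ + X]mxE -big_split/=.
by apply: cder_sum => k; apply: cderM; [exact: dA|exact: dB].
Qed.

Lemma cder_add_cst (f g : R[i] -> R[i]) (c w a : R[i]) :
  (forall z, f z = c + g z) -> cder g w a -> cder f w a.
Proof.
move=> fg Hg e /Hg[d d0 Hd]; exists d => // z zd.
by rewrite !fg (_ : c + g z - _ = g z - g w); [exact: Hd|ring].
Qed.

Lemma is_derive_scaled_exp (a b x : R) :
  is_derive x (1 : R) (fun s => b * expR (a * s)) (b * (expR (a * x) * a)).
Proof.
have dl : is_derive x (1 : R) (fun s => a * s) a.
  have := @is_deriveZ _ _ _ id a x (1 : R) 1 (is_derive_id _ _).
  by move=> H; apply: is_derive_eq H _; rewrite /GRing.scale/= mulr1.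
have := @is_deriveZ _ _ _ _ b x (1 : R) _ (is_derive_real_comp (is_derive_expR (a * x)) dl).
by [].
Qed.

(** Increments to the left determine a derivative at [1]. This is used where two functions are known
    to agree on [[0, 1]] only. *)
Lemma rder_left_unique (f g : R -> R[i]) (l m : R[i]) : rder f 1 l -> rder g 1 m ->
  (forall t, 0 <= t <= 1 -> f t = g t) -> l = m.
Proof.
move=> fl gm fg; apply/eqP; rewrite -subr_eq0 -rn_eq0 eq_le rn_ge0 andbT.
apply/ler_addgt0Pr => e e0; rewrite add0r.
have e20 : 0 < e / 2 by rewrite divr_gt0.
have [d1 d10 H1] := fl _ e20; have [d2 d20 H2] := gm _ e20.
pose h := Num.min (Num.min d1 d2) 1 / 2.
have [h1 h2 h3] : [/\ h < d1, h < d2 & h < 1].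
  have m0 : 0 < Num.min (Num.min d1 d2) 1 by rewrite !lt_min d10 d20 ltr01.
  have hm : h < Num.min (Num.min d1 d2) 1 by rewrite /h; lra.
  by move: hm; rewrite !lt_min => /andP[/andP[]].
have h0 : 0 < h by rewrite divr_gt0// !lt_min d10 d20 ltr01.
have nh : `|- h| = h by rewrite normrN gtr0_norm.
have := H1 (- h); have := H2 (- h); rewrite nh => /(_ h2) k2 /(_ h1) k1.
rewrite -(fg 1) ?ler01 ?lexx// in k2.
rewrite -(fg (1 - h)) in k2; last by apply/andP; split; lra.
rewrite -(ler_pM2l h0) -[X in X * rn _](gtr0_norm h0) -rnR -rnM.
rewrite (_ : h%:C * (l - m) = (f (1 - h) - f 1 - (- h)%:C * l) - (f (1 - h) - f 1 - (- h)%:C * m));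
    last by rewrite rcN; ring.
by apply: le_trans (rnB _ _) _; lra.
Qed.

End Slices.

(** * Primitives and Picard iteration on star-shaped domains *)

Section Primitive.
Context {R : realType} {T : normedModType R[i]}.
Variables (P : set R[i]) (O : set T) (w0 : R[i]).
Hypothesis P_open : forall w, P w -> exists2 d : R, 0 < d & forall y, rn (y - w) < d -> P y.
Hypothesis O_open : forall o, O o -> exists2 d : R, 0 < d & forall y, rn (y - o) < d -> O y.
Hypothesis P_star : forall w (t : R), P w -> 0 <= t <= 1 -> P (w0 + t%:C * (w - w0)).
Hypothesis P_w0 : P w0.

Lemma product_open w o : P w -> O o -> exists2 d : R, 0 < d &
  forall y : (R[i] * T)%type, rn (y - (w, o)) < d -> P y.1 /\ O y.2.
Proof.
move=> /P_open[d1 d10 H1] /O_open[d2 d20 H2]; exists (Num.min d1 d2); first by rewrite lt_min d10.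
move=> y; rewrite rn_pairE gt_max !lt_min => /andP[/andP[? ?] /andP[? ?]].
by split; [exact: H1|exact: H2].
Qed.

Lemma segment_bound (f : (R[i] * T)%type -> R[i]) (w : R[i]) (o : T) :
  (forall t, 0 <= t <= 1 -> differentiable f (w0 + t%:C * (w - w0), o)) ->
  exists m, 0 < m /\ forall t, 0 <= t <= 1 -> forall y : (R[i] * T)%type,
    rn (y - (w, o)) < m -> rn (f (w0 + t%:C * (y.1 - w0), y.2)) <= m^-1.
Proof.
move=> df.
apply: (@uniform01 R (fun t m => forall y : (R[i] * T)%type,
    rn (y - (w, o)) < m -> rn (f (w0 + t%:C * (y.1 - w0), y.2)) <= m^-1)).
  move=> t m m' m'0 mm' H y ym; apply: le_trans (H y (lt_le_trans ym mm')) _.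
  by rewrite lef_pV2 ?posrE// (lt_le_trans m'0).
move=> t t01; set p := (w0 + t%:C * (w - w0), o).
have /continuous_rn/(_ 1 ltr01)[d d0 Hd] := differentiable_continuous (df t t01).
have W0 : 0 < rn (w - w0) + 1 by rewrite ltr_wpDl ?rn_ge0.
have f0 : 0 < rn (f p) + 1 by rewrite ltr_wpDl ?rn_ge0.
exists (Num.min (d / 2 / (rn (w - w0) + 1)) (Num.min (d / 2) (rn (f p) + 1)^-1)); split.
  by rewrite !lt_min !divr_gt0// invr_gt0.
move=> t' t'01; rewrite lt_min ltr_pdivlMr// => /andP[tt _] y.
rewrite !lt_min => /andP[_ /andP[yd _]].
apply: (@le_trans _ _ (rn (f p) + 1)); last first.
  rewrite -[X in X <= _]invrK lef_pV2 ?posrE ?invr_gt0//; last by rewrite !lt_min !divr_gt0// invr_gt0.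
  by rewrite !ge_min lexx !orbT.
rewrite -(subrK (f p) (f _)) (le_trans (rnD _ _))// addrC lerD2l ltW//; apply: Hd.
move: yd; rewrite !rn_pairE !gt_max/= => /andP[y1 y2]; apply/andP; split; last first.
  by apply: lt_trans y2 _; rewrite ltr_pdivrMr// ltr_pMr// ltrDl.
rewrite (_ : _ - _ = t'%:C * (y.1 - w) + (t' - t)%:C * (w - w0)); last first.
  by rewrite rcD rcN; ring.
apply: le_lt_trans (rnD _ _) _; rewrite !rnM !rnR.
have /andP[t'0 t'1] := t'01; rewrite ger0_norm//.
have h1 : t' * rn (y.1 - w) <= rn (y.1 - w) by rewrite ler_piMl ?rn_ge0.
have h2 : `|t' - t| * rn (w - w0) <= `|t' - t| * (rn (w - w0) + 1).
  by rewrite ler_wpM2l// lerDl.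
by lra.
Qed.

Lemma segment_cont01 (f : (R[i] * T)%type -> R[i]) (w : R[i]) (o : T) :
  (forall w o, P w -> O o -> differentiable f (w, o)) -> P w -> O o ->
  cont01 (fun t => f (w0 + t%:C * (w - w0), o)).
Proof.
move=> df Pw Oo.
apply: (@cont01_comp R (fun z => f (z, o)) (fun t => w0 + t%:C * (w - w0))).
  apply: (@rder_cont01 _ _ (fun=> 0 + (w - w0) * 1)) => t.
  rewrite (_ : (fun t => _) = fun t => w0 + (w - w0) * t%:C); last by apply/funext => x; rewrite mulrC.
  exact: rder_lin (rder_cst _ _) (rder_id _).
move=> t t01; apply: differentiable_continuous; apply: slice_differentiable.
by apply: df => //; exact: P_star.
Qed.

Definition primitive (f : (R[i] * T)%type -> R[i]) (x : (R[i] * T)%type) : R[i] :=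
  (x.1 - w0) * I01 (fun t => f (w0 + t%:C * (x.1 - w0), x.2)).

Lemma segment_I01_differentiable (f : (R[i] * T)%type -> R[i]) (w : R[i]) (o : T) :
  (forall w o, P w -> O o -> differentiable f (w, o)) -> P w -> O o ->
  differentiable (fun x : (R[i] * T)%type => I01 (fun t => f (w0 + t%:C * (x.1 - w0), x.2))) (w, o).
Proof.
move=> df Pw Oo.
have [d d0 Hd] := product_open Pw Oo.
have [|m [m0 Hm]] := @segment_bound f w o.
  by move=> t t01; apply: df => //; exact: P_star.
apply: (@differentiable_I01 R _ (fun t (x : (R[i] * T)%type) => f (w0 + t%:C * (x.1 - w0), x.2))
  (w, o) m^-1 (Num.min d m)).
- by rewrite lt_min d0.
- move=> t [y1 y2] t01; rewrite lt_min => /andP[/Hd[/= Py Oy] _].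
  apply: (@differentiable_comp _ _ _ _ (fun x : (R[i] * T)%type => (w0 + t%:C * (x.1 - w0), x.2)) f).
    apply: differentiable_pair; last exact: differentiable_snd.
    by apply: holD; [exact: hol_cst|apply: holZ; apply: holB; [exact: differentiable_fst|exact: hol_cst]].
  by apply: df => //; exact: P_star.
- by move=> t y t01; rewrite lt_min => /andP[_]; exact: Hm.
- by move=> [y1 y2]; rewrite lt_min => /andP[/Hd[/= Py Oy] _]; exact: segment_cont01.
Qed.

Lemma primitive_differentiable (f : (R[i] * T)%type -> R[i]) (w : R[i]) (o : T) :
  (forall w o, P w -> O o -> differentiable f (w, o)) -> P w -> O o ->
  differentiable (primitive f) (w, o).
Proof.
move=> df Pw Oo; apply: holM; last exact: segment_I01_differentiable.
by apply: holB; [exact: differentiable_fst|exact: hol_cst].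
Qed.

Lemma primitive_ray (f : (R[i] * T)%type -> R[i]) (w : R[i]) (o : T) (Q : R -> R[i]) :
  prim01 (fun s => f (w0 + s%:C * (w - w0), o)) Q -> forall t : R, 0 <= t <= 1 ->
  primitive f (w0 + t%:C * (w - w0), o) = (w - w0) * (Q t - Q 0).
Proof.
move=> fQ t t01; rewrite /primitive/=; set v := w - w0.
have -> : w0 + t%:C * v - w0 = t%:C * v by rewrite addrAC subrr add0r.
have [->|t0] := eqVneq t 0; first by rewrite mul0r mul0r subrr mulr0.
have tC0 : t%:C != 0 :> R[i] by rewrite eq_complex/= eqxx andbT.
have QE : prim01 (fun s => f (w0 + s%:C * (t%:C * v), o)) (fun s => 0 + t%:C^-1 * Q (t * s + 0)).
  move=> s s01.
  have -> : f (w0 + s%:C * (t%:C * v), o) = 0 + t%:C^-1 * (t%:C * f (w0 + (t * s + 0)%:C * v, o)).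
    by rewrite add0r [RHS]mulrA mulVf// mul1r addr0 rcM mulrA (mulrC s%:C).
  apply: rder_lin; first exact: rder_cst.
  by apply: rder_affine; apply: fQ; rewrite addr0; nra.
rewrite (I01E QE) mulr1 mulr0 !addr0 !add0r -mulrBr (mulrC t%:C) -mulrA.
by rewrite [t%:C * _]mulrA mulfV// mul1r.
Qed.

(** The primitive is already holomorphic as a parameter integral, so its derivative may be computed
    in a single direction; along the ray from [w0] it is a primitive in one real variable. At
    [w = w0] there is no ray, and continuity of the mean of [f] over the segment is used. *)
Lemma primitive_cder (f : (R[i] * T)%type -> R[i]) (w : R[i]) (o : T) :
  (forall w o, P w -> O o -> differentiable f (w, o)) -> P w -> O o ->
  cder (fun z => primitive f (z, o)) w (f (w, o)).
Proof.
move=> df Pw Oo.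
have [->|ww0] := eqVneq w w0.
  move=> e e0.
  have := differentiable_continuous (slice_differentiable (segment_I01_differentiable df P_w0 Oo)).
  move=> /continuous_rn/(_ e e0)[d d0 Hd]; exists d => // z zd.
  rewrite /primitive/= subrr mul0r subr0.
  have := Hd z zd; rewrite /= subrr.
  rewrite [in X in rn (_ - X)](_ : (fun t : R => _) = fun=> f (w0, o)); last first.
    by apply/funext => t; rewrite mulr0 addr0.
  by rewrite I01_cst mulrC -mulrBl rnM => H; rewrite ler_wpM2r ?rn_ge0// ltW.
have dp := slice_differentiable (primitive_differentiable df Pw Oo).
suff E : 'd (fun z => primitive f (z, o)) w 1 = f (w, o) by rewrite -E; exact: differentiable_cder.
have [Q fQ] := prim01_ex (segment_cont01 df Pw Oo).
have dr : rder (fun t => primitive f (w0 + t%:C *: (w - w0), o)) 1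
    ('d (fun z => primitive f (z, o)) (w0 + 1%:C *: (w - w0)) (w - w0)).
  apply: (@differentiable_rder R _ (fun z => primitive f (z, o))).
  by rewrite scale1r addrC subrK.
have dQ : rder (fun t => - ((w - w0) * Q 0) + (w - w0) * Q t) 1 (0 + (w - w0) * f (w, o)).
  apply: rder_lin; first exact: rder_cst.
  have := fQ 1; rewrite mul1r [w0 + _]addrC subrK; apply.
  by rewrite ler01 lexx.
have ww : w - w0 != 0 by rewrite subr_eq0.
have := rder_left_unique dr dQ; rewrite scale1r [w0 + _]addrC subrK add0r.
have -> : 'd (fun z => primitive f (z, o)) w (w - w0) = (w - w0) * 'd (fun z => primitive f (z, o)) w 1.
  by rewrite -[w - w0 in LHS]mulr1 diffZE.
move=> H; apply: (mulfI ww); apply: H => t t01.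
by rewrite (primitive_ray fQ)// mulrBr addrC.
Qed.

Lemma cder_zero_segment (f : R[i] -> R[i]) (w : R[i]) : (forall z, P z -> cder f z 0) -> P w ->
  f w = f w0.
Proof.
move=> df Pw.
have dr (t : R) : 0 <= t <= 1 -> rder (fun t => f (w0 + t%:C * (w - w0))) t 0.
  by move=> t01; rewrite -(mulr0 (w - w0)); apply: cder_rder; apply: df; exact: P_star.
have := @rder_mvi_cst R _ (fun=> 0) 0 0 1 ler01 dr; rewrite rn0 mulr0 mul0r.
rewrite !mul1r mul0r addr0 [w0 + _]addrC subrK => H.
apply/eqP; rewrite -subr_eq0 -rn_eq0 eq_le rn_ge0 andbT; exact: H.
Qed.

(** Serves both for [Psi Phi = 1] and for comparing a solution in a half-plane with [Phi]. *)
Lemma product_along_segment (n : nat) (A B C : R[i] -> 'M[R[i]]_n) (w : R[i]) : P w ->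
  (forall i j z, P z -> cder (fun z => B z i j) z (- (B z *m A z) i j)) ->
  (forall i j z, P z -> cder (fun z => C z i j) z ((A z *m C z) i j)) ->
  B w *m C w = B w0 *m C w0.
Proof.
move=> Pw dB dC; apply/matrixP => i j.
apply: (@cder_zero_segment (fun z => (B z *m C z) i j)) Pw => z Pz.
have := @cder_mulmx _ _ _ _ B C (- (B z *m A z)) (A z *m C z) z _ _ i j.
rewrite mulNmx -mulmxA addNr mxE; apply=> i' j'; last exact: dC.
by rewrite mxE; exact: dB.
Qed.

Section Picard.
Context {n : nat}.
Variable A : (R[i] * T)%type -> 'M[R[i]]_n.
Hypothesis A_diff : forall i j w o, P w -> O o -> differentiable (fun x => A x i j) (w, o).

Fixpoint picard (k : nat) (x : (R[i] * T)%type) : 'M[R[i]]_n :=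
  if k is k'.+1 then
    1%:M + \matrix_(i, j) primitive (fun y => (A y *m picard k' y) i j) x
  else 1%:M.

Lemma picardS k x i j : picard k.+1 x i j =
  (1%:M : 'M[R[i]]_n) i j + primitive (fun y => (A y *m picard k y) i j) x.
Proof. by rewrite [LHS]mxE [X in _ + X]mxE. Qed.

Lemma picard_differentiable k i j w o : P w -> O o -> differentiable (fun x => picard k x i j) (w, o).
Proof.
elim: k i j w o => [|k IH] i j w o Pw Oo; first exact: hol_cst.
rewrite (_ : (fun _ => _) = fun x => (1%:M : 'M[R[i]]_n) i j +
    primitive (fun y => (A y *m picard k y) i j) x); last by apply/funext => x; exact: picardS.
apply: holD; first exact: hol_cst.
apply: primitive_differentiable => // w' o' Pw' Oo'; apply: hol_mulmx => i' j'; [exact: A_diff|exact: IH].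
Qed.

Let Apicard_diff k i j w o : P w -> O o ->
  differentiable (fun y => (A y *m picard k y) i j) (w, o).
Proof.
by move=> Pw Oo; apply: hol_mulmx => i' j'; [exact: A_diff|exact: picard_differentiable].
Qed.

Lemma picard_cder k i j w o : P w -> O o ->
  cder (fun z => picard k.+1 (z, o) i j) w ((A (w, o) *m picard k (w, o)) i j).
Proof.
move=> Pw Oo.
apply: (cder_add_cst (c := (1%:M : 'M[R[i]]_n) i j)
  (g := fun z => primitive (fun y => (A y *m picard k y) i j) (z, o))).
  by move=> z; exact: picardS.
exact: primitive_cder (fun w o Pw Oo => Apicard_diff k i j Pw Oo) Pw Oo.
Qed.

Lemma picard_w0 k o : picard k (w0, o) = 1%:M.
Proof.
case: k => [//|k] /=; apply/matrixP => i j; rewrite !mxE /primitive/= subrr mul0r.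
exact: addr0.
Qed.

Lemma A_segment_bound w o : P w -> O o -> exists m, 0 < m /\ forall t, 0 <= t <= 1 ->
  forall y : (R[i] * T)%type, rn (y - (w, o)) < m ->
  forall i j, rn (A (w0 + t%:C * (y.1 - w0), y.2) i j) <= m^-1.
Proof.
move=> Pw Oo.
have [||m [m0 Hm]] := @finite_pos_min R ('I_n * 'I_n)%type (fun p m => 0 < m -> forall t, 0 <= t <= 1 ->
  forall y : (R[i] * T)%type, rn (y - (w, o)) < m ->
  rn (A (w0 + t%:C * (y.1 - w0), y.2) p.1 p.2) <= m^-1).
- move=> p m m' mm' H m'0 t t01 y ym.
  have m0 : 0 < m by exact: lt_le_trans mm'.
  by apply: le_trans (H m0 t t01 y (lt_le_trans ym mm')) _; rewrite lef_pV2.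
- move=> [i j]; have [|m [m0 Hm]] := @segment_bound (fun x => A x i j) w o.
    by move=> t t01; apply: A_diff => //; exact: P_star.
  by exists m.
by exists m; split => // t t01 y ym i j; exact: (Hm (i, j)).
Qed.

(** The weight [e^(L t)] makes the iteration contract by [1/2] on the whole segment, whatever its
    length. [I01_major] costs a factor [2], so [c / L] must be at most a quarter of [2^-k]; this
    explains the [4] in [L], while [n + 1] keeps [L] positive for [n = 0]. *)
Lemma picard_contraction w o (M V : R) : P w -> O o -> 0 < M -> 0 < V -> rn (w - w0) <= V ->
  (forall t, 0 <= t <= 1 -> forall i j, rn (A (w0 + t%:C * (w - w0), o) i j) <= M) ->
  let L := 4 * V * (n%:R + 1) * M in
  forall k t, 0 <= t <= 1 -> forall i j,
    rn ((picard k.+1 (w0 + t%:C * (w - w0), o) - picard k (w0 + t%:C * (w - w0), o)) i j)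
    <= 2^-1 ^+ k.+1 * expR (L * t).
Proof.
move=> Pw Oo M0 V0 wV AM L.
have n1 : 0 < n%:R + 1 :> R by rewrite ltr_wpDl.
have L0 : 0 < L by rewrite !mulr_gt0.
pose D k (x : (R[i] * T)%type) := if k is k'.+1 then picard k x - picard k' x else 1%:M.
have DD k i j w' o' : P w' -> O o' -> differentiable (fun x => D k x i j) (w', o').
  move=> Pw' Oo'; case: k => [|k]; first exact: hol_cst.
  rewrite (_ : (fun _ => _) = fun x => picard k.+1 x i j - picard k x i j).
    by apply: holB; exact: picard_differentiable.
  by apply/funext => x; rewrite /D !mxE.
have AD k i j w' o' : P w' -> O o' -> differentiable (fun x => (A x *m D k x) i j) (w', o').
  by move=> Pw' Oo'; apply: hol_mulmx => i' j'; [exact: A_diff|exact: DD].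
have Drec k i j w' : P w' -> D k.+1 (w', o) i j = primitive (fun x => (A x *m D k x) i j) (w', o).
  move=> Pw'; case: k => [|k]; first by rewrite /D /= !mxE addrAC subrr add0r.
  have -> : D k.+2 (w', o) i j = primitive (fun x => (A x *m picard k.+1 x) i j) (w', o) -
      primitive (fun x => (A x *m picard k x) i j) (w', o).
    rewrite /D mxE [X in _ + X]mxE !picardS; set p := primitive _ _; set q := primitive _ _.
    by ring.
  rewrite /primitive -mulrBr -I01B; last 2 first.
  - by apply: (segment_cont01 (f := fun x => (A x *m picard k.+1 x) i j)) => // *; exact: Apicard_diff.
  - by apply: (segment_cont01 (f := fun x => (A x *m picard k x) i j)) => // *; exact: Apicard_diff.
  congr (_ * _); apply: I01_eq => [|t t01].
    apply: cont01B.
    + by apply: (segment_cont01 (f := fun x => (A x *m picard k.+1 x) i j)) => // *; exact: Apicard_diff.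
    + by apply: (segment_cont01 (f := fun x => (A x *m picard k x) i j)) => // *; exact: Apicard_diff.
  by rewrite /D mulmxBr [RHS]mxE [X in _ = _ + X]mxE.
have key k t : 0 <= t <= 1 -> forall i j, rn (D k (w0 + t%:C * (w - w0), o) i j) <=
    2^-1 ^+ k * expR (L * t).
  elim: k t => [|k IH] t t01 i j.
    rewrite /D mul1r (@le_trans _ _ 1)//.
      by rewrite !mxE; case: (i == j); rewrite ?rn1// rn0.
    by rewrite -expR0 ler_expR mulr_ge0// ?(ltW L0)//; case/andP: t01.
  rewrite Drec; last exact: P_star.
  rewrite /primitive/= addrAC subrr add0r.
  set v := w - w0 in wV AM IH *.
  pose f s := t%:C * v * (A (w0 + s%:C * (t%:C * v), o) *m D k (w0 + s%:C * (t%:C * v), o)) i j.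
  have Ptv : P (w0 + t%:C * v) by exact: P_star.
  have fc : cont01 (fun s => (A (w0 + s%:C * (t%:C * v), o) *m D k (w0 + s%:C * (t%:C * v), o)) i j).
    have := segment_cont01 (f := fun x => (A x *m D k x) i j) (fun w o Pw Oo => AD k i j w o Pw Oo) Ptv Oo.
    by rewrite addrAC subrr add0r.
  rewrite -(I01Z _ fc) -/f.
  pose c := V * (n%:R * M) * 2^-1 ^+ k.
  have c0 : 0 <= c by rewrite !mulr_ge0 ?exprn_ge0// ltW.
  pose G s := c / L * expR (L * t * s).
  have Gd s : is_derive s (1 : R) G (t * (c * expR (L * t * s))).
    have H := is_derive_scaled_exp (L * t) (c / L) s; apply: is_derive_eq H _.
    rewrite (mulrC (expR _)) mulrA (mulrA (c / L)) (divfK (lt0r_neq0 L0)); ring.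
  have /andP[t0 t1] := t01.
  have fle s : 0 <= s <= 1 -> rn (f s) <= t * (c * expR (L * t * s)).
    move=> /andP[s0 s1]; have st01 : 0 <= s * t <= 1 by apply/andP; split; nra.
    rewrite /f (mulrA s%:C) -rcM -mulrA rnM rnR ger0_norm// ler_wpM2l// rnM.
    have h1 := rn_mulmx (AM _ st01) (IH _ st01) i j.
    apply: (le_trans (ler_pM (rn_ge0 _) (rn_ge0 _) wV h1)).
    by rewrite /c (mulrC s) !mulrA.
  apply: (le_trans (I01_major (cont01Z _ fc) (fun s _ => Gd s) fle)).
  rewrite /G mulr1 mulr0 expR0.
  have cL : 4 * c <= L * 2^-1 ^+ k.
    rewrite /c /L mulrA; apply: ler_wpM2r; first by rewrite exprn_ge0.
    rewrite (_ : 4 * V * (n%:R + 1) * M = 4 * (V * (n%:R * M)) + 4 * (V * M)); last by ring.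
    by rewrite lerDl !mulr_ge0// ltW.
  have ccL : 4 * (c / L) <= 2^-1 ^+ k by rewrite mulrA ler_pdivrMr// [_ * L]mulrC.
  have cL0 : 0 <= c / L by rewrite divr_ge0// ltW.
  have := expR_gt0 (L * t); rewrite exprS; set E := expR _; set h := 2^-1 ^+ k in ccL *.
  by nra.
by move=> k t t01 i j; exact: (key k.+1).
Qed.

Lemma linear_ode_exists : exists Phi : (R[i] * T)%type -> 'M[R[i]]_n,
  (forall o, O o -> Phi (w0, o) = 1%:M) /\
  forall i j w o, P w -> O o -> differentiable (fun x => Phi x i j) (w, o) /\
    cder (fun z => Phi (z, o) i j) w ((A (w, o) *m Phi (w, o)) i j).
Proof.
pose D := [set x : (R[i] * T)%type | P x.1 /\ O x.2].
have H (p : 'I_n * 'I_n) : exists f : (R[i] * T)%type -> R[i], forall x, D x ->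
    [/\ differentiable f x, picard k x p.1 p.2 @[k --> \oo] --> f x &
        forall v, 'd (fun x => picard k x p.1 p.2) x v @[k --> \oo] --> 'd f x v].
  case: p => i j /=; apply: (@hol_limit R _ D (fun k x => picard k x i j)).
    by move=> k [w o] [Pw Oo]; exact: picard_differentiable.
  move=> [w o] [/= Pw Oo].
  have [d d0 Hd] := product_open Pw Oo.
  have [m [m0 Hm]] := A_segment_bound Pw Oo.
  pose V := rn (w - w0) + d.
  have V0 : 0 < V by rewrite ltr_wpDl ?rn_ge0.
  pose L := 4 * V * (n%:R + 1) * m^-1.
  exists (Num.min d m), (1 + expR L); split.
  - by rewrite lt_min d0.
  - by move=> y; rewrite lt_min => /andP[/Hd].
  - move=> y _; rewrite /= !mxE (@le_trans _ _ 1) ?lerDl ?expR_ge0//.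
    by case: (i == j); rewrite ?rn1// rn0.
  move=> k [z q]; rewrite lt_min => /andP[/[dup] zd /Hd[/= Pz Oq] zm].
  have zV : rn (z - w0) <= V.
    rewrite (_ : z - w0 = (z - w) + (w - w0)); last by ring.
    rewrite (le_trans (rnD _ _))// /V addrC lerD2l.
    by move: zd; rewrite rn_pairE gt_max => /andP[/ltW].
  have := picard_contraction Pz Oq (M := m^-1) (V := V) _ V0 zV _ k (t := 1) _ i j.
  rewrite invr_gt0 m0 ler01 lexx mul1r [w0 + _]addrC subrK -/L mulr1 => /(_ erefl) H.
  have := H (fun t t01 i j => Hm t t01 (z, q) zm i j) erefl.
  rewrite !mxE => /le_trans; apply.
  rewrite exprS -mulrA mulrCA mulrC; apply: ler_wpM2r; first by rewrite exprn_ge0.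
  by have := expR_gt0 L; lra.
have [Phi HPhi] := choice H.
exists (fun x => \matrix_(i, j) Phi (i, j) x); split.
  move=> o Oo; apply/matrixP => i j; rewrite mxE.
  have [_ H2 _] := HPhi (i, j) (w0, o) (conj P_w0 Oo).
  apply: (rn_lim_eq H2) => e e0; apply: nearW => k.
  by rewrite picard_w0 subrr rn0 ltW.
move=> i j w o Pw Oo.
rewrite (_ : (fun x => _) = Phi (i, j)); last by apply/funext => x; rewrite mxE.
rewrite (_ : (fun z => _) = fun z => Phi (i, j) (z, o)); last by apply/funext => x; rewrite mxE.
have [d1 _ d3] := HPhi (i, j) (w, o) (conj Pw Oo).
split => //.
suff -> : (A (w, o) *m \matrix_(i0, j0) Phi (i0, j0) (w, o)) i j = 'd (Phi (i, j)) (w, o) (1, 0).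
  exact: slice_cder.
pose u k := 'd (fun x => picard k x i j) (w, o) (1, 0).
have hu : u k @[k --> \oo] --> 'd (Phi (i, j)) (w, o) (1, 0) := d3 (1, 0).
have h1 := cvg_succ hu.
have h2 : (A (w, o) *m picard k (w, o)) i j @[k --> \oo] -->
    (A (w, o) *m \matrix_(i0, j0) Phi (i0, j0) (w, o)) i j.
  rewrite mxE (_ : (fun k => _) = fun k => \sum_j0 A (w, o) i j0 * picard k (w, o) j0 j); last first.
    by apply/funext => k; rewrite mxE.
  apply: cvg_sum_ord => j0; apply: cvgMl_tmp; rewrite mxE.
  by have [_ c _] := HPhi (j0, j) (w, o) (conj Pw Oo).
(* The equation between consecutive iterates passes to the limit because their differentials
   converge along with them. *)
have E : (fun k => u k.+1) =
    fun k => (A (w, o) *m picard k (w, o)) i j.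
  apply/funext => k; apply: cder_unique (slice_cder _) (picard_cder _ _ _ Pw Oo).
  exact: picard_differentiable.
rewrite E in h1; exact: (cvg_unique _ h2 h1).
Qed.

End Picard.

(** [Psi] is the transpose of a solution of the adjoint system [X' = - A^T X], so [Psi Phi] is
    constant, equal to [1] at [w0]. The inverse of [Phi] thus comes with its holomorphy and its own
    differential equation. *)
Lemma fundamental_pair_exists (n : nat) (A : (R[i] * T)%type -> 'M[R[i]]_n) :
  (forall i j w o, P w -> O o -> differentiable (fun x => A x i j) (w, o)) ->
  exists Phi Psi : (R[i] * T)%type -> 'M[R[i]]_n, forall w o, P w -> O o ->
  [/\ forall i j, differentiable (fun x => Phi x i j) (w, o) /\
        cder (fun z => Phi (z, o) i j) w ((A (w, o) *m Phi (w, o)) i j),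
      forall i j, differentiable (fun x => Psi x i j) (w, o) /\
        cder (fun z => Psi (z, o) i j) w (- (Psi (w, o) *m A (w, o)) i j) &
      Psi (w, o) *m Phi (w, o) = 1%:M].
Proof.
move=> dA; have [Phi [Phi0 HPhi]] := linear_ode_exists dA.
have [|Psi [Psi0 HPsi]] := @linear_ode_exists n (fun x => - (A x)^T).
  move=> i j w o Pw Oo; rewrite (_ : (fun x => _) = fun x => - A x j i).
    by apply: holN; exact: dA.
  by apply/funext => x; rewrite !mxE.
have HPsiT i j w o : P w -> O o -> differentiable (fun x => (Psi x)^T i j) (w, o) /\
        cder (fun z => (Psi (z, o))^T i j) w (- ((Psi (w, o))^T *m A (w, o)) i j).
  move=> Pw Oo; have [h1 h2] := HPsi j i w o Pw Oo.
  rewrite (_ : (fun x => _) = fun x => Psi x j i); last by apply/funext => x; rewrite mxE.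
  rewrite (_ : (fun z => (Psi (z, o))^T i j) = fun z => Psi (z, o) j i); last by apply/funext => x;
      rewrite mxE.
  split => //; move: h2; rewrite mulNmx [X in cder _ _ X]mxE.
  by rewrite -[(A (w, o))^T *m _]trmxK trmx_mul trmxK [(_^T) j i]mxE.
exists Phi, (fun x => (Psi x)^T) => w o Pw Oo; split.
- by move=> i j; exact: HPhi.
- by move=> i j; exact: HPsiT.
rewrite (product_along_segment (B := fun z => (Psi (z, o))^T) (C := fun z => Phi (z, o)) (A := fun
    z => A (z, o)) Pw).
- by rewrite Psi0// Phi0// trmx1 mulmx1.
- by move=> i j z Pz; have [] := HPsiT i j z o Pz Oo.
by move=> i j z Pz; have [] := HPhi i j z o Pz Oo.
Qed.

End Primitive.

(** * The integral equation in a half-plane *)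

Section DecayingPrimitive.
Context {R : realType} {T : normedModType R[i]}.
Variables (B : R) (O : set T).
Hypothesis O_open : forall o, O o -> exists2 d : R, 0 < d & forall y, rn (y - o) < d -> O y.
(** [gm b o t] majorizes the perturbation at [b + i t], and [Gm b o] is a primitive of it on the
    vertical line [Re x = b], with values between [0] and [e0]. This is all that is retained of the
    [L^1] condition. *)
Variables (gm Gm : R -> T -> R -> R) (e0 : R).
Hypothesis gm_ge0 : forall b o t, 0 <= gm b o t.
Hypothesis Gm_der : forall b o t, B < b -> O o -> is_derive t (1 : R) (Gm b o) (gm b o t).
Hypothesis Gm_range : forall b o t, B < b -> O o -> 0 <= Gm b o t <= e0.

(** Serves in two coordinates: for the variable [x] of a rotated half-plane and, with [B = ln a],
    for [w = log z], where it is the domain [|z| > a]. *)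
Definition right_of : set R[i] := [set x | B < complex.Re x].

Lemma right_of_open w : right_of w -> exists2 d : R, 0 < d & forall y, rn (y - w) < d -> right_of y.
Proof.
rewrite /right_of/= => Bw; exists (complex.Re w - B); first by rewrite subr_gt0.
move=> y yw; have := le_lt_trans (rnRe _) yw; rewrite cReD cReN ltr_norml => /andP[h _] /=.
by lra.
Qed.

Lemma right_of_star w0 w (t : R) : right_of w0 -> right_of w -> 0 <= t <= 1 ->
  right_of (w0 + t%:C * (w - w0)).
Proof.
rewrite /right_of/= => B0 Bw /andP[t0 t1]; rewrite cReD Re_scale cReD cReN.
have h0 : 0 <= (1 - t) * (complex.Re w0 - B) by rewrite mulr_ge0 ?subr_ge0// ltW.
have h1 : 0 <= t * (complex.Re w - B) by rewrite mulr_ge0 ?subr_ge0// ltW.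
have [t2|t2] := leP t 2^-1.
  have : 0 < (2^-1 - t + 2^-1) * (complex.Re w0 - B) by rewrite mulr_gt0 ?subr_gt0//; lra.
  by lra.
have : 0 < t * (complex.Re w - B) by rewrite mulr_gt0 ?subr_gt0//; lra.
by lra.
Qed.

Section OneEntry.
Variables (s : bool) (p : (R[i] * T)%type -> R[i]).
Hypothesis p_diff : forall w o, right_of w -> O o -> differentiable p (w, o).

(** Direction of integration, up or down the vertical line, in which [Re p] does not decrease. *)
Let c : R[i] := (-1) ^+ s * 'i%C.

Hypothesis p_mono : forall x o (t : R), right_of x -> O o -> 0 <= t ->
  complex.Re (p (x, o)) <= complex.Re (p (x + t%:C * c, o)).

Definition dominated (h : (R[i] * T)%type -> R[i]) (K : R) : Prop :=
  [/\ 0 <= K, forall w o, right_of w -> O o -> differentiable h (w, o) &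
    forall w o, right_of w -> O o -> rn (h (w, o)) <= K * gm (complex.Re w) o (complex.Im w)].

Let base : R[i] := (B + 1)%:C.

Let base_right : right_of base.
Proof. by rewrite /right_of/= ltrDl. Qed.

Let Hfun (h : (R[i] * T)%type -> R[i]) x := cexp (- p x) * h x.
Let W h := primitive base (Hfun h).

Let c_lift (x : R[i]) (t : R) :
  complex.Re (x + t%:C * c) = complex.Re x /\ complex.Im (x + t%:C * c) = complex.Im x + (-1) ^+ s * t.
Proof.
rewrite /c; case: s; rewrite ?expr1 ?expr0 !ReImE/= !(mul0r, mulr0, oppr0, subr0, add0r, addr0,
    mulr1, mul1r, mulrN, mulNr).
  by split; ring.
by split; ring.
Qed.

Let c_right x t : right_of x -> right_of (x + t%:C * c).
Proof. by move=> Bx; rewrite /right_of/= (c_lift x t).1. Qed.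

Let rn_c : rn c = 1.
Proof.
rewrite /c rnM (_ : rn ((-1) ^+ s : R[i]) = 1) ?mul1r.
  by rewrite norm_sqr/= expr0n expr1n add0r sqrtr1.
by case: s; rewrite ?expr1 ?expr0 ?rnN rn1.
Qed.

Let c_neq0 : c != 0.
Proof.
rewrite /c; case: s; rewrite ?expr1 ?expr0 ?mulN1r ?mul1r ?oppr_eq0; by rewrite eq_complex/= oner_eq0 andbF.
Qed.

Variable h : (R[i] * T)%type -> R[i].
Variable K : R.
Hypothesis h_dom : dominated h K.

Let H_diff w o : right_of w -> O o -> differentiable (Hfun h) (w, o).
Proof.
move=> Bw Oo; have [_ hd _] := h_dom; apply: holM; last exact: hd.
by apply: differentiable_cexp_comp; apply: holN; exact: p_diff.
Qed.

Let W_diff w o : right_of w -> O o -> differentiable (W h) (w, o).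
Proof.
move=> Bw Oo; apply: (primitive_differentiable right_of_open O_open) H_diff Bw Oo.
by move=> w' t Bw' t01; exact: right_of_star.
Qed.

Let W_cder w o : right_of w -> O o -> cder (fun z => W h (z, o)) w (Hfun h (w, o)).
Proof.
move=> Bw Oo; apply: (primitive_cder right_of_open O_open) H_diff Bw Oo => //.
by move=> w' t Bw' t01; exact: right_of_star.
Qed.

(** [Gm] followed in the direction [c]; the outer sign makes it nondecreasing in [t] for both
    orientations. *)
Let sGm x o (t : R) : R := (-1) ^+ s * Gm (complex.Re x) o (complex.Im x + (-1) ^+ s * t).

Let sGm_der x o t : right_of x -> O o ->
  is_derive t (1 : R) (sGm x o) (gm (complex.Re x) o (complex.Im x + (-1) ^+ s * t)).
Proof.
move=> Bx Oo.
have dl : is_derive t (1 : R) (fun t => complex.Im x + (-1) ^+ s * t) ((-1) ^+ s).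
  have := is_deriveD (is_derive_cst (complex.Im x) t (1 : R))
     (@is_deriveZ _ _ _ id ((-1) ^+ s) t (1 : R) 1 (is_derive_id _ _)).
  by move=> H; apply: is_derive_eq H _; rewrite /GRing.scale/= mulr1 add0r.
have := @is_deriveZ _ _ _ _ ((-1) ^+ s) t (1 : R) _ (is_derive_real_comp (Gm_der _ Bx Oo) dl).
move=> H; apply: is_derive_eq H _; rewrite /GRing.scale/=.
by case: (s); rewrite ?expr1 ?expr0; ring.
Qed.

Let sGm_mono x o (t t' : R) : right_of x -> O o -> t <= t' -> sGm x o t <= sGm x o t'.
Proof.
move=> Bx Oo tt; have z0 (u : R) : t <= u <= t' -> is_derive u (1 : R) (fun=> 0 : R) 0 by move=> _;
    exact: is_derive_cst.
have := real_mvi tt z0 (fun u _ => sGm_der u Bx Oo).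
move=> H; rewrite -subr_ge0; apply: le_trans (normr_ge0 (0 - 0)) (H _) => u _; rewrite normr0.
exact: gm_ge0.
Qed.

(** Beyond [x] the factor [e^(-p)] has modulus at most [e^(- Re p(x))]; the factor [e^(p(x))] in
    [Vseq] will cancel this, and no exponential remains in the bound. *)
Let W_tail x o (t t' : R) : right_of x -> O o -> 0 <= t -> t <= t' ->
  rn (W h (x + t'%:C * c, o) - W h (x + t%:C * c, o)) <=
  2 * (expR (- complex.Re (p (x, o))) * K) * (sGm x o t' - sGm x o t).
Proof.
move=> Bx Oo t0 tt; have [K0 _ hK] := h_dom.
set E := expR _.
have d1 (u : R) : t <= u <= t' -> rder (fun t => W h (x + t%:C * c, o)) u (c * Hfun h (x + u%:C * c, o)).
  move=> _; apply: (cder_rder (f := fun z => W h (z, o))); apply: W_cder => //; exact: c_right.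
have d2 (u : R) : t <= u <= t' -> is_derive u (1 : R) (fun u => E * K * sGm x o u)
    (E * K * gm (complex.Re x) o (complex.Im x + (-1) ^+ s * u)).
  by move=> _; exact: (@is_deriveZ _ _ _ _ (E * K) u (1 : R) _ (sGm_der u Bx Oo)).
have bd (u : R) : t <= u <= t' -> rn (c * Hfun h (x + u%:C * c, o)) <=
    E * K * gm (complex.Re x) o (complex.Im x + (-1) ^+ s * u).
  move=> /andP[tu _]; rewrite rnM rn_c mul1r /Hfun rnM rn_cexp -[X in _ <= X]mulrA.
  apply: ler_pM; rewrite ?expR_ge0 ?rn_ge0//.
    by rewrite ler_expR cReN lerN2; apply: p_mono => //; exact: le_trans tu.
  by have := hK _ o (c_right u Bx) Oo; rewrite (c_lift x u).1 (c_lift x u).2.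
have := rder_mvi tt d1 d2 bd.
by rewrite -mulrBr !mulrA.
Qed.

Let sGm_le x o (t e : R) : right_of x -> O o -> (forall t, Gm (complex.Re x) o t <= e) ->
  sGm x o t - sGm x o 0 <= e.
Proof.
move=> Bx Oo He.
have := Gm_range (complex.Im x + (-1) ^+ s * t) Bx Oo.
have := Gm_range (complex.Im x + (-1) ^+ s * 0) Bx Oo.
rewrite /sGm; have := He (complex.Im x + (-1) ^+ s * t); have := He (complex.Im x + (-1) ^+ s * 0).
set a := Gm _ _ (_ + _ * 0); set b := Gm _ _ _.
by case: (s); rewrite ?expr1 ?expr0 ?mulN1r ?mul1r => ? ? /andP[? ?] /andP[? ?]; lra.
Qed.

Let Wseq x o (N : nat) := W h (x + N%:R%:C * c, o).

Let sGm_cvg x o : right_of x -> O o -> forall e : R, 0 < e -> exists N : nat, forall t t' : R,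
  N%:R <= t -> t <= t' -> sGm x o t' - sGm x o t <= e.
Proof.
move=> Bx Oo e e0'.
have cv : cvgn (fun N : nat => sGm x o N%:R).
  apply: nondecreasing_is_cvgn.
    by move=> m n mn; apply: sGm_mono => //; rewrite ler_nat.
  exists (sGm x o 0 + e0) => _ [N _ <-]; rewrite -lerBlDl.
  by apply: sGm_le => // t; have /andP[] := Gm_range t Bx Oo.
have ub (t : R) : sGm x o t <= limn (fun N : nat => sGm x o N%:R).
  have [N tN] : exists N : nat, t <= N%:R.
    exists (Num.bound `|t|); have := archi_boundP (normr_ge0 t).
    by move=> /ltW; apply: le_trans; exact: ler_norm.
  apply: (le_trans (sGm_mono Bx Oo tN)).
  apply: nondecreasing_cvgn_le => //.
  by move=> m n mn; apply: sGm_mono => //; rewrite ler_nat.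
move: cv => /cvgrPdist_lt/(_ e e0')[N _ HN]; exists N => t t' Nt tt.
have := HN N (leqnn N); have := ub t'; have := sGm_mono Bx Oo Nt.
rewrite /= ltr_norml; move=> ? ? /andP[? ?]; lra.
Qed.

Let W_cvg x o : right_of x -> O o -> exists l, Wseq x o N @[N --> \oo] --> (l : R[i]).
Proof.
move=> Bx Oo; have [K0 _ _] := h_dom.
apply: rn_cauchy_cvg => e e1.
pose C := 2 * (expR (- complex.Re (p (x, o))) * K) + 1.
have C0 : 0 < C by rewrite ltr_wpDl// !mulr_ge0 ?expR_ge0.
have e2 : 0 < e / 2 / 2 / C by rewrite !divr_gt0.
have [N HN] := sGm_cvg Bx Oo e2.
have Hk m : (N <= m)%N -> rn (Wseq x o m - Wseq x o N) <= e / 2 / 2.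
  move=> Nm; have Nm' : N%:R <= m%:R :> R by rewrite ler_nat.
  apply: (le_trans (W_tail Bx Oo (ler0n _ N) Nm')).
  have h1 := HN N%:R m%:R (lexx _) Nm'.
  have h0 : 0 <= sGm x o m%:R - sGm x o N%:R by rewrite subr_ge0 sGm_mono.
  apply: (@le_trans _ _ (C * (sGm x o m%:R - sGm x o N%:R))).
    by rewrite ler_wpM2r// lerDl.
  by rewrite mulrC -ler_pdivlMr.
exists N => m n Nm Nn.
rewrite (_ : _ - _ = (Wseq x o m - Wseq x o N) - (Wseq x o n - Wseq x o N)); last by ring.
by apply: le_lt_trans (rnB _ _) _; have := Hk m Nm; have := Hk n Nn; lra.
Qed.

(** Minus the integral of [e^(p(x) - p(x')) h(x')] from [x] to [x + N c]: holomorphic for each [N],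
    and bounded independently of [N]. *)
Let Vseq (N : nat) (x : (R[i] * T)%type) := cexp (p x) * (W h x - W h (x.1 + N%:R%:C * c, x.2)).

Let Vseq_diff N w o : right_of w -> O o -> differentiable (Vseq N) (w, o).
Proof.
move=> Bw Oo; apply: holM; first by apply: differentiable_cexp_comp; exact: p_diff.
apply: holB; first exact: W_diff.
apply: (@differentiable_comp _ _ _ _ (fun x : (R[i] * T)%type => (x.1 + N%:R%:C * c, x.2)) (W h)).
  apply: differentiable_pair; last exact: differentiable_snd.
  by apply: holD; [exact: differentiable_fst|exact: hol_cst].
by apply: W_diff => //; exact: c_right.
Qed.

Let Vseq_le N w o e : right_of w -> O o -> (forall t, Gm (complex.Re w) o t <= e) ->
  rn (Vseq N (w, o)) <= 2 * K * e.
Proof.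
move=> Bw Oo He; have [K0 _ _] := h_dom.
have := W_tail Bw Oo (lexx 0) (ler0n _ N); rewrite mul0r addr0 => h1.
have h2 := sGm_le N%:R Bw Oo He.
rewrite /Vseq rnM rn_cexp/= -rnN opprB.
apply: (le_trans (ler_wpM2l (expR_ge0 _) h1)).
rewrite [X in X <= _](_ : _ = 2 * K * (sGm w o N%:R - sGm w o 0)); last first.
  rewrite expRN; field; exact: lt0r_neq0 (expR_gt0 _).
by rewrite ler_wpM2l// mulr_ge0.
Qed.

Let Winf_line (Winf : (R[i] * T)%type -> R[i]) :
  (forall x, right_of x.1 -> O x.2 -> Wseq x.1 x.2 N @[N --> \oo] --> Winf x) ->
  forall x o (t : R), right_of x -> O o -> 0 <= t -> Winf (x + t%:C * c, o) = Winf (x, o).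
Proof.
move=> HW x o t Bx Oo t0; have [K0 _ _] := h_dom.
apply: (rn_lim_eq (HW (x + t%:C * c, o) (c_right t Bx) Oo)) => e e1.
pose C := 2 * (expR (- complex.Re (p (x, o))) * K) + 1.
have C0 : 0 < C by rewrite ltr_wpDl// !mulr_ge0 ?expR_ge0.
have e2 : 0 < e / 2 / C by rewrite !divr_gt0.
have e3 : 0 < e / 2 by rewrite divr_gt0.
have [N0 HN] := sGm_cvg Bx Oo e2.
have nr : \forall N \near \oo, (N0 <= N)%N by exists N0.
have := HW (x, o) Bx Oo; move=> /cvg_rn/(_ _ e3) nW.
apply: filterS2 nr nW => N NN /= hW.
rewrite (_ : Wseq _ _ _ = W h (x + (t + N%:R)%:C * c, o)); last first.
  by rewrite /Wseq rcD mulrDl addrA.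
rewrite -[W h _](subrK (Wseq x o N)) -addrA (le_trans (rnD _ _))//.
rewrite (splitr e) lerD//; last exact: ltW.
have Nt : N%:R <= t + N%:R by rewrite lerDr.
apply: (le_trans (W_tail Bx Oo (ler0n _ N) Nt)).
have h1 := HN _ _ _ Nt; rewrite ler_nat in h1; have {}h1 := h1 NN.
have h0 : 0 <= sGm x o (t + N%:R) - sGm x o N%:R by rewrite subr_ge0 sGm_mono.
apply: (@le_trans _ _ (C * (sGm x o (t + N%:R) - sGm x o N%:R))).
  by rewrite ler_wpM2r// lerDl.
by rewrite mulrC -ler_pdivlMr.
Qed.

(** The limit [Winf] of [W] at the end of the line is only defined pointwise, so its holomorphy is
    obtained indirectly: [V] is a bounded limit of the [Vseq N], and [Winf = W - e^(-p) V]. Being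
    constant in the direction [c], it has complex derivative zero in [z], so [e^(-p) V] has the
    derivative of [W]. *)
Lemma decaying_primitive_dominated : exists V : (R[i] * T)%type -> R[i],
  forall w o, right_of w -> O o ->
  [/\ Vseq N (w, o) @[N --> \oo] --> V (w, o),
      differentiable V (w, o),
      forall e, (forall t, Gm (complex.Re w) o t <= e) -> rn (V (w, o)) <= 2 * K * e &
      cder (fun z => cexp (- p (z, o)) * V (z, o)) w (cexp (- p (w, o)) * h (w, o))].
Proof.
have H (x : (R[i] * T)%type) : exists l : R[i], right_of x.1 -> O x.2 -> Wseq x.1 x.2 N @[N --> \oo] --> l.
  have [[Bx Ox]|nx] := pselect (right_of x.1 /\ O x.2).
    by have [l Hl] := W_cvg Bx Ox; exists l.
  by exists 0 => Bx Ox; case: nx.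
have [Winf HW] := choice H.
pose V x := cexp (p x) * (W h x - Winf x).
have cV w o : right_of w -> O o -> Vseq N (w, o) @[N --> \oo] --> V (w, o).
  move=> Bw Oo; apply: cvgMl_tmp; apply: cvgB; first exact: cvg_cst.
  exact: (HW (w, o)).
have dV w o : right_of w -> O o -> differentiable V (w, o).
  move=> Bw Oo.
  have [d d0 Hd] := product_open right_of_open O_open Bw Oo.
  have [|||//] := @differentiable_limit R _ Vseq V (w, o) (2 * K * e0) d d0.
  - by move=> N [y1 y2] /Hd[? ?]; exact: Vseq_diff.
  - move=> N [y1 y2] /Hd[/= By Oy]; apply: Vseq_le => // t.
    by have /andP[] := Gm_range t By Oy.
  - by move=> [y1 y2] /Hd[? ?]; exact: cV.
exists V => w o Bw Oo; split; [exact: cV|exact: dV| |].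
  move=> e He; apply: rn_lim_le (cV w o Bw Oo) _; apply: nearW => N; exact: Vseq_le.
have UE z : cexp (- p (z, o)) * V (z, o) = W h (z, o) - Winf (z, o).
  by rewrite /V mulrA -cexpD addNr cexp0 mul1r.
have dWinf : differentiable (fun x => W h x - cexp (- p x) * V x) (w, o).
  apply: holB; first exact: W_diff.
  apply: holM; last exact: dV.
  by apply: differentiable_cexp_comp; apply: holN; exact: p_diff.
have WinfE z : W h (z, o) - cexp (- p (z, o)) * V (z, o) = Winf (z, o).
  by rewrite UE opprB addrC subrK.
have := slice_cder dWinf; set a := 'd _ _ _ => ca.
have w'E : w - c + 1%:C * c = w by rewrite mul1r subrK.
have w'r : right_of (w - c).
  have := c_right (-1) Bw; rewrite rcN mulN1r //.
have ra := @cder_rder R (fun z => W h (z, o) - cexp (- p (z, o)) * V (z, o)) (w - c) c a 1.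
rewrite w'E in ra; have {}ra := ra ca.
have a0 : a = 0.
  apply: (mulfI c_neq0); rewrite mulr0.
  apply: (rder_left_unique ra (rder_cst (Winf (w - c, o)) 1)) => t /andP[t0 t1].
  by rewrite WinfE; exact: Winf_line HW _ _ _ w'r Oo t0.
rewrite (_ : (fun z => _) = fun z => W h (z, o) + (-1) * (W h (z, o) - cexp (- p (z, o)) * V (z,
    o))); last first.
  by apply/funext => z; rewrite mulN1r opprB addrC subrK.
have cN := cderM (cder_cst (-1) w) ca.
have := cderD (W_cder Bw Oo) cN.
by rewrite a0 mul0r mulr0 !addr0.
Qed.

End OneEntry.

(** [V] is chosen before [K]: it is then one operator applied to [h], bounded for every admissible
    [K]. The functions found for two constants agree as limits of the same sequence, and an [h] that
    is not dominated gets the default [0]. *)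
Lemma decaying_primitive_exists (s : bool) (p : (R[i] * T)%type -> R[i]) :
  (forall w o, right_of w -> O o -> differentiable p (w, o)) ->
  (forall x o (t : R), right_of x -> O o -> 0 <= t ->
    complex.Re (p (x, o)) <= complex.Re (p (x + t%:C * ((-1) ^+ s * 'i%C), o))) ->
  forall h, exists V : (R[i] * T)%type -> R[i],
  forall K, dominated h K -> forall w o, right_of w -> O o ->
  [/\ differentiable V (w, o),
      forall e, (forall t, Gm (complex.Re w) o t <= e) -> rn (V (w, o)) <= 2 * K * e &
      cder (fun z => cexp (- p (z, o)) * V (z, o)) w (cexp (- p (w, o)) * h (w, o))].
Proof.
move=> dp mp h.
have [[K0 dK0]|nK] := pselect (exists K, dominated h K); last first.
  by exists (fun=> 0) => K dK; case: nK; exists K.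
have [V HV] := decaying_primitive_dominated dp mp dK0.
exists V => K dK w o Bw Oo; have [c1 d1 _ cd1] := HV w o Bw Oo.
split => // e He.
have [V' HV'] := decaying_primitive_dominated dp mp dK; have [c2 _ b2 _] := HV' w o Bw Oo.
have -> : V (w, o) = V' (w, o) by exact: (cvg_unique _ c1 c2).
exact: b2.
Qed.

Section IntegralEquation.
Variables (n : nat) (s : 'I_n -> 'I_n -> bool) (p : 'I_n -> 'I_n -> (R[i] * T)%type -> R[i])
  (G : (R[i] * T)%type -> 'M[R[i]]_n).
Hypothesis p_diff : forall a b w o, right_of w -> O o -> differentiable (p a b) (w, o).
Hypothesis p_mono : forall a b x o (t : R), right_of x -> O o -> 0 <= t ->
  complex.Re (p a b (x, o)) <= complex.Re (p a b (x + t%:C * ((-1) ^+ s a b * 'i%C), o)).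
Hypothesis G_diff : forall a b w o, right_of w -> O o -> differentiable (fun x => G x a b) (w, o).
Hypothesis G_le : forall a b w o, right_of w -> O o ->
  rn (G (w, o) a b) <= gm (complex.Re w) o (complex.Im w).
Hypothesis e0_small : 4 * n%:R * e0 <= 1.

(** Neumann series: [D 0 = 1], [D k.+1 = J (G D k)], and [X] is the sum from [D 1] on. Each step
    costs a factor [2 n e0], at most [1/2]. For the bound by [e], only the last application of [J]
    is estimated by [e], the bound of [Gm] on the line through [w]; the terms [2 n e 2^-k] then sum
    to [4 n e]. *)
Lemma integral_equation_solution : exists X : (R[i] * T)%type -> 'M[R[i]]_n,
  forall a b w o, right_of w -> O o ->
  [/\ differentiable (fun x => X x a b) (w, o),
      forall e, (forall t, Gm (complex.Re w) o t <= e) -> rn (X (w, o) a b) <= 4 * n%:R * e &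
      cder (fun z => cexp (- p a b (z, o)) * X (z, o) a b) w
        (cexp (- p a b (w, o)) * (G (w, o) *m (1%:M + X (w, o))) a b)].
Proof.
have HJ0 (ab : 'I_n * 'I_n) := choice (decaying_primitive_exists (p_diff ab.1 ab.2) (@p_mono ab.1 ab.2)).
pose J ab := projT1 (HJ0 ab).
have HJ ab h K : dominated h K -> forall w o, right_of w -> O o ->
    [/\ differentiable (J ab h) (w, o),
      forall e, (forall t, Gm (complex.Re w) o t <= e) -> rn (J ab h (w, o)) <= 2 * K * e &
      cder (fun z => cexp (- p ab.1 ab.2 (z, o)) * J ab h (z, o)) w (cexp (- p ab.1 ab.2 (w, o)) * h (w, o))].
  exact: (projT2 (HJ0 ab)).
pose D := fix D (k : nat) (x : (R[i] * T)%type) : 'M[R[i]]_n :=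
  if k is k'.+1 then \matrix_(a, b) J (a, b) (fun y => (G y *m D k' y) a b) x else 1%:M.
have DS k x a b : D k.+1 x a b = J (a, b) (fun y => (G y *m D k y) a b) x by rewrite [LHS]mxE.
pose inv k := (forall a b w o, right_of w -> O o -> differentiable (fun x => D k x a b) (w, o)) /\
    (forall a b w o, right_of w -> O o -> rn (D k (w, o) a b) <= 2^-1 ^+ k).
have dom k a b : inv k -> dominated (fun y => (G y *m D k y) a b) (n%:R * 2^-1 ^+ k).
  move=> [i1 i2]; split; first by rewrite mulr_ge0// exprn_ge0.
    by move=> w o Bw Oo; apply: hol_mulmx => i j; [exact: G_diff|exact: i1].
  move=> w o Bw Oo.
  have := rn_mulmx (fun i j => G_le i j Bw Oo) (fun i j => i2 i j w o Bw Oo) a b.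
  by rewrite (mulrC (gm _ _ _)) mulrA.
have Hinv k : inv k.
  elim: k => [|k IH]; split => a b w o Bw Oo.
  - exact: hol_cst.
  - by rewrite expr0 /D mxE; case: (a == b); rewrite ?rn1// rn0.
  - rewrite (_ : (fun _ => _) = J (a, b) (fun y => (G y *m D k y) a b)); last by apply/funext => x; exact: DS.
    by have [] := HJ (a, b) _ _ (dom k a b IH) w o Bw Oo.
  rewrite DS; have [_ h2 _] := HJ (a, b) _ _ (dom k a b IH) w o Bw Oo.
  apply: (le_trans (h2 e0 _)); first by move=> t; have /andP[] := Gm_range t Bw Oo.
  rewrite exprS (_ : 2 * _ * e0 = 2^-1 * (4 * n%:R * e0) * 2^-1 ^+ k); last by field.
  by rewrite ler_wpM2r ?exprn_ge0// ler_piMr.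
have HD k a b w o (Bw : right_of w) (Oo : O o) := HJ (a, b) _ _ (dom k a b (Hinv k)) w o Bw Oo.
pose S (k : nat) (x : (R[i] * T)%type) : 'M[R[i]]_n := \sum_(j < k) D j.+1 x.
have SS k x a b : S k.+1 x a b = S k x a b + D k.+1 x a b by rewrite /S big_ord_recr mxE.
have S_diff k a b w o : right_of w -> O o -> differentiable (fun x => S k x a b) (w, o).
  move=> Bw Oo; elim: k => [|k IH].
    rewrite (_ : (fun _ => _) = fun=> 0); first exact: hol_cst.
    by apply/funext => x; rewrite /S big_ord0 mxE.
  rewrite (_ : (fun _ => _) = fun x => S k x a b + D k.+1 x a b); last by apply/funext => x; exact: SS.
  by apply: holD IH _; exact: (Hinv k.+1).1.
have HX (ab : 'I_n * 'I_n) : exists f : (R[i] * T)%type -> R[i], forall x, right_of x.1 /\ O x.2 ->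
    [/\ differentiable f x, S k x ab.1 ab.2 @[k --> \oo] --> f x &
        forall v, 'd (fun x => S k x ab.1 ab.2) x v @[k --> \oo] --> 'd f x v].
  apply: (@hol_limit R _ [set x | right_of x.1 /\ O x.2] (fun k x => S k x ab.1 ab.2)).
    by move=> k [w o] [Bw Oo]; exact: S_diff.
  move=> [w o] [/= Bw Oo].
  have [d d0 Hd] := product_open right_of_open O_open Bw Oo.
  exists d, 1; split => // [y yd|k [w' o'] /Hd[/= Bw' Oo']].
    by rewrite /S big_ord0 mxE rn0.
  rewrite SS addrAC subrr add0r mul1r (le_trans ((Hinv k.+1).2 _ _ _ _ Bw' Oo'))// exprS.
  by rewrite ler_piMl// ?exprn_ge0// invf_le1// ler1n.
have [Xf HXf] := choice HX.
exists (fun x => \matrix_(a, b) Xf (a, b) x) => a b w o Bw Oo.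
have [f1 f2 f3] := HXf (a, b) (w, o) (conj Bw Oo).
have XE : (fun x => (\matrix_(a, b) Xf (a, b) x) a b) = Xf (a, b) by apply/funext => x; rewrite mxE.
split.
- by rewrite XE.
- move=> e He; rewrite mxE; apply: rn_lim_le f2 _; apply: nearW => k /=.
  have Hk k' : rn (S k'.+1 (w, o) a b - S k' (w, o) a b) <= 2 * n%:R * e * 2^-1 ^+ k'.
    rewrite SS addrAC subrr add0r DS.
    have [_ h2 _] := HD k' a b w o Bw Oo; apply: le_trans (h2 e He) _.
    by rewrite le_eqVlt; apply/orP; left; apply/eqP; ring.
  have := geometric_bound (u := fun k => S k (w, o) a b) Hk 0 k.
  rewrite add0n (_ : S 0 (w, o) a b = 0); last by rewrite /S big_ord0 mxE.
  by rewrite subr0 expr0 mulr1; lra.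
rewrite (_ : (fun z => _) = fun z => cexp (- p a b (z, o)) * Xf (a, b) (z, o)); last first.
  by apply/funext => z; rewrite mxE.
have dE : differentiable (fun x => cexp (- p a b x)) (w, o).
  by apply: differentiable_cexp_comp; apply: holN; exact: p_diff.
have := slice_cder dE; set q := 'd _ _ _; set E := fun z => cexp _ => cE.
have cX := cderM cE (slice_cder f1).
set l := q * _ + _ in cX.
suff -> : cexp (- p a b (w, o)) * (G (w, o) *m (1%:M + \matrix_(a, b) Xf (a, b) (w, o))) a b = l by exact: cX.
pose u k := q * S k (w, o) a b + E w * 'd (fun x => S k x a b) (w, o) (1, 0).
have cu : u k @[k --> \oo] --> l.
  by apply: cvgD; apply: cvgMl_tmp; [exact: f2|exact: f3].
(* The derivative of [e^(-p) S k.+1] involves [S k] only, and convergence of the differentials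
   carries this relation to the limit. *)
have uE k : u k.+1 = E w * (G (w, o) *m (1%:M + S k (w, o))) a b.
  have h1 := cderM cE (slice_cder (S_diff k.+1 a b w o Bw Oo)).
  apply: cder_unique h1 _.
  rewrite (_ : (fun z => _) = fun z => \sum_(j < k.+1) E z * D j.+1 (z, o) a b); last first.
    by apply/funext => z; rewrite -mulr_sumr /S summxE.
  have -> : 1%:M + S k (w, o) = \sum_(j < k.+1) D j (w, o) by rewrite big_ord_recl.
  rewrite mulmx_sumr summxE mulr_sumr; apply: cder_sum => j.
  rewrite (_ : (fun z => _) = fun z => E z * J (a, b) (fun y => (G y *m D j y) a b) (z, o)); last first.
    by apply/funext => z; rewrite DS.
  by have [] := HD j a b w o Bw Oo.
have cu' : u k.+1 @[k --> \oo] --> E w * (G (w, o) *m (1%:M + \matrix_(a, b) Xf (a, b) (w, o))) a b.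
  rewrite (_ : (fun k => _) = fun k => E w * \sum_c G (w, o) a c * ((1%:M : 'M[R[i]]_n) c b + S k
      (w, o) c b)).
    apply: cvgMl_tmp; rewrite mxE; apply: cvg_sum_ord => c; apply: cvgMl_tmp.
    rewrite !mxE; apply: cvgD; first exact: cvg_cst.
    by have [_ h _] := HXf (c, b) (w, o) (conj Bw Oo).
  by apply/funext => k; rewrite uE mxE; congr (_ * _); apply: eq_bigr => c _; rewrite [X in _ * X]mxE.
exact: (cvg_unique _ cu' (cvg_succ cu)).
Qed.

End IntegralEquation.

End DecayingPrimitive.

(** * Bounded primitives of integrable functions *)

Section Decay.
Context {R : realType}.

(** [U] is the integral from minus infinity, which stays between [0] and the integral over the line;
    continuity of [u] makes it derivable at every point. *)
Lemma decay_primitive (u : R -> R) : continuous u -> (forall t, 0 <= u t) ->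
  (\int[lebesgue_measure]_t (u t)%:E < +oo)%E ->
  exists U : R -> R, (forall t : R, is_derive t (1 : R) U (u t)) /\
    forall t, 0 <= U t /\ forall e, (\int[lebesgue_measure]_t (u t)%:E <= e%:E)%E -> U t <= e.
Proof.
move=> cu u0 fin_u.
have iu : lebesgue_measure.-integrable setT (EFin \o u).
  apply/integrableP; split.
    by apply/measurable_EFinP; exact: continuous_measurable_fun.
  rewrite (_ : (fun x => _) = fun t => (u t)%:E)//.
  by apply/funext => t /=; rewrite ger0_norm.
have iuS (t : R) : lebesgue_measure.-integrable `]-oo, t] (EFin \o u).
  exact: integrableS iu.
exists (fun x => (\int[lebesgue_measure]_(t in `]-oo, x]) u t)%R); split.
  move=> t; have [||dU eU] := @continuous_FTC1 R u -oo%O t (t + 1) _ (iuS _) _ (cu t).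
  - by rewrite ltrDl.
  - exact: ltNyr.
  by apply: DeriveDef; [exact: dU|rewrite -derive1E; exact: eU].
move=> t; have fe : (0 <= \int[lebesgue_measure]_(x in `]-oo, t]) (u x)%:E)%E.
  by apply: integral_ge0 => x _; rewrite lee_fin.
split; first by rewrite /Rintegral fine_ge0.
move=> e ue; rewrite /Rintegral -lee_fin fineK.
  apply: le_trans ue; apply: ge0_subset_integral => //.
  - by have /integrableP[] := iu.
  - by move=> x _ /=; rewrite lee_fin.
exact: integrable_fin_num.
Qed.

End Decay.

(** * Block-diagonal matrices and perturbations of the identity *)

Section MatrixLemmas.
Context {R : realType}.

Lemma mxdiag_scalar (l : nat) (s : 'I_l -> nat) (d : 'I_l -> R[i]) :
  \mxdiag_(i < l) ((d i)%:M : 'M[R[i]]_(s i)) = diag_mx (\row_a d (tagnat.sig1 a)).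
Proof.
apply/mxblockP => i j; rewrite mxblockK; apply/matrixP => u v.
rewrite !mxE tagnat.Rank1K; have [ij|ij] := eqVneq i j.
  by subst j; rewrite conform_mx_id mxE -[in RHS](inj_eq val_inj) tagnat.eq_Rank eqxx.
rewrite mxE [tagnat.Rank _ _ == _](_ : _ = false) ?mulr0n//.
by apply/negP => /eqP /(congr1 tagnat.sig1); rewrite !tagnat.Rank1K => /eqP; rewrite (negbTE ij).
Qed.

Section Perturbation.
Context {n : nat}.
Implicit Types E M N : 'M[R[i]]_n.

(** The kernel matrix [K] satisfies [K = - K E], hence [|K| <= |K| / 2]. *)
Lemma add_small_unitmx E (e : R) : (forall a b, rn (E a b) <= e) -> n%:R * e <= 2^-1 ->
  1%:M + E \in unitmx.
Proof.
move=> Ee ne; rewrite -row_free_unit -kermx_eq0; apply/eqP.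
set K := kermx _; have KE : K = - (K *m E).
  by apply/eqP; rewrite -subr_eq0 opprK -[X in X + _]mulmx1 -mulmxDr mulmx_ker.
have : rn K <= 2^-1 * rn K.
  rewrite {1}KE rnN; apply: rn_mx_le; first by rewrite mulr_ge0 ?rn_ge0.
  move=> a b; apply: (le_trans (rn_mulmx (fun i j => rn_entry_le K i j) Ee a b)).
  by rewrite mulrCA mulrC ler_wpM2r ?rn_ge0.
move=> h; apply/eqP; rewrite -rn_eq0 eq_le rn_ge0 andbT; have := rn_ge0 K; lra.
Qed.

(** [N - 1 = E2 - E1 - E1 (N - 1)], and [n e <= 1/2] lets the left side absorb the last term. *)
Lemma quotient_bound E1 E2 N (e : R) : (forall a b, rn (E1 a b) <= e) ->
  (forall a b, rn (E2 a b) <= e) -> n%:R * e <= 2^-1 -> 0 <= e ->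
  (1%:M + E1) *m N = 1%:M + E2 -> forall a b, rn ((N - 1%:M) a b) <= 4 * e.
Proof.
move=> E1e E2e ne e0 H.
have NE : N - 1%:M = E2 - E1 - E1 *m (N - 1%:M).
  have : N = 1%:M + E2 - E1 *m N by rewrite -H mulmxDl mul1mx addrK.
  rewrite mulmxBr mulmx1; move=> {1}->.
  by apply/matrixP => i j; rewrite !mxE; ring.
have h : rn (N - 1%:M) <= 2 * e + 2^-1 * rn (N - 1%:M).
  rewrite {1}NE; apply: rn_mx_le; first by rewrite addr_ge0 ?mulr_ge0 ?rn_ge0.
  move=> a b; have h1 := rn_mulmx E1e (fun i j => rn_entry_le (N - 1%:M) i j) a b.
  rewrite (_ : _ a b = E2 a b - E1 a b - (E1 *m (N - 1%:M)) a b); last first.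
    by rewrite [LHS]mxE [X in X + _]mxE [in X in _ + X]mxE [X in _ + X + _]mxE.
  have h2 : n%:R * (e * rn (N - 1%:M)) <= 2^-1 * rn (N - 1%:M).
    by rewrite mulrA ler_wpM2r ?rn_ge0.
  have := rnB (E2 a b - E1 a b) ((E1 *m (N - 1%:M)) a b); have := rnB (E2 a b) (E1 a b).
  have := E1e a b; have := E2e a b.
  move: h1; set x := rn (_ - _ - _); set y := rn ((E1 *m (N - 1%:M)) a b : R[i]); lra.
move=> a b; apply: le_trans (rn_entry_le _ a b) _; lra.
Qed.

End Perturbation.
End MatrixLemmas.

(** * Sectorial solutions, gluing and uniqueness *)

Section Charts.
Context {R : realType}.

(** Algebra of the passage from [X] to [(1 + X) e^Q]: [Ei], [Ej], [Ep] stand for [e^(q_i)],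
    [e^(q_j)], [e^(q_j - q_i)], and [d] for an entry of the identity matrix. *)
Lemma diagonalized_derivative (e ri rj d Ei Ej Ep x g : R[i]) : Ei * Ep = Ej -> d * rj = d * ri ->
  0 * Ej + d * (Ej * (e * rj)) + (Ei * (e * ri) * (Ep * x) + Ei * (Ep * g)) =
  e * ri * ((d + x) * Ej) + g * Ej.
Proof.
move=> <- dr; rewrite (_ : d * _ = d * rj * (Ei * Ep * e)); last by ring.
by rewrite dr; ring.
Qed.

Lemma cder_comp (f g : R[i] -> R[i]) (z a b : R[i]) :
  cder f (g z) a -> cder g z b -> cder (fun z => f (g z)) z (a * b).
Proof.
move=> /cder_differentiable[_ Ha] /cder_differentiable[_ Hb].
by apply: derivable_cder; exact: is_derive_ccomp.
Qed.

Lemma cderB (f g : R[i] -> R[i]) (w a b : R[i]) :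
  cder f w a -> cder g w b -> cder (fun z => f z - g z) w (a - b).
Proof.
move=> /cder_differentiable[_ Ha] /cder_differentiable[_ Hb].
by apply: derivable_cder; exact: is_deriveB Ha Hb.
Qed.

Lemma param_slice (T : normedModType R[i]) (f : (R[i] * T)%type -> R[i]) (w : R[i]) (o : T) :
  differentiable f (w, o) -> differentiable (fun o => f (w, o)) o.
Proof.
move=> df; apply: (@differentiable_comp _ _ _ _ (fun o : T => (w, o)) f); last exact: df.
by apply: differentiable_pair; [exact: differentiable_cst|apply: (@differentiable_bounded_linear R
    T T id 1) => // v; rewrite mul1r].
Qed.

Lemma chart_cder (phi : R) (f : R[i] -> R[i]) (z b : R[i]) : 0 < complex.Re z ->
  cder f (lchart phi z) (cexp (lchart phi z) * b) ->
  cder (fun z => f (lchart phi z)) z (cexp (0 +i* phi) * b).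
Proof.
move=> z0 Hf; have := cder_comp Hf (lchart_cder phi z0).
rewrite cexp_lchart// (_ : _ / z = cexp (0 +i* phi) * b)//.
have zn0 : z != 0 by apply: contraTneq z0 => ->; rewrite ltxx.
by rewrite mulrAC mulfK.
Qed.

Lemma cder_zero_path (f : R[i] -> R[i]) (w v : R[i]) (t1 t2 : R) : t1 <= t2 ->
  (forall t, t1 <= t <= t2 -> cder f (w + t%:C * v) 0) -> f (w + t2%:C * v) = f (w + t1%:C * v).
Proof.
move=> tt H.
have dr (t : R) : t1 <= t <= t2 -> rder (fun t => f (w + t%:C * v)) t 0.
  by move=> t12; rewrite -(mulr0 v); apply: cder_rder; exact: H.
have := rder_mvi_cst (M := 0) tt dr; rewrite mulr0 mul0r => h.
apply/eqP; rewrite -subr_eq0 -rn_eq0 eq_le rn_ge0 andbT; apply: h => t _.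
by rewrite rn0.
Qed.

Lemma lchartK (phi : R) (w : R[i]) : `|uarg w - phi| < pi / 2 ->
  complex.Re (cexp (w - 0 +i* phi)) = umod w * cos (uarg w - phi) /\
  lchart phi (cexp (w - 0 +i* phi)) = w.
Proof.
move=> wphi.
have Ew : w - 0 +i* phi = complex.Re w +i* (uarg w - phi).
  by apply/eqP; rewrite eq_complex !ReImE/= oppr0 addr0 !eqxx.
have c0 : 0 < cos (uarg w - phi) by apply: cos_gt0_pihalf; rewrite -ltr_norml.
have ReE : complex.Re (cexp (w - 0 +i* phi)) = umod w * cos (uarg w - phi) by rewrite Ew.
have Re0 : 0 < complex.Re (cexp (w - 0 +i* phi)) by rewrite ReE mulr_gt0// expR_gt0.
split => //; apply/eqP; rewrite eq_complex; apply/andP; split; apply/eqP.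
  by apply: expR_inj; rewrite -/(umod _) umod_lchart// rn_cexp Ew.
rewrite -/(uarg _) uarg_lchart Ew /cexp/= (mulrC (expR _)) (mulrC (expR _)) -mulf_div divff ?mulr1;
    last first.
  exact: lt0r_neq0 (expR_gt0 _).
have tE : atan (sin (uarg w - phi) / cos (uarg w - phi)) = uarg w - phi.
  by apply: tanK; rewrite in_itv/= -ltr_norml.
by rewrite tE addrC subrK.
Qed.

Lemma chart_comp_differentiable (T : normedModType R[i]) (phi : R) (f : (R[i] * T)%type -> R[i])
    (w : R[i]) (o : T) : 0 < complex.Re w -> differentiable f (lchart phi w, o) ->
  differentiable (fun x : (R[i] * T)%type => f (lchart phi x.1, x.2)) (w, o).
Proof.
move=> w0 df.
apply: (@differentiable_comp _ _ _ _ (fun x : (R[i] * T)%type => (lchart phi x.1, x.2)) f); last exact: df.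
apply: differentiable_pair; last exact: differentiable_snd.
apply: (@differentiable_comp _ _ _ _ (fun x : (R[i] * T)%type => x.1) (lchart phi)).
  exact: differentiable_fst.
exact: differentiable_lchart.
Qed.

End Charts.

Section Exponents.
Context {R : realType} {l h : nat}.
Variable sigma : 'I_h.+1 -> R.
Let T := 'M[R[i]]_(l, h.+1).

(** Diagonal entry of [Lambda], that is [dq_i/dz]; with respect to [w] the derivative of [q_i] is
    [e^w] times it. *)
Definition rate (w : R[i]) (omega : T) (i : 'I_l) : R[i] :=
  \sum_(k < h.+1) (sigma k)%:C * omega i k * upow w (sigma k - 1).

Lemma cexp_rate (w : R[i]) (omega : T) (i : 'I_l) :
  cexp w * rate w omega i = \sum_(k < h.+1) omega i k * ((sigma k)%:C * upow w (sigma k)).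
Proof.
rewrite /rate mulr_sumr; apply: eq_bigr => k _.
have -> : upow w (sigma k) = cexp w * upow w (sigma k - 1).
  by rewrite !upowE -cexpD; congr cexp; rewrite rcD rcN; ring.
by set A := cexp w; set B := upow _ _; ring.
Qed.

Lemma q_fun_cder (w : R[i]) (omega : T) (i : 'I_l) :
  cder (fun z => q_fun sigma z omega i) w (cexp w * rate w omega i).
Proof.
rewrite cexp_rate; apply: cder_sum => k; rewrite -[X in cder _ _ X]add0r -[X in cder _ _ (X +
    _)](mul0r (upow w (sigma k))).
by apply: cderM; [exact: cder_cst|apply: derivable_cder; exact: is_derive_upow].
Qed.

Lemma differentiable_upow (w : R[i]) (e : R) : differentiable (fun z => upow z e) w.
Proof. by have [] := cder_differentiable (derivable_cder (is_derive_upow w e)). Qed.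

Lemma differentiable_param (i : 'I_l) (k : 'I_h.+1) (w : R[i]) (omega : T) :
  differentiable (fun x : (R[i] * T)%type => x.2 i k) (w, omega).
Proof.
apply: (@differentiable_comp _ _ _ _ (fun x : (R[i] * T)%type => x.2) (fun M : T => M i k)).
  exact: differentiable_snd.
exact: differentiable_coord.
Qed.

Lemma differentiable_upow_fst (w : R[i]) (omega : T) (e : R) :
  differentiable (fun x : (R[i] * T)%type => upow x.1 e) (w, omega).
Proof.
apply: (@differentiable_comp _ _ _ _ (fun x : (R[i] * T)%type => x.1) (fun z : R[i] => upow z e)).
  exact: differentiable_fst.
exact: differentiable_upow.
Qed.

Lemma q_fun_differentiable (i : 'I_l) (w : R[i]) (omega : T) :
  differentiable (fun x : (R[i] * T)%type => q_fun sigma x.1 x.2 i) (w, omega).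
Proof.
apply: hol_sum => k _; apply: holM; [exact: differentiable_param|exact: differentiable_upow_fst].
Qed.

Lemma rate_differentiable (i : 'I_l) (w : R[i]) (omega : T) :
  differentiable (fun x : (R[i] * T)%type => rate x.1 x.2 i) (w, omega).
Proof.
apply: hol_sum => k _; apply: holM; last exact: differentiable_upow_fst.
apply: holZ; exact: differentiable_param.
Qed.

End Exponents.

Section Sectors.
Context {R : realType} {l h mu : nat} {s : 'I_l -> nat}.
Let n := (\sum_(i < l) s i)%N.
Let T := 'M[R[i]]_(l, h.+1).
Variables (a : R) (sigma : 'I_h.+1 -> R) (Omega : set T) (N : 'M[R[i]]_(\sum_(i < l) s i) -> R)
  (F : R[i] -> T -> 'M[R[i]]_(\sum_(i < l) s i)) (eta : R) (sg : 'I_mu -> R)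
  (tau : 'I_mu -> T -> R) (k : 'I_mu -> int).
Hypotheses (a_gt0 : 0 < a) (l_ge2 : (2 <= l)%N) (sigma0 : sigma ord0 = 1)
    (sigma_gt0 : forall j, 0 < sigma j)
    (sigma_decr : forall j j' : 'I_h.+1, (j < j')%N -> sigma j' < sigma j)
    (N_norm : is_norm N)
    (Omega_neq0 : Omega !=set0) (Omega_open : open Omega)
    (Omega_connected : connected Omega) (Omega_bounded : bounded_set Omega)
    (Omega_degrees : constant_degrees Omega)
    (Omega_enum : preserved_enumeration eta Omega)
    (F_holo : holomorphic_on (ucover_gt a) Omega F)
    (F_decay : forall I : set R, open I -> is_interval I ->
       good_decay N a Omega F I)
    (tau_enum : tau_enumeration sigma eta Omega sg tau)
    (k_adequate : Sigma_set Omega sg tau k !=set0).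
Let Sigma := Sigma_set Omega sg tau k.

(** The decay condition is taken on the open interval [R], which contains every closed range of
    directions. *)
Lemma decay_small c d (eps : R) : c <= d -> 0 < eps -> exists B, forall b phi omega,
  B < b -> c <= phi <= d -> Omega omega ->
  (\int[lebesgue_measure]_t (N (F (ell phi b t) omega))%:E <= eps%:E)%E.
Proof.
move=> cd eps0; have [|g [_ H]] := F_decay openT; first by move=> ? ? _ _ ? _.
have [_ cv] := H c d cd (@subsetT _ _).
have nb : nbhs (0%E : \bar R) [set x : \bar R | (x < eps%:E)%E].
  apply: open_nbhs_nbhs; split; first exact: open_ereal_lt_ereal.
  by rewrite /= lte_fin.
have [M [_ HM]] := cv _ nb.
exists M => b phi omega Mb phi_cd Oo; have := HM b Mb => /ltW; apply: le_trans.
apply: le_trans (ereal_sup_ubound _); last by exists omega.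
by apply: ereal_sup_ubound; exists phi => //=; rewrite in_itv.
Qed.

Definition block (j : 'I_n) : 'I_l := tagnat.sig1 j.

Definition expq (w : R[i]) (omega : T) : 'M[R[i]]_n :=
  diag_mx (\row_j cexp (q_fun sigma w omega (block j))).

Definition expNq (w : R[i]) (omega : T) : 'M[R[i]]_n :=
  diag_mx (\row_j cexp (- q_fun sigma w omega (block j))).

Lemma expqK w omega : expq w omega *m expNq w omega = 1%:M.
Proof.
rewrite mulmx_diag; apply/matrixP => i j; rewrite !mxE -cexpD addrN cexp0.
by [].
Qed.

Lemma expqNK w omega : expNq w omega *m expq w omega = 1%:M.
Proof. exact: mulmx1C (expqK w omega). Qed.

Lemma Lambda_mxE w omega : Lambda_mx s sigma w omega = diag_mx (\row_j rate sigma w omega (block j)).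
Proof. exact: mxdiag_scalar. Qed.

Lemma mexp_QE w omega : mexp (Q_mx s sigma w omega) = expq w omega.
Proof.
rewrite /Q_mx mxdiag_scalar mexp_diag; congr diag_mx.
by apply/matrixP => i j; rewrite !mxE.
Qed.

Lemma ucover_right w : ucover_gt a w <-> right_of (ln a) w.
Proof. by rewrite /ucover_gt /right_of /umod/= -{1}(lnK a_gt0) ltr_expR. Qed.

Lemma Omega_ball o : Omega o -> exists2 d : R, 0 < d & forall y, rn (y - o) < d -> Omega y.
Proof. by move=> Oo; apply/nbhs_rn; exact: open_nbhs_nbhs. Qed.

Lemma F_entry_differentiable i j w omega : ucover_gt a w -> Omega omega ->
  differentiable (fun x : (R[i] * T)%type => F x.1 x.2 i j) (w, omega).
Proof.
move=> aw Oo; have := F_holo aw Oo.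
by move=> /(differentiable_entries (fun x : (R[i] * T)%type => F x.1 x.2)); apply.
Qed.

(** Coefficient of the system in the coordinate [w = log z], where [dz = e^w dw]. *)
Definition coefficient (x : (R[i] * T)%type) : 'M[R[i]]_n :=
  cexp x.1 *: (Lambda_mx s sigma x.1 x.2 + F x.1 x.2).

Lemma coefficientE x i j : coefficient x i j =
  cexp x.1 * (rate sigma x.1 x.2 (block i) *+ (i == j) + F x.1 x.2 i j).
Proof. by rewrite /coefficient Lambda_mxE !mxE. Qed.

Lemma coefficient_differentiable i j w omega : right_of (ln a) w -> Omega omega ->
  differentiable (fun x => coefficient x i j) (w, omega).
Proof.
move=> /ucover_right aw Oo.
rewrite (_ : (fun x => _) = fun x => cexp x.1 * (rate sigma x.1 x.2 (block i) *+ (i == j) + F x.1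
    x.2 i j)); last first.
  by apply/funext => x; rewrite coefficientE.
apply: holM; first by apply: differentiable_cexp_comp; exact: differentiable_fst.
apply: holD; last exact: F_entry_differentiable.
case: (i == j); first exact: rate_differentiable.
exact: hol_cst.
Qed.

Variables Phi Psi : (R[i] * T)%type -> 'M[R[i]]_n.
Hypothesis fundamental_pair : forall w o, right_of (ln a) w -> Omega o ->
  [/\ forall i j, differentiable (fun x => Phi x i j) (w, o) /\
        cder (fun z => Phi (z, o) i j) w ((coefficient (w, o) *m Phi (w, o)) i j),
      forall i j, differentiable (fun x => Psi x i j) (w, o) /\
        cder (fun z => Psi (z, o) i j) w (- (Psi (w, o) *m coefficient (w, o)) i j) &
      Psi (w, o) *m Phi (w, o) = 1%:M].

(** The [o(1)] term of the solution [Phi C]; asymptotics thus become a property of the matrix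
    [C]. *)
Definition remainder (C : 'M[R[i]]_n) (w : R[i]) (omega : T) : 'M[R[i]]_n :=
  Phi (w, omega) *m C *m expNq w omega - 1%:M.

Section FixedDirection.
Variables (phi B : R) (sgn : 'I_l -> 'I_l -> bool) (c1 e0 : R).
Hypotheses (a_le_B : a <= B) (c1_gt0 : 0 < c1) (e0_small : 4 * n%:R * e0 <= 1).
Hypothesis N_entries : forall (A : 'M[R[i]]_n) i j, rn (A i j) <= c1 * N A.
Hypothesis small_integral : forall b omega, B < b -> Omega omega ->
  (\int[lebesgue_measure]_t (N (F (ell phi b t) omega))%:E <= (e0 / c1)%:E)%E.
Hypothesis rate_sign : forall omega i j w, Omega omega -> `|uarg w - phi| < pi / 2 ->
  ln B <= complex.Re w ->
  0 <= (-1) ^+ sgn i j * complex.Re (cexp (0 +i* (phi + pi / 2)) * (rate sigma w omega i - rate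
      sigma w omega j)).

Let B_gt0 : 0 < B. Proof. exact: lt_le_trans a_le_B. Qed.

Let lchart_right (z : R[i]) : right_of B z ->
  [/\ 0 < complex.Re z, ucover_gt a (lchart phi z), `|uarg (lchart phi z) - phi| < pi / 2 &
     ln B <= complex.Re (lchart phi z)].
Proof.
move=> Bz; have {}Bz : B < complex.Re z := Bz.
have z0 := lt_trans B_gt0 Bz.
have rz : B < rn z by apply: lt_le_trans Bz _; apply: le_trans (rnRe z); exact: ler_norm.
split; first exact: z0.
- by rewrite /ucover_gt/= umod_lchart//; exact: le_lt_trans rz.
- rewrite uarg_lchart addrAC subrr add0r ltr_norml; apply/andP; split; [exact: atan_gtNpi2|exact: atan_ltpi2].
by rewrite -ler_expR lnK// -/(umod _) umod_lchart// ltW.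
Qed.

Let u b omega t : R := N (F (ell phi b t) omega).

Let u_continuous b omega : B < b -> Omega omega -> continuous (u b omega).
Proof.
move=> Bb Oo t.
have Bz : right_of B (b +i* t) by [].
have [z0 az _ _] := lchart_right Bz.
apply: (@continuous_comp _ _ _ (fun t : R => F (ell phi b t) omega) N); last exact:
    (is_norm_continuous N_norm).
apply: (@continuous_comp _ _ _ (fun t : R => (b +i* t : R[i])) (fun z : R[i] => F (lchart phi z) omega)).
  apply/cvg_rn => e e1; have : \forall x \near nbhs t, `|t - x| < e.
    by apply/nbhs_ballP; exists e.
  apply: filterS => x h1; apply: le_lt_trans (rn_ReIm _) _.
  by rewrite !ReImE/= subrr normr0 add0r distrC.
apply: (@continuous_comp _ _ _ (lchart phi) (fun w : R[i] => F w omega)).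
  exact: differentiable_continuous (differentiable_lchart phi z0).
apply: differentiable_continuous; apply/differentiable_entries => i j.
exact: slice_differentiable (F_entry_differentiable i j az Oo).
Qed.

(** [Yh = (1 + X) e^Q] solves the system for [Re x > B], so [Psi Yh] is constant there, and [C] is
    its value at the base point [z0]. It is holomorphic in the parameters because [Psi] and [Yh]
    are, and the remainder of [Phi C] is [X] itself. *)
Lemma sectorial_solution_direction : exists C : T -> 'M[R[i]]_n,
  (forall i j omega, Omega omega -> differentiable (fun o => C o i j) omega) /\
  forall omega z, Omega omega -> right_of B z ->
    forall e, (\int[lebesgue_measure]_t (N (F (ell phi (complex.Re z) t) omega))%:E <= (e / c1)%:E)%E ->
    forall i j, rn (remainder (C omega) (lchart phi z) omega i j) <= 4 * n%:R * e.
Proof.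
have u0 b omega t : 0 <= u b omega t by exact: norm_ge0.
have HU (bo : R * T) : exists U : R -> R, B < bo.1 -> Omega bo.2 ->
    (forall t : R, is_derive t (1 : R) U (u bo.1 bo.2 t)) /\
    forall t, 0 <= U t /\ forall e,
    (\int[lebesgue_measure]_t (u bo.1 bo.2 t)%:E <= e%:E)%E -> U t <= e.
  have [[h1 h2]|nh] := pselect (B < bo.1 /\ Omega bo.2); last first.
    by exists (fun=> 0) => h1 h2; case: nh.
  have [||U [U1 U2]] := decay_primitive (u_continuous h1 h2).
  - by move=> t; exact: u0.
  - by apply: le_lt_trans (small_integral h1 h2) _; rewrite ltry.
  by exists U.
have [U {}HU] := choice HU.
pose gm b omega t := c1 * u b omega t.
pose Gm b omega t := c1 * U (b, omega) t.
have gm0 b omega t : 0 <= gm b omega t by rewrite mulr_ge0// ltW.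
have Gm_der b omega (t : R) : B < b -> Omega omega -> is_derive t (1 : R) (Gm b omega) (gm b omega t).
  move=> Bb Oo; have [h1 _] := HU (b, omega) Bb Oo.
  exact: (@is_deriveZ _ _ _ _ c1 t (1 : R) _ (h1 t)).
have Gm_le b omega t e : B < b -> Omega omega ->
    (\int[lebesgue_measure]_t (u b omega t)%:E <= (e / c1)%:E)%E -> Gm b omega t <= e.
  move=> Bb Oo he; have [_ /(_ t)[_ h1]] := HU (b, omega) Bb Oo.
  by have := h1 _ he; rewrite ler_pdivlMr// mulrC.
have Gm_range b omega t : B < b -> Omega omega -> 0 <= Gm b omega t <= e0.
  move=> Bb Oo; apply/andP; split; last by apply: Gm_le => //; exact: small_integral.
  by have [_ /(_ t)[h1 _]] := HU (b, omega) Bb Oo; rewrite mulr_ge0// ltW.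
pose p (i j : 'I_n) (x : (R[i] * T)%type) :=
  q_fun sigma (lchart phi x.1) x.2 (block i) - q_fun sigma (lchart phi x.1) x.2 (block j).
pose G (x : (R[i] * T)%type) : 'M[R[i]]_n := cexp (0 +i* phi) *: F (lchart phi x.1) x.2.
have q_diff (i : 'I_l) w (o : T) : right_of B w -> differentiable (fun x : (R[i] * T)%type =>
    q_fun sigma (lchart phi x.1) x.2 i) (w, o).
  move=> Bw; have [w0 _ _ _] := lchart_right Bw.
  apply: (chart_comp_differentiable (f := fun x : (R[i] * T)%type => q_fun sigma x.1 x.2 i)) => //.
  exact: q_fun_differentiable.
have p_diff i j w o : right_of B w -> Omega o -> differentiable (p i j) (w, o).
  by move=> Bw Oo; apply: holB; exact: q_diff.
have q_cder (i : 'I_l) w (o : T) : right_of B w -> cder (fun z => q_fun sigma (lchart phi z) o i) w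
    (cexp (0 +i* phi) * rate sigma (lchart phi w) o i).
  move=> Bw; have [w0 _ _ _] := lchart_right Bw.
  exact: chart_cder w0 (q_fun_cder sigma (lchart phi w) o i).
have p_mono i j x o (t : R) : right_of B x -> Omega o -> 0 <= t ->
    complex.Re (p i j (x, o)) <= complex.Re (p i j (x + t%:C * ((-1) ^+ sgn (block i) (block j) * 'i%C), o)).
  move=> Bx Oo t0; set b := sgn _ _.
  have Bu (v : R) : right_of B (x + v%:C * ((-1) ^+ b * 'i%C)).
    move: Bx; rewrite /right_of/= cReD Re_scale; case: (b); rewrite ?expr1 ?expr0 ?mulN1r ?mul1r /=
        ?oppr0 mulr0 addr0//.
  have dp (v : R) : rder (fun v => p i j (x + v%:C * ((-1) ^+ b * 'i%C), o)) v
      ((-1) ^+ b * 'i%C * (cexp (0 +i* phi) * (rate sigma (lchart phi (x + v%:C * ((-1) ^+ b *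
          'i%C))) o (block i) -
        rate sigma (lchart phi (x + v%:C * ((-1) ^+ b * 'i%C))) o (block j)))).
    apply: (cder_rder (f := fun z => p i j (z, o))).
    by rewrite mulrBr; apply: cderB; exact: q_cder.
  have z0 (v : R) : 0 <= v <= t -> is_derive v (1 : R) (fun=> 0 : R) 0 by move=> _; exact: is_derive_cst.
  have := real_mvi t0 z0 (fun v _ => rderRe (dp v)).
  rewrite mul0r addr0 => H; rewrite -subr_ge0; apply: le_trans (normr_ge0 (0 - 0)) (H _) => v _.
  rewrite normr0; have [_ _ h1 h2] := lchart_right (Bu v).
  have := rate_sign (block i) (block j) Oo h1 h2; rewrite -/b cexp_imD.
  have -> : cexp (0 +i* (pi / 2)) = 'i%C :> R[i].
    by rewrite /cexp/= expR0 cos_pihalf sin_pihalf !mul1r.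
  set D := _ - _ => h3.
  rewrite (_ : complex.Re _ = (-1) ^+ b * complex.Re (cexp (0 +i* phi) * 'i%C * D))//.
  rewrite -mulrA (mulrA 'i%C) (mulrC 'i%C).
  by case: (b); rewrite ?expr1 ?expr0 ?mulN1r ?mul1r// cReN.
have G_diff i j w o : right_of B w -> Omega o -> differentiable (fun x => G x i j) (w, o).
  move=> Bw Oo; have [w0 aw _ _] := lchart_right Bw.
  rewrite (_ : (fun x => _) = fun x => cexp (0 +i* phi) * F (lchart phi x.1) x.2 i j); last first.
    by apply/funext => x; rewrite mxE.
  apply: holZ; apply: (chart_comp_differentiable (f := fun x : (R[i] * T)%type => F x.1 x.2 i j)) => //.
  exact: F_entry_differentiable.
have G_le i j w o : right_of B w -> Omega o -> rn (G (w, o) i j) <= gm (complex.Re w) o (complex.Im w).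
  by move=> Bw Oo; rewrite mxE rnM rn_cexp/= expR0 mul1r; exact: N_entries.
have [X HX] := integral_equation_solution Omega_ball gm0 Gm_der Gm_range
   p_diff (s := fun i j => sgn (block i) (block j)) p_mono G_diff G_le e0_small.
have Eq_diff j w (o : T) : right_of B w -> differentiable (fun x : (R[i] * T)%type =>
    cexp (q_fun sigma (lchart phi x.1) x.2 (block j))) (w, o).
  by move=> Bw; apply: differentiable_cexp_comp; exact: q_diff.
pose Yh (z : R[i]) (o : T) := (1%:M + X (z, o)) *m expq (lchart phi z) o.
have YhE z o i j : Yh z o i j = ((1%:M : 'M[R[i]]_n) i j + X (z, o) i j) *
    cexp (q_fun sigma (lchart phi z) o (block j)).
  by rewrite /Yh mul_mx_diag !mxE.
(* In the variable of the half-plane the coefficient is divided by that variable, because the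
   derivative of [lchart] at [x] is [1 / x]. *)
have coefE w o : right_of B w -> w^-1 *: coefficient (lchart phi w, o) =
    diag_mx (\row_j (cexp (0 +i* phi) * rate sigma (lchart phi w) o (block j))) + G (w, o).
  move=> Bw; have [w0 _ _ _] := lchart_right Bw.
  have wn0 : w != 0 by apply: contraTneq w0 => ->; rewrite ltxx.
  apply/matrixP => i j; rewrite mxE coefficientE !mxE/= cexp_lchart//.
  by case: (i == j); rewrite ?mulr1n ?mulr0n; field.
have Yh_cder i j w o : right_of B w -> Omega o ->
    cder (fun z => Yh z o i j) w ((w^-1 *: coefficient (lchart phi w, o) *m Yh w o) i j).
  move=> Bw Oo; set d := (1%:M : 'M[R[i]]_n) i j.
  have Epq z : cexp (q_fun sigma (lchart phi z) o (block i)) * cexp (- p i j (z, o)) =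
      cexp (q_fun sigma (lchart phi z) o (block j)).
    by rewrite -cexpD /p/= opprB addrC subrK.
  rewrite (_ : (fun z => _) = fun z => d * cexp (q_fun sigma (lchart phi z) o (block j)) +
      cexp (q_fun sigma (lchart phi z) o (block i)) * (cexp (- p i j (z, o)) * X (z, o) i j)); last first.
    by apply/funext => z; rewrite YhE mulrA Epq -/d; ring.
  have ce j' := @cder_comp R cexp _ w _ _ (cexp_cder _) (q_cder (block j') w o Bw).
  have [_ _ cX] := HX i j w o Bw Oo.
  have := cderD (cderM (cder_cst d w) (ce j)) (cderM (ce i) cX).
  have RE : (w^-1 *: coefficient (lchart phi w, o) *m Yh w o) i j =
      cexp (0 +i* phi) * rate sigma (lchart phi w) o (block i) *
        ((d + X (w, o) i j) * cexp (q_fun sigma (lchart phi w) o (block j))) +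
      (G (w, o) *m (1%:M + X (w, o))) i j * cexp (q_fun sigma (lchart phi w) o (block j)).
    rewrite coefE// mulmxDl mxE; congr (_ + _).
      by rewrite mul_diag_mx mxE mxE YhE -/d.
    by rewrite /Yh mulmxA mul_mx_diag [LHS]mxE [X in _ * X]mxE.
  rewrite RE; congr (cder _ _ _); apply: diagonalized_derivative; first exact: Epq.
  by rewrite /d mxE; case: eqVneq => [->|_]; rewrite ?mul0r.
have Yh_diff i j w o : right_of B w -> Omega o -> differentiable (fun x => Yh x.1 x.2 i j) (w, o).
  move=> Bw Oo.
  rewrite (_ : (fun x => _) = fun x => ((1%:M : 'M[R[i]]_n) i j + X x i j) *
      cexp (q_fun sigma (lchart phi x.1) x.2 (block j))); last first.
    by apply/funext => -[z o']; exact: YhE.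
  apply: holM; last exact: Eq_diff.
  by apply: holD; [exact: hol_cst|have [] := HX i j w o Bw Oo].
pose z0 : R[i] := (B + 1)%:C.
have Bz0 : right_of B z0 by rewrite /right_of/= ltrDl.
pose C o := Psi (lchart phi z0, o) *m Yh z0 o.
have [z00' az0 _ _] := lchart_right Bz0.
exists C; split.
  move=> i j o Oo; apply: hol_mulmx => i' j'.
    apply: (param_slice (f := fun x => Psi x i' j')).
    have [_ H _] := fundamental_pair ((ucover_right _).1 az0) Oo; exact: (H i' j').1.
  exact: (param_slice (f := fun x => Yh x.1 x.2 i' j')) (Yh_diff i' j' z0 o Bz0 Oo).
move=> o z Oo Bz e he i j.
have [z00 az _ _] := lchart_right Bz.
have [_ _ PsiPhi] := fundamental_pair ((ucover_right _).1 az) Oo.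
have CE : Psi (lchart phi z, o) *m Yh z o = C o.
  have star w (t : R) : right_of B w -> 0 <= t <= 1 -> right_of B (z0 + t%:C * (w - z0)).
    by move=> Bw t01; exact: right_of_star.
  apply: (@product_along_segment R (right_of B) z0 star n (fun z => z^-1 *: coefficient (lchart phi z, o))
    (fun z => Psi (lchart phi z, o)) (fun z => Yh z o) z) => //.
  - move=> i' j' w Bw; have [w0 aw _ _] := lchart_right Bw.
    have [_ H _] := fundamental_pair ((ucover_right _).1 aw) Oo.
    have := cder_comp (H i' j').2 (lchart_cder phi w0).
    rewrite -(scalemxAr w^-1 (Psi (lchart phi w, o)) (coefficient (lchart phi w, o))); congr (cder
        _ _ _); rewrite [in RHS]mxE mulNr; congr (- _).
    exact: mulrC.
  by move=> i' j' w Bw; exact: Yh_cder.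
have E : remainder (C o) (lchart phi z) o = X (z, o).
  rewrite /remainder -CE mulmxA (mulmx1C PsiPhi) mul1mx /Yh -mulmxA expqK mulmx1.
  by rewrite addrC addKr.
rewrite E; have [_ hX _] := HX i j z o Bz Oo; apply: hX => t.
exact: Gm_le.
Qed.

End FixedDirection.

Let n1_gt0 : 0 < n%:R + 1 :> R. Proof. by rewrite ltr_wpDl. Qed.

(** The threshold [B] serves all directions of a closed interval and all parameters; this uniformity
    is what allows a closed subsector to be covered later. *)
Lemma sectorial_solution c d : Sigma c -> Sigma d -> c <= d -> exists B : R -> R,
  (forall e, a <= B e) /\ forall x, c <= x <= d -> exists C : T -> 'M[R[i]]_n,
  (forall i j omega, Omega omega -> differentiable (fun o => C o i j) omega) /\
  forall e omega z, 0 < e -> Omega omega -> right_of (B e) z ->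
    forall i j, rn (remainder (C omega) (lchart (x + pi / 2) z) omega i j) <= e.
Proof.
move=> Sc Sd cd.
have [L HL] := monotone_exponents l_ge2 sigma0 sigma_gt0 sigma_decr Omega_neq0 Omega_connected
  Omega_bounded Omega_degrees Omega_enum tau_enum Sc Sd cd.
have [c1 c10 Hc1] := entries_le_norm N_norm.
pose ka : R := 4 * (n%:R + 1).
have ka0 : 0 < ka by rewrite mulr_gt0.
have HB e : exists B, 0 < e -> forall b phi omega, B < b -> c + pi / 2 <= phi <= d + pi / 2 -> Omega omega ->
    (\int[lebesgue_measure]_t (N (F (ell phi b t) omega))%:E <= (e / ka / c1)%:E)%E.
  have [e0|e0] := leP e 0; first by exists 0.
  have [||B HB] := @decay_small (c + pi / 2) (d + pi / 2) (e / ka / c1).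
  - by rewrite lerD2r.
  - by rewrite !divr_gt0.
  by exists B.
have [Bd HBd] := choice HB.
(* [a] keeps the half-plane in the domain, [e^L] makes the exponents monotone, and [Bd 1] bounds the
   decay integral by [1 / ka / c1], which gives the contraction since [4 n <= ka]. *)
pose B0 := Num.max a (Num.max (expR L) (Bd 1)).
exists (fun e => Num.max B0 (Bd e)); split; first by move=> e; rewrite !le_max lexx.
move=> x /[dup] xcd /andP[cx xd]; have [sgn Hsgn] := HL x xcd.
have phi_cd : c + pi / 2 <= x + pi / 2 <= d + pi / 2 by rewrite !lerD2r cx.
have B0L : L <= ln B0.
  rewrite -ler_expR lnK; first by rewrite !le_max lexx orbT.
  by rewrite posrE !lt_max a_gt0.
have [||||C [C1 C2]] := @sectorial_solution_direction (x + pi / 2) B0 sgn c1 (1 / ka) _ c10 _ Hc1.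
- by rewrite le_max lexx.
- by rewrite mulrA mulr1 ler_pdivrMr// mul1r /ka ler_pM2l// lerDl.
- move=> b omega; rewrite !gt_max => /andP[_ /andP[_ Bb]] Oo; exact: HBd.
- move=> omega i j w Oo warg Lw.
  have := Hsgn omega i j w Oo warg (le_trans B0L Lw).
  rewrite (_ : x + pi / 2 + pi / 2 = x + pi); last by lra.
  rewrite (_ : \sum_(k' < h.+1) _ = rate sigma w omega i - rate sigma w omega j)//.
  by rewrite /rate -sumrB; apply: eq_bigr => k' _; rewrite mulrBr mulrBl.
exists C; split => // e omega z e0 Oo; rewrite /right_of/= gt_max => /andP[B0z Bz] i j.
have := C2 omega z Oo B0z (e / ka) (HBd e e0 _ _ _ Bz phi_cd Oo) i j.
move/le_trans; apply; rewrite mulrA ler_pdivrMr// /ka.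
by rewrite mulrC ler_pM2l// ler_pM2l// lerDl.
Qed.

Definition asymptotic_on_ray (C : 'M[R[i]]_n) (omega : T) (th : R) : Prop :=
  forall e, 0 < e -> exists M, forall r, M <= r ->
    right_of (ln a) (r +i* th) /\ forall i j, rn (remainder C (r +i* th) omega i j) <= e.

Lemma remainderE C w omega : 1%:M + remainder C w omega = Phi (w, omega) *m C *m expNq w omega.
Proof. by rewrite /remainder addrC subrK. Qed.

Let e_half : R := (2 * (n%:R + 1))^-1.

Let e_half_gt0 : 0 < e_half. Proof. by rewrite invr_gt0 mulr_gt0. Qed.

Let e_halfP e : e <= e_half -> n%:R * e <= 2^-1.
Proof.
move=> ee; apply: (@le_trans _ _ (n%:R * e_half)); first by rewrite ler_wpM2l.
by rewrite /e_half ler_pdivrMr ?mulr_gt0// mulrA mulVf// mul1r lerDl.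
Qed.

Lemma asymptotic_unitmx C omega th : asymptotic_on_ray C omega th -> C \in unitmx.
Proof.
move=> /(_ _ e_half_gt0)[M /(_ M (lexx M))[_ H]].
have := add_small_unitmx H (e_halfP (lexx _)).
by rewrite remainderE !unitmx_mul => /andP[/andP[]].
Qed.

Lemma ray_rigidity x1 x2 omega C1 C2 : Sigma x1 -> Sigma x2 -> x1 <= x2 -> Omega omega ->
  (forall th, x2 < th < x1 + pi -> asymptotic_on_ray C1 omega th /\ asymptotic_on_ray C2 omega th) ->
  C1 = C2.
Proof.
move=> S1 S2 x12 Oo H; have co := subset_closure Oo.
have [Z HZ] := Sigma_bounded k l_ge2 sigma_gt0 Omega_neq0 Omega_degrees Omega_enum tau_enum.
have /andP[z1 z2] := HZ _ S1; have /andP[z3 z4] := HZ _ S2.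
pose th0 := (x2 + (x1 + pi)) / 2.
have th0P : x2 < th0 < x1 + pi by rewrite /th0; apply/andP; split; lra.
have C1u : C1 \in unitmx by have [h1 _] := H _ th0P; exact: asymptotic_unitmx h1.
have [M ME] : exists M, C1 *m M = C2 by exists (invmx C1 *m C2); rewrite mulmxA mulmxV// mul1mx.
suff M1 : M = 1%:M by rewrite -ME M1 mulmx1.
have key th e i j : x2 < th < x1 + pi -> 0 < e -> e <= e_half -> exists L, forall r, L <= r ->
    rn (M i j * cexp (q_fun sigma (r +i* th) omega (block i) - q_fun sigma (r +i* th) omega (block j)) -
      (1%:M : 'M[R[i]]_n) i j) <= 4 * e.
  move=> thP e0 ee; have [h1 h2] := H th thP.
  have [M1 HM1] := h1 e e0; have [M2 HM2] := h2 e e0.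
  exists (Num.max M1 M2) => r; rewrite ge_max => /andP[/HM1[_ E1] /HM2[_ E2]].
  set w := r +i* th in E1 E2 *.
  have := @quotient_bound _ _ _ _ (expq w omega *m M *m expNq w omega) e E1 E2 (e_halfP ee) (ltW e0).
  rewrite !remainderE !mulmxA -(mulmxA _ (expNq w omega) (expq w omega)) expqNK mulmx1.
  rewrite -(mulmxA (Phi _) C1) ME => /(_ erefl i j).
  rewrite mul_mx_diag mul_diag_mx [X in rn X](_ : _ =
    M i j * cexp (q_fun sigma w omega (block i) - q_fun sigma w omega (block j)) - (1%:M : 'M[R[i]]_n) i j)//.
  by rewrite !mxE cexpD; ring.
apply/matrixP => i j; apply/eqP; rewrite -subr_eq0 -rn_eq0 eq_le rn_ge0 andbT.
apply/ler_addgt0Pr => e e0; rewrite add0r.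
pose e' := Num.min (e / 4) e_half.
have e'0 : 0 < e' by rewrite lt_min divr_gt0.
have e'h : e' <= e_half by rewrite ge_min lexx orbT.
have e'e : 4 * e' <= e.
  have : e' <= e / 4 by rewrite ge_min lexx.
  by move=> ?; lra.
apply: le_trans e'e.
(* Within a block the two exponents are the same function, so any common ray gives the estimate; a
   special direction is needed only across blocks. *)
have [bij|bij] := eqVneq (block i) (block j).
  have [L HL] := key th0 e' i j th0P e'0 e'h.
  by have := HL L (lexx L); rewrite bij subrr cexp0 mulr1.
have [th thP [L0 HL0]] := dominance_direction sigma0 sigma_gt0 sigma_decr Omega_degrees Omega_enum tau_enum
  S1 S2 x12 co bij.
have [L HL] := key th e' i j thP e'0 e'h.
pose r := Num.max L0 L.
have r1 : L0 <= r by rewrite le_max lexx.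
have r2 : L <= r by rewrite le_max lexx orbT.
have ij : (i == j) = false by apply/eqP => eij; rewrite eij eqxx in bij.
have := HL r r2; have := HL0 r r1; rewrite [1%:M i j]mxE ij !subr0 rnM rn_cexp => p0.
apply: le_trans; rewrite -[X in X <= _]mulr1 ler_wpM2l ?rn_ge0//.
by rewrite -expR0 ler_expR.
Qed.

Let D := halfplanes [set x + pi / 2 | x in Sigma] a `&` ucover_gt a.

Lemma lchart_sector (x : R) (w : R[i]) (b ga : R) : a <= b -> 0 < ga -> ga < pi / 2 -> Sigma x ->
  `|uarg w - (x + pi / 2)| <= pi / 2 - ga -> b / sin ga < umod w ->
  exists z, [/\ lchart (x + pi / 2) z = w, right_of b z & D w].
Proof.
move=> ab ga0 gapi Sx warg bw.
have pi0 := @pi_gt0 R.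
have s0 : 0 < sin ga by apply: sin_gt0_pi; apply/andP; split; lra.
have wlt : `|uarg w - (x + pi / 2)| < pi / 2 by lra.
have [ReE zE] := lchartK wlt.
have cs := cos_ge_sin ga0 warg.
have w0 : 0 < umod w := expR_gt0 _.
have bc : b < umod w * cos (uarg w - (x + pi / 2)).
  by rewrite ltr_pdivrMr// in bw; apply: lt_le_trans bw _; rewrite ler_wpM2l// ltW.
have c0 : 0 < cos (uarg w - (x + pi / 2)) by exact: lt_le_trans cs.
exists (cexp (w - 0 +i* (x + pi / 2))); split => //.
  by change (b < complex.Re (cexp (w - 0 +i* (x + pi / 2)))); rewrite ReE.
split; last first.
  apply: (le_lt_trans ab); apply: (lt_le_trans bc); rewrite ler_piMr ?cos_le1//.
  exact: ltW.
exists (x + pi / 2); first by exists x.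
split; first by move: wlt; rewrite ltr_norml => /andP[? ?]; apply/andP; split; lra.
rewrite -[cos _]cosN opprB ler_pdivrMr// (le_trans ab)// ltW//.
Qed.

Lemma asymptotic_on_rays x (B : R -> R) C omega : Sigma x -> (forall e, a <= B e) ->
  (forall e z, 0 < e -> right_of (B e) z ->
    forall i j, rn (remainder C (lchart (x + pi / 2) z) omega i j) <= e) ->
  forall th, x < th < x + pi -> asymptotic_on_ray C omega th.
Proof.
move=> Sx aB HC th /andP[t1 t2] e1 e10; have pi0 := @pi_gt0 R.
have tlt : `|th - (x + pi / 2)| < pi / 2 by rewrite ltr_norml; apply/andP; split; lra.
have t0 := normr_ge0 (th - (x + pi / 2)).
pose g := (pi / 2 - `|th - (x + pi / 2)|) / 2.
have g0 : 0 < g by rewrite /g; lra.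
have gpi : g < pi / 2 by rewrite /g; lra.
have gle : `|th - (x + pi / 2)| <= pi / 2 - g by rewrite /g; lra.
have sg0 : 0 < sin g by apply: sin_gt0_pi; apply/andP; split; lra.
have b0 : 0 < B e1 / sin g by rewrite divr_gt0//; exact: lt_le_trans (aB e1).
exists (ln (B e1 / sin g + 1)) => r rM.
have rE : B e1 / sin g < umod (r +i* th).
  rewrite /umod/= (@lt_le_trans _ _ (B e1 / sin g + 1))// ?ltrDl//.
  by rewrite -ler_expR lnK// posrE addr_gt0 in rM.
have [z [zE Bz [_ aw]]] := @lchart_sector x (r +i* th) _ _ (aB e1) g0 gpi Sx gle rE.
split; first by apply/ucover_right.
by rewrite -zE; exact: HC.
Qed.

(** A point [w] is treated in the direction [x] nearest to [arg w - pi/2] in [[c', d']]; by the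
    choice of [ga] it keeps the angle [ga] from the edges of that half-plane. The matrix belonging
    to [x] is the given [C], by rigidity on the rays common to [x] and [x0]. *)
Lemma remainder_uniform (x0 : R) (C : T -> 'M[R[i]]_n) : Sigma x0 ->
  (forall omega th, Omega omega -> x0 < th < x0 + pi -> asymptotic_on_ray (C omega) omega th) ->
  forall c d e, inf Sigma < c -> c <= d -> d < sup Sigma + pi -> 0 < e ->
  exists M, forall w, c <= uarg w <= d -> M < umod w -> D w /\
    forall omega i j, Omega omega -> rn (remainder (C omega) w omega i j) <= e.
Proof.
move=> S0 HC c d e ic cd sd e0; have pi0 := @pi_gt0 R.
have [c1 Sc1 c1c] := Sigma_lt ic S0.
have [d1 Sd1 dd1] : exists2 z, Sigma z & d - pi < z by apply: Sigma_gt S0; lra.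
have [Z HZ] := Sigma_bounded k l_ge2 sigma_gt0 Omega_neq0 Omega_degrees Omega_enum tau_enum.
(* A closed interval inside [Sigma] that contains [x0] and leaves room on both sides: [c' < c] and
   [d < d' + pi]. *)
pose c' := Num.min (Num.min c1 x0) d1; pose d' := Num.max (Num.max c1 x0) d1.
have Sc' : Sigma c' by rewrite /c'; case: (leP c1 x0) => _; case: leP.
have Sd' : Sigma d' by rewrite /d'; case: (leP c1 x0) => _; case: leP.
have c'1 : c' <= c1 by rewrite /c' !ge_min lexx.
have c'0 : c' <= x0 by rewrite /c' !ge_min lexx orbT.
have d'0 : x0 <= d' by rewrite /d' !le_max lexx orbT.
have d'1 : d1 <= d' by rewrite /d' !le_max lexx !orbT.
have cd' : c' <= d' by exact: le_trans d'0.
have [B [aB HB]] := sectorial_solution Sc' Sd' cd'.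
pose ga := Num.min (Num.min (c - c') (d' + pi - d)) (pi / 3).
have ga0 : 0 < ga by rewrite /ga !lt_min !subr_gt0; apply/andP; split; [apply/andP; split; lra|lra].
have [ga1 ga2 ga3] : [/\ ga <= c - c', ga <= d' + pi - d & ga <= pi / 3].
  by rewrite /ga !ge_min !lexx ?orbT.
have gapi : ga < pi / 2 by lra.
have sector (x : R) (w : R[i]) e' := @lchart_sector x w (B e') ga (aB e') ga0 gapi.
have same x Cx omega : c' <= x <= d' -> Omega omega ->
    (forall e z, 0 < e -> right_of (B e) z ->
      forall i j, rn (remainder Cx (lchart (x + pi / 2) z) omega i j) <= e) -> Cx = C omega.
  move=> xcd Oo HCx.
  have Sx : Sigma x by exact: Sigma_convex Sc' Sd' xcd.
  have ray := asymptotic_on_rays Sx aB HCx.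
  have [xx|xx] := leP x x0.
    apply: (ray_rigidity Sx S0 xx Oo) => th /andP[t1 t2]; split.
      by apply: ray; apply/andP; split; lra.
    by apply: HC => //; apply/andP; split; lra.
  apply/esym; apply: (ray_rigidity S0 Sx (ltW xx) Oo) => th /andP[t1 t2]; split.
    by apply: HC => //; apply/andP; split; lra.
  by apply: ray; apply/andP; split; lra.
exists (B e / sin ga) => w /andP[w1 w2] wM.
pose x := Num.min (Num.max (uarg w - pi / 2) c') d'.
have xcd : c' <= x <= d'.
  by rewrite /x; apply/andP; split; [rewrite le_min cd' le_max lexx orbT|rewrite ge_min lexx orbT].
have Sx : Sigma x by exact: Sigma_convex Sc' Sd' xcd.
have warg : `|uarg w - (x + pi / 2)| <= pi / 2 - ga.
  rewrite ler_norml /x.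
  have [h1|h1] := leP (uarg w - pi / 2) c'.
    by rewrite min_l//; apply/andP; split; lra.
  have [h2|h2] := leP (uarg w - pi / 2) d'; apply/andP; split; lra.
have [z [zE Bz Dw]] := sector x w e Sx warg wM.
split => // omega i j Oo.
have [Cx [_ HCx]] := HB x xcd.
have CE : Cx omega = C omega.
  by apply: (same x) => // e1 z1 e10 Bz1; exact: HCx.
by rewrite -CE -zE; exact: HCx.
Qed.

Lemma D_right w : D w -> right_of (ln a) w.
Proof. by move=> [_ /ucover_right]. Qed.

Lemma D_radial w w' : D w -> uarg w' = uarg w -> complex.Re w <= complex.Re w' -> D w'.
Proof.
move=> [[phi Iphi [w1 w2]] aw] uu ww.
have mm : umod w <= umod w' by rewrite ler_expR.
split; last exact: lt_le_trans mm.
by exists phi => //; split; rewrite uu//; exact: le_trans mm.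
Qed.

Lemma Sigma_inf_sup x : Sigma x -> inf Sigma <= x <= sup Sigma.
Proof.
move=> Sx.
have [Z HZ] := Sigma_bounded k l_ge2 sigma_gt0 Omega_neq0 Omega_degrees Omega_enum tau_enum.
apply/andP; split.
  by apply: ge_inf => //; exists (Z - pi) => t /HZ /andP[/ltW].
by apply: ub_le_sup => //; exists Z => t /HZ /andP[_ /ltW].
Qed.

Lemma D_sector w : D w -> inf Sigma < uarg w < sup Sigma + pi.
Proof.
move=> [[_ [x Sx <-] [/andP[w1 w2] _]] _]; have /andP[i1 i2] := Sigma_inf_sup Sx.
by apply/andP; split; lra.
Qed.

Section Uniqueness.
Hypothesis D_large : forall c d, inf Sigma < c -> c <= d -> d < sup Sigma + pi ->
  exists M, forall w, c <= uarg w <= d -> M < umod w -> D w.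
Variables (Y : R[i] -> T -> 'M[R[i]]_n) (omega : T).
Hypothesis omega_in : Omega omega.
Hypothesis Y_ode : forall w, D w ->
  is_dz (Y ^~ omega) w ((Lambda_mx s sigma w omega + F w omega) *m Y w omega).

Let K w := Psi (w, omega) *m Y w omega.

Let K_cder i j w : D w -> cder (fun z => K z i j) w 0.
Proof.
move=> Dw; have [_ HPsi _] := fundamental_pair (D_right Dw) omega_in.
have HY m m' : cder (fun z => Y z omega m m') w ((coefficient (w, omega) *m Y w omega) m m').
  have := (is_dzP _ _ _).1 (Y_ode Dw) m m' => /derivable_cder.
  by rewrite /coefficient/= -scalemxAl [X in _ -> cder _ _ X]mxE.
have := @cder_mulmx _ _ _ _ (fun z => Psi (z, omega)) (Y ^~ omega)
  (- (Psi (w, omega) *m coefficient (w, omega))) (coefficient (w, omega) *m Y w omega) w _ HY i j.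
rewrite mulNmx -mulmxA addNr mxE; apply=> i' j'.
by rewrite mxE; exact: (HPsi i' j').2.
Qed.

Let K_radial w (r : R) : D w -> complex.Re w <= r -> K (r +i* uarg w) = K w.
Proof.
move=> Dw wr; apply/matrixP => i j.
have t0 : 0 <= r - complex.Re w by rewrite subr_ge0.
have := @cder_zero_path R (fun z => K z i j) w 1 0 (r - complex.Re w) t0.
rewrite mul0r addr0 (_ : w + _ = r +i* uarg w); last first.
  by apply/eqP; rewrite eq_complex !ReImE/= mulr1 !mulr0 mul0r subr0 !addr0 addrC subrK !eqxx.
apply=> t /andP[t1 t2]; apply: K_cder; apply: (D_radial Dw).
  by rewrite /uarg mulr1 cImD/= addr0.
by rewrite mulr1 cReD/= lerDl.
Qed.

(** Both points are moved outwards along their rays, which stay in [D], to a common modulus so large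
    that the arc between the rays lies in [D] too. [K] has derivative zero along all three
    pieces. *)
Lemma solution_constant w1 w2 : D w1 -> D w2 -> K w1 = K w2.
Proof.
wlog le12 : w1 w2 / uarg w1 <= uarg w2.
  move=> H D1 D2; have [le12|/ltW le21] := leP (uarg w1) (uarg w2); first exact: H.
  by apply/esym; exact: H.
move=> D1 D2.
have /andP[i1 _] := D_sector D1; have /andP[_ i2] := D_sector D2.
have [M HM] := D_large i1 le12 i2.
(* [r] is the logarithm of the common modulus; [e^r >= 1 + r > M]. *)
pose r := Num.max (Num.max (complex.Re w1) (complex.Re w2)) (`|M|).
have r1 : complex.Re w1 <= r by rewrite !le_max lexx.
have r2 : complex.Re w2 <= r by rewrite !le_max lexx orbT.
have rM : `|M| <= r by rewrite !le_max lexx !orbT.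
have Mr : M < expR r.
  have := expR_ge1Dx r; have := ler_norm M; lra.
rewrite -(K_radial D1 r1) -(K_radial D2 r2); apply/matrixP => i j.
have arcE (t : R) : r%:C + t%:C * 'i%C = r +i* t.
  by apply/eqP; rewrite eq_complex !ReImE/= mulr0 mul0r mulr1 subr0 mul0r !addr0 add0r !eqxx.
have := @cder_zero_path R (fun z => K z i j) r%:C 'i%C (uarg w1) (uarg w2) le12.
rewrite !arcE => H; apply/esym; apply: H => t t12.
by rewrite arcE; apply: K_cder; exact: HM.
Qed.

End Uniqueness.

(** The solution is [Phi C] with [C] taken from one arbitrary direction [x0]. Any other is [Phi C']
    with [C'] constant on [D], and its asymptotics on the rays [x0 < arg z < x0 + pi] force
    [C' = C]. *)
Lemma fundamental_solution_exists_unique :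
  let is_Y := fundamental_solution sigma N F D Omega (inf Sigma) (sup Sigma + pi) in
  exists Y, is_Y Y /\
    forall Y', is_Y Y' -> forall w omega, D w -> Omega omega -> Y' w omega = Y w omega.
Proof.
move=> is_Y; have [x0 S0] := k_adequate; have pi0 := @pi_gt0 R.
have [B [aB HB]] := sectorial_solution S0 S0 (lexx x0).
have [|C [C_diff HC]] := HB x0; first by rewrite lexx.
have ray omega th : Omega omega -> x0 < th < x0 + pi -> asymptotic_on_ray (C omega) omega th.
  move=> Oo; apply: (asymptotic_on_rays S0 aB) => e z e0 Bz i j; exact: HC.
have RU := remainder_uniform S0 ray.
have D_large c d : inf Sigma < c -> c <= d -> d < sup Sigma + pi ->
    exists M, forall w, c <= uarg w <= d -> M < umod w -> D w.
  move=> ic cd sd; have [M HM] := RU c d 1 ic cd sd ltr01.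
  by exists M => w wcd wM; have [] := HM w wcd wM.
have [KN KN0 HKN] := norm_le_entries N_norm.
pose Y w omega := Phi (w, omega) *m C omega.
have Y_ode w omega : D w -> Omega omega ->
    is_dz (Y ^~ omega) w ((Lambda_mx s sigma w omega + F w omega) *m Y w omega).
  move=> Dw Oo; have [HPhi _ _] := fundamental_pair (D_right Dw) Oo.
  apply/is_dzP => i j.
  have -> : cexp w * ((Lambda_mx s sigma w omega + F w omega) *m Y w omega) i j =
      (coefficient (w, omega) *m Phi (w, omega) *m C omega + Phi (w, omega) *m 0) i j.
    by rewrite mulmx0 addr0 -mulmxA /coefficient/= -scalemxAl [in RHS]mxE.
  have dC i' j' : cder (fun=> C omega i' j') w ((0 : 'M[R[i]]_n) i' j').
    by rewrite mxE; exact: cder_cst.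
  have [_] := cder_differentiable (@cder_mulmx _ _ _ _ (fun z => Phi (z, omega)) (fun=> C omega)
    (coefficient (w, omega) *m Phi (w, omega)) 0 w (fun i j => (HPhi i j).2) dC i j).
  exact.
exists Y; split; first split.
- move=> w omega Dw Oo; have [HPhi _ _] := fundamental_pair (D_right Dw) Oo.
  apply/differentiable_entries => i j.
  rewrite (_ : (fun x => _) = fun x : (R[i] * T)%type => (Phi x *m C x.2) i j); last first.
    by apply/funext => -[].
  apply: hol_mulmx.
    by move=> i' j'; exact: (HPhi i' j').1.
  move=> i' j'.
  apply: (@differentiable_comp _ _ _ _ (fun x : (R[i] * T)%type => x.2) (fun o => C o i' j')).
    exact: differentiable_snd.
  exact: C_diff.
- move=> w omega Dw Oo; have [_ _ PP] := fundamental_pair (D_right Dw) Oo.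
  rewrite unitmx_mul; apply/andP; split; first by have [] := mulmx1_unit PP.
  apply: (asymptotic_unitmx (th := x0 + pi / 2) (omega := omega)).
  by apply: ray => //; apply/andP; split; lra.
- exact: Y_ode.
- exists (fun w omega => remainder (C omega) w omega); split.
    move=> w omega Dw Oo; rewrite remainderE mexp_QE -(mulmxA _ (expNq w omega) (expq w omega)) expqNK mulmx1.
    by [].
  move=> c d eps ic cd sd eps0.
  have e0 : 0 < eps / KN / 2 by rewrite !divr_gt0.
  have [M HM] := RU c d _ ic cd sd e0; exists M => w omega wcd wM Oo.
  have [Dw Hw] := HM w wcd wM; split => //.
  apply: (le_lt_trans (HKN _ _ (ltW e0) (fun i j => Hw omega i j Oo))).
  rewrite mulrA (mulrC KN) divfK ?gt_eqF//; lra.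
move=> Y' [_ _ Y'_ode [E [Y'E HE]]] w omega Dw Oo.
have [c1 c10 Hc1] := entries_le_norm N_norm.
have [_ _ PP] := fundamental_pair (D_right Dw) Oo.
pose C' := Psi (w, omega) *m Y' w omega.
have Y'C z : D z -> Y' z omega = Phi (z, omega) *m C'.
  move=> Dz; have [_ _ PPz] := fundamental_pair (D_right Dz) Oo.
  rewrite /C' (solution_constant D_large Oo (fun z Dz => Y'_ode z omega Dz Oo) Dw Dz).
  by rewrite mulmxA (mulmx1C PPz) mul1mx.
have /andP[i1 i2] := Sigma_inf_sup S0.
suff CE : C' = C omega by rewrite Y'C// CE.
apply: (ray_rigidity S0 S0 (lexx x0) Oo) => th thP; split; last exact: ray.
move=> e e0; have /andP[t1 t2] := thP.
have ec : 0 < e / c1 by rewrite divr_gt0.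
have [||M HM] := HE th th (e / c1) _ (lexx th) _ ec; [exact: le_lt_trans t1|lra|].
exists `|M| => r rM.
have Mr : M < umod (r +i* th).
  by rewrite /umod/=; have := expR_ge1Dx r; have := ler_norm M; lra.
have [|Dr Er] := HM (r +i* th) omega _ Mr Oo; first by rewrite /uarg/= lexx.
split; first exact: D_right.
have -> : remainder C' (r +i* th) omega = E (r +i* th) omega.
  by rewrite /remainder -Y'C// Y'E// mexp_QE -mulmxA expqK mulmx1 addrC addKr.
move=> i j; apply: (le_trans (Hc1 _ i j)); apply: ltW.
by move: Er; rewrite ltr_pdivlMr// mulrC.
Qed.

End Sectors.

Theorem theorem3p23 (R : realType) (a : R) (l h : nat) (s : 'I_l -> nat)
    (sigma : 'I_h.+1 -> R) (Omega : set 'M[R[i]]_(l, h.+1))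
    (N : 'M[R[i]]_(\sum_(i < l) s i) -> R)
    (F : R[i] -> 'M[R[i]]_(l, h.+1) -> 'M[R[i]]_(\sum_(i < l) s i))
    (eta : R) (mu : nat) (sg : 'I_mu -> R)
    (tau : 'I_mu -> 'M[R[i]]_(l, h.+1) -> R) (k : 'I_mu -> int)
    (a_gt0 : 0 < a) (l_ge2 : (2 <= l)%N)
    (s_gt0 : forall i, (0 < s i)%N)
    (sigma0 : sigma ord0 = 1)
    (sigma_gt0 : forall j, 0 < sigma j)
    (sigma_decr : forall j j' : 'I_h.+1, (j < j')%N -> sigma j' < sigma j)
    (N_norm : is_norm N)
    (Omega_neq0 : Omega !=set0) (Omega_open : open Omega)
    (Omega_connected : connected Omega) (Omega_bounded : bounded_set Omega)
    (Omega_degrees : constant_degrees Omega)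
    (Omega_enum : preserved_enumeration eta Omega)
    (F_holo : holomorphic_on (ucover_gt a) Omega F)
    (F_decay : forall I : set R, open I -> is_interval I ->
       good_decay N a Omega F I)
    (tau_enum : tau_enumeration sigma eta Omega sg tau)
    (k_adequate : Sigma_set Omega sg tau k !=set0) :
  let Sigma := Sigma_set Omega sg tau k in
  let D := halfplanes [set x + pi / 2 | x in Sigma] a `&` ucover_gt a in
  let is_Y :=
    fundamental_solution sigma N F D Omega (inf Sigma) (sup Sigma + pi) in
  exists Y, is_Y Y /\
    forall Y', is_Y Y' -> forall w omega, D w -> Omega omega ->
      Y' w omega = Y w omega.
Proof.
(* In the coordinate [w] the domain [|z| > a] is a half-plane, star-shaped about [ln a + 1], so
   [Phi] and [Psi] exist on all of it. *)
have base : right_of (ln a) (ln a + 1)%:C by rewrite /right_of/= ltrDl.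
have star w (t : R) : right_of (ln a) w -> 0 <= t <= 1 ->
  right_of (ln a) ((ln a + 1)%:C + t%:C * (w - (ln a + 1)%:C)) by exact: right_of_star.
have dA := coefficient_differentiable sigma a_gt0 F_holo.
have [Phi [Psi HP]] := fundamental_pair_exists (@right_of_open R (ln a)) (Omega_ball Omega_open) star base dA.
exact: (fundamental_solution_exists_unique a_gt0 l_ge2 sigma0 sigma_gt0 sigma_decr N_norm Omega_neq0
  Omega_open Omega_connected Omega_bounded Omega_degrees Omega_enum F_holo F_decay tau_enum k_adequate HP).
Qed.
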